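(* Let $\alpha_+,\alpha_-,\alpha_+',\alpha_-'\in\mathbb{R}$ be such that the Cahen-Wallach space $M_B$ is indecomposable (i.e. $B$ is non-degenerate: $\alpha_-\neq\pm\alpha_+'$ and $\alpha_+\neq\pm\alpha_+'$), and such that the connection $D$ is non-flat, with $M_B,D,\mathcal{K}_0,\mathcal{K}_1,\mathcal{L},\{\cdot,\cdot\}$ as defined in the context. Then $M_B$ along with the connection $D$ defines a non-restricted geometric superalgebra, where: - the even and odd parts of the underlying graded vector space are $\mathcal{K}_0$ and $\mathcal{K}_1$, respectively; - the product structure is given by the usual commutator on $\mathcal{K}_0$, completed by the even-odd bracket $[K,\vec\xi]=\mathcal{L}_K\vec\xi$ given by the spinorial Lie derivative, and by the odd-odd bracket $\{\cdot,\cdot\}:\mathcal{K}_1\times\mathcal{K}_1\to\mathcal{K}_0$.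
   Context: **Metric.** Let $V=\mathbb{R}^9$ with standard Euclidean metric and orthonormal basis $e_1,\dots,e_9$. For real parameters $\alpha_+,\alpha_-,\alpha_+',\alpha_-'$ put $\lambda_1=\lambda_2=-i(\alpha_--\alpha_+')$, $\lambda_3=\lambda_4=-i(\alpha_-+\alpha_+')$, $\lambda_5=-i(\alpha_+-\alpha_+')$, $\lambda_6=\dots=\lambda_9=-i(\alpha_++\alpha_+')$, and $B=\mathrm{diag}(\lambda_1^2,\dots,\lambda_9^2)$ (a real symmetric endomorphism of $V$). The eleven-dimensional Cahen-Wallach space $M_B$ is $\mathbb{R}^{11}$ with coordinates $x^+,x^-,x^1,\dots,x^9$ and Lorentzian metric $g_B=2dx^+dx^--\sum_i\lambda_i^2(x^i)^2(dx^-)^2+\sum_i(dx^i)^2$. It is indecomposable if and only if $B$ is non-degenerate. **Spinors.** The Clifford convention is $vw+wv=-2g(v,w)$. $S(V)=\mathbb{C}^{16}$ is the irreducible complex module of $C\ell(V)$ with generators $\gamma_1,\dots,\gamma_9$, $\gamma_i\gamma_j+\gamma_j\gamma_i=-2\delta_{ij}$; multi-indices denote antisymmetrized products, e.g. $\gamma_{125}=\gamma_1\gamma_2\gamma_5$. The spinor space of $W=\mathbb{R}^{1,1}\oplus V$ is $S(W)=S^-\oplus S^+$ with $S^\pm\cong S(V)$, elements written $\vec\eta=(\eta_1,\eta_2)^t$, $\eta_1\in S^-$, $\eta_2\in S^+$, and $\Gamma_+=\sqrt2\begin{pmatrix}0&\mathbf 1\\0&0\end{pmatrix}$, $\Gamma_-=\sqrt2\begin{pmatrix}0&0\\-\mathbf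 1&0\end{pmatrix}$, $\Gamma_i=\begin{pmatrix}-\gamma_i&0\\0&\gamma_i\end{pmatrix}$. The spinor bundle $S$ of $M_B$ is trivialized by the global frame $\partial_+,\ \partial_-+\tfrac12\sum_i\lambda_i^2(x^i)^2\partial_+,\ \partial_i$, so spinor fields are functions $\vec\xi=(\xi_1,\xi_2)^t$ with values in $S(W)$. In this trivialization the Levi-Civita spin connection is $\nabla_+=\partial_+$, $\nabla_i=\partial_i$, $\nabla_-=\partial_-+\tfrac12\sum_i\lambda_i^2x^i\Gamma_+\Gamma_i$. **The pair $(\bar c,d)$ and the connection $D$.** Put $X^\pm_{1234}=\tfrac12(\mathbf 1\pm\gamma_{1234})$ and $\bar c=(\alpha_+X^+_{1234}+\alpha_-X^-_{1234})\gamma_{125}$, $d=(\alpha_+'X^+_{1234}+\alpha_-'X^-_{1234})\gamma_{125}$, elements of $C\ell(V)$. For $v\in V$ let $s_{\bar c,d}(v)=\bar c v-vd\in C\ell(V)$. The connection $D$ on $S$ is $D_+=\nabla_+$, $D_i\vec\xi=\nabla_i\vec\xi-\tfrac1{\sqrt2}(s_{\bar c,d}(e_i)\xi_2,0)^t$, $D_-\vec\xi=\nabla_-\vec\xi+(\bar c\xi_1,d\xi_2)^t$. **$\mathcal{K}_1$.** $\mathcal{K}_1$ is the 24-dimensional space of spinor fields $\vec\xi=\vec\xi(\xi_1^0,\xi_2^0)$ of the form $\xi_2=\exp(-x^-d)\xi_2^0$, $\ \xi_1=\exp(-x^-\bar c)\xi_1^0+\tfrac1{\sqrt2}\sum_{i=1}^9x^i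 s_{\bar c,d}(e_i)\exp(-x^-d)\xi_2^0$, with constant $\xi_1^0,\xi_2^0\in S(V)$ and $X^-_{1234}\xi_2^0=0$. **$\mathcal{K}_0$.** $\mathcal{K}_0$ is the Lie algebra (with the commutator of vector fields; complexified, since the brackets below have complex coefficients) of Killing vector fields of $g_B$ spanned by $K_{(+)}=-\partial_+$, $K_{(-)}=-\partial_-$, $K_{(i)}=\cos(\lambda_ix^-)\partial_i+\lambda_i\sin(\lambda_ix^-)x^i\partial_+$, $K_{(i^* )}=-\lambda_i\sin(\lambda_ix^-)\partial_i+\lambda_i^2\cos(\lambda_ix^-)x^i\partial_+$ for $1\le i\le9$, and $K_{(ij)}=x^j\partial_i-x^i\partial_j$ for $(ij)\in\{1,2\}^2\cup\{3,4\}^2\cup\{6,7,8,9\}^2$. **Spinorial Lie derivative.** For a Killing vector field $K$: $\mathcal{L}_K\vec\xi=\nabla_K\vec\xi-\tfrac14\sum_{\mu\nu}(\nabla_\mu K_\nu)\Gamma^{\mu\nu}\vec\xi$, where $\Gamma^{\mu\nu}=\tfrac12[\Gamma^\mu,\Gamma^\nu]$ and components refer to the global frame $\partial_+,\ \partial_-+\tfrac12\sum_i\lambda_i^2(x^i)^2\partial_+,\ \partial_i$ (so $\Gamma^{\pm}=\Gamma_{\mp}$). **Charge conjugation.** $C_V$ is the non-degenerate symmetric complex bilinear form on $S(V)$ (unique up to scale) with $C_V(\gamma_iu,v)=C_V(u,\gamma_iv)$, and $C$ is the skew-symmetric bilinear form on $S(W)$ given by $C(\vec\xi,\vec\eta)=-i\,C_V(\xi_1,\eta_2)+i\,C_V(\xi_2,\eta_1)$.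 **Odd-odd bracket.** For $\vec\xi=\vec\xi(\xi_1^0,\xi_2^0)$, $\vec\eta=\vec\xi(\eta_1^0,\eta_2^0)$ in $\mathcal{K}_1$, where $\xi_1^0,\eta_1^0$ are regarded as elements of $S^-$ and $\xi_2^0,\eta_2^0$ as elements of $S^+$, $$\begin{aligned}\{\vec\xi,\vec\eta\}=&\ C(\xi_1^0,\Gamma_-\eta_1^0)K_{(+)}+C(\xi_2^0,\Gamma_+\eta_2^0)K_{(-)}+\sum_{i=1}^9\big(C(\xi_1^0,\Gamma_i\eta_2^0)+C(\eta_1^0,\Gamma_i\xi_2^0)\big)K_{(i)}\\&+\sum_{i=1}^9\tfrac{i}{\lambda_i}\big(C(\xi_1^0,\Gamma_{125}\Gamma_i\eta_2^0)+C(\eta_1^0,\Gamma_{125}\Gamma_i\xi_2^0)\big)K_{(i^* )}\\&+i\lambda_1C(\xi_2^0,\Gamma_+\Gamma_5\eta_2^0)K_{(12)}+i\lambda_3C(\xi_2^0,\Gamma_+\Gamma_{12345}\eta_2^0)K_{(34)}+\tfrac{i\lambda_6}{2}\sum_{j,k=6}^9C(\xi_2^0,\Gamma_+\Gamma_{125jk}\eta_2^0)K_{(jk)},\end{aligned}$$ where in the prefactors the non-subscript $i$ is the imaginary unit. **Geometric superalgebra.** $\mathcal{K}_0\oplus\mathcal{K}_1$ is a geometric superalgebra if: $\mathcal{K}_0$ is a Lie algebra of Killing vector fields; $\mathcal{K}_1$ is a subspace of the space $\{\vec\xi\,|\,D\vec\xi=0\}$ of $D$-parallel sections; $\mathcal{L}:\mathcal{K}_0\to\mathrm{End}(\mathcal{K}_1)$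 is well defined with $[\mathcal{L}_X,\mathcal{L}_Y]=\mathcal{L}_{[X,Y]}$ for $X,Y\in\mathcal{K}_0$; and $\{\cdot,\cdot\}:\mathcal{K}_1\times\mathcal{K}_1\to\mathcal{K}_0$ is a symmetric bilinear map with $[X,\{\vec\xi,\vec\eta\}]=\{\mathcal{L}_X\vec\xi,\vec\eta\}+\{\vec\xi,\mathcal{L}_X\vec\eta\}$ for all $X\in\mathcal{K}_0$, $\vec\xi,\vec\eta\in\mathcal{K}_1$. It is called non-restricted if $\mathcal{K}_1$ is the full space of $D$-parallel sections.
   Formalization: In the odd-odd bracket, K_(i) and K_(ij) are taken with the sign opposite to the printed one (the span K_0 is unchanged): with the printed signs [X,{ξ,η}]={L_Xξ,η}+{ξ,L_Xη} fails for X=K_(-), since the K_(i)-components of the two sides are opposite and not identically zero. *)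

(* Defs.v *)
From HB Require Import structures.
From mathcomp Require Import all_boot all_order all_algebra.
From mathcomp Require Import complex.
From mathcomp Require Import all_classical all_reals all_analysis.

Set Implicit Arguments.
Unset Strict Implicit.
Unset Printing Implicit Defensive.

Import Order.TTheory GRing.Theory Num.Theory.
Import numFieldNormedType.Exports.

Local Open Scope classical_set_scope.
Local Open Scope ring_scope.
Local Open Scope complex_scope.

(** * Coordinates

    'I_11 = 'I_(2 + 9) indexes x^+, x^-, x^1, ..., x^9 in this order, and 'I_9
    indexes e_1, ..., e_9, so the 1-based label k is the ordinal k - 1. *)

Definition lab (k : nat) : 'I_9 := inord k.-1.

Definition labs (s : seq nat) : seq 'I_9 := map lab s.

Definition ix_p : 'I_11 := @lshift 2 9 ord0.
Definition ix_m : 'I_11 := @lshift 2 9 ord_max.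
Definition ix (i : 'I_9) : 'I_11 := @rshift 2 9 i.

Definition by_index (T : Type) (p m : T) (f : 'I_9 -> T) (mu : 'I_11) : T :=
  match @fintype.split 2 9 mu with
  | inl k => if k == ord0 then p else m
  | inr i => f i
  end.

Notation pt R := 'rV[R]_11.

(** All fields are complexified; a spinor is the column (xi_1, xi_2) with
    xi_1 in S^- = C^16 and xi_2 in S^+ = C^16. *)
Notation vfield R := (pt R -> 'cV[R[i]]_11).
Notation spinor R := 'cV[R[i]]_(16 + 16).
Notation sfield R := (pt R -> spinor R).
Notation gammas R := ('I_9 -> 'M[R[i]]_16).

Section Calculus.
Variable R : realType.
Local Notation C := R[i].

Definition xcoord (mu : 'I_11) (p : pt R) : R := p 0 mu.

Definition pd (mu : 'I_11) (f : pt R -> R) (p : pt R) : R :=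
  'D_(delta_mx 0 mu) f p.

Definition pdC (mu : 'I_11) (f : pt R -> C) (p : pt R) : C :=
  (pd mu (fun q => complex.Re (f q)) p) +i* (pd mu (fun q => complex.Im (f q)) p).

Definition pdV n (mu : 'I_11) (f : pt R -> 'cV[C]_n) (p : pt R) : 'cV[C]_n :=
  \col_k pdC mu (fun q => f q k 0) p.

(** C^infinity: every iterated partial derivative is differentiable. *)
Definition smoothR (f : pt R -> R) : Prop :=
  forall (s : seq 'I_11) (p : pt R), differentiable (foldr pd f s) p.

Definition smooth n (f : pt R -> 'cV[C]_n) : Prop :=
  forall k, smoothR (fun p => complex.Re (f p k 0)) /\
            smoothR (fun p => complex.Im (f p k 0)).

Definition expC (z : C) : C :=
  (expR (complex.Re z))%:C * (cos (complex.Im z) +i* sin (complex.Im z)).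
Definition cosC (z : C) : C := (expC ('i * z) + expC (- ('i * z))) / 2.
Definition sinC (z : C) : C := (expC ('i * z) - expC (- ('i * z))) / (2 * 'i).

Definition limC (u : nat -> C) : C :=
  (limn (fun n => complex.Re (u n))) +i* (limn (fun n => complex.Im (u n))).

Definition expM n (A : 'M[C]_n.+1) : 'M[C]_n.+1 :=
  \matrix_(a, b) limC (fun N => (\sum_(k < N) (k`!%:R^-1 : C) *: A ^+ k) a b).

End Calculus.

Section Geometry.
Variable R : realType.
Local Notation C := R[i].

Definition lie_bracket (X Y : vfield R) : vfield R := fun p =>
  \sum_mu (X p mu 0 *: pdV mu Y p - Y p mu 0 *: pdV mu X p).

Variable g : pt R -> 'M[R]_11.

(** Smooth complexified solutions of L_K g = 0. *)
Definition killing (K : vfield R) : Prop :=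
  smooth K /\ forall p mu nu,
    \sum_rho (K p rho 0 * (pd rho (fun q => g q mu nu) p)%:C
              + (g p rho nu)%:C * pdV mu K p rho 0
              + (g p mu rho)%:C * pdV nu K p rho 0) = 0.

Definition christoffel (rho mu nu : 'I_11) (p : pt R) : R :=
  2^-1 * \sum_sigma invmx (g p) rho sigma *
    (pd mu (fun q => g q nu sigma) p + pd nu (fun q => g q mu sigma) p
     - pd sigma (fun q => g q mu nu) p).

Definition levi_civita (mu : 'I_11) (K : vfield R) : vfield R := fun p =>
  \col_rho (pdV mu K p rho 0
            + \sum_nu (christoffel rho mu nu p)%:C * K p nu 0).

(** nabla_a K_b = g (nabla_{E_a} K, E_b) in a frame E. *)
Definition cov_frame (E : 'I_11 -> vfield R) (K : vfield R) (a b : 'I_11)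
    (p : pt R) : C :=
  \sum_mu \sum_nu \sum_rho
     E a p mu 0 * (g p nu rho)%:C * levi_civita mu K p nu 0 * E b p rho 0.

End Geometry.

Section Connections.
Variable R : realType.
Local Notation C := R[i].

(** A connection is given by its values on the coordinate fields. *)
Variable D : 'I_11 -> sfield R -> sfield R.

Definition along (X : vfield R) (xi : sfield R) : sfield R := fun p =>
  \sum_mu X p mu 0 *: D mu xi p.

Definition parallel : set (sfield R) :=
  [set xi | smooth xi /\ forall mu p, D mu xi p = 0].

Definition curvature (X Y : vfield R) (xi : sfield R) : sfield R := fun p =>
  along X (along Y xi) p - along Y (along X xi) p - along (lie_bracket X Y) xi p.

Definition flat : Prop :=
  forall X Y xi, smooth X -> smooth Y -> smooth xi ->
  forall p, curvature X Y xi p = 0.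

End Connections.

Section Superalgebra.
Variable R : realType.
Local Notation C := R[i].

Definition is_subspace (V : lmodType C) (U : set V) : Prop :=
  U 0 /\ forall (a : C) u v, U u -> U v -> U (a *: u + v).

Definition lspan (V : lmodType C) (S : set V) : set V :=
  [set v | exists n (a : 'I_n -> C) (w : 'I_n -> V),
     (forall k, S (w k)) /\ v = \sum_k a k *: w k].

(** [L] and [br] are only constrained on K0 and K1. *)
Record geometric_superalgebra (g : pt R -> 'M[R]_11)
    (D : 'I_11 -> sfield R -> sfield R)
    (K0 : set (vfield R)) (K1 : set (sfield R))
    (L : vfield R -> sfield R -> sfield R)
    (br : sfield R -> sfield R -> vfield R) : Prop := {
  even_subspace : is_subspace K0;
  even_closed : forall X Y, K0 X -> K0 Y -> K0 (lie_bracket X Y);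
  even_killing : forall X, K0 X -> killing g X;
  odd_subspace : is_subspace K1;
  odd_parallel : K1 `<=` parallel D;
  lie_stable : forall X xi, K0 X -> K1 xi -> K1 (L X xi);
  lie_linear_odd : forall X (a : C) xi eta, K0 X -> K1 xi -> K1 eta ->
    L X (a *: xi + eta) = a *: L X xi + L X eta;
  lie_linear_even : forall (a : C) X Y xi, K0 X -> K0 Y -> K1 xi ->
    L (a *: X + Y) xi = a *: L X xi + L Y xi;
  lie_morphism : forall X Y xi, K0 X -> K0 Y -> K1 xi ->
    L X (L Y xi) - L Y (L X xi) = L (lie_bracket X Y) xi;
  bracket_even : forall xi eta, K1 xi -> K1 eta -> K0 (br xi eta);
  bracket_sym : forall xi eta, K1 xi -> K1 eta -> br xi eta = br eta xi;
  bracket_linear : forall (a : C) xi eta zeta, K1 xi -> K1 eta -> K1 zeta ->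
    br (a *: xi + eta) zeta = a *: br xi zeta + br eta zeta;
  bracket_derivation : forall X xi eta, K0 X -> K1 xi -> K1 eta ->
    lie_bracket X (br xi eta) = br (L X xi) eta + br xi (L X eta)
}.

Definition nonrestricted_geometric_superalgebra g D K0 K1 L br : Prop :=
  geometric_superalgebra g D K0 K1 L br /\ K1 = parallel D.

End Superalgebra.

Section Clifford.
Variable R : realType.
Local Notation C := R[i].
Variable gamma : gammas R.

(** A 16-dimensional module over the complex Clifford algebra in dimension 9 is
    automatically irreducible. *)
Definition clifford_rep : Prop :=
  forall i j, gamma i * gamma j + gamma j * gamma i = (- (2 * (i == j)%:R))%:M.

Record charge_conjugation (CV : 'cV[C]_16 -> 'cV[C]_16 -> C) : Prop := {
  cc_linear_l : forall v (a : C) u w, CV (a *: u + w) v = a * CV u v + CV w v;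
  cc_linear_r : forall u (a : C) v w, CV u (a *: v + w) = a * CV u v + CV u w;
  cc_sym : forall u v, CV u v = CV v u;
  cc_nondegenerate : forall u, (forall v, CV u v = 0) -> u = 0;
  cc_gamma : forall i u v, CV (gamma i *m u) v = CV u (gamma i *m v)
}.

(** Antisymmetrized products: as distinct generators anticommute, this is the
    plain product for distinct indices and 0 if an index is repeated. *)
Definition gammaI (s : seq 'I_9) : 'M[C]_16 :=
  if uniq s then \prod_(k <- s) gamma k else 0.

Definition Gamma_p : 'M[C]_(16 + 16) := (Num.sqrt 2)%:C *: block_mx 0 1%:M 0 0.
Definition Gamma_m : 'M[C]_(16 + 16) := (Num.sqrt 2)%:C *: block_mx 0 0 (- 1%:M) 0.
Definition Gamma (i : 'I_9) : 'M[C]_(16 + 16) :=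
  block_mx (- gamma i) 0 0 (gamma i).

Definition GammaI (s : seq 'I_9) : 'M[C]_(16 + 16) :=
  if uniq s then \big[mulmx/1%:M]_(k <- s) Gamma k else 0.

(** Gamma^mu, with Gamma^+ = Gamma_- and Gamma^- = Gamma_+. *)
Definition Gamma_up (mu : 'I_11) : 'M[C]_(16 + 16) :=
  by_index Gamma_m Gamma_p Gamma mu.
Definition Gamma_up2 (mu nu : 'I_11) : 'M[C]_(16 + 16) :=
  2^-1 *: (Gamma_up mu *m Gamma_up nu - Gamma_up nu *m Gamma_up mu).

Definition in_Sm (u : 'cV[C]_16) : spinor R := col_mx u 0.
Definition in_Sp (u : 'cV[C]_16) : spinor R := col_mx 0 u.

Definition Cform (CV : 'cV[C]_16 -> 'cV[C]_16 -> C) (xi eta : spinor R) : C :=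
  - ('i * CV (usubmx xi) (dsubmx eta)) + 'i * CV (dsubmx xi) (usubmx eta).

End Clifford.

Section CahenWallach.
Variable R : realType.
Local Notation C := R[i].
(** The parameters alpha_+, alpha_-, alpha'_+, alpha'_-. *)
Variables ap am ap' am' : R.
Variable gamma : gammas R.

Definition lambda (i : 'I_9) : C :=
  - 'i * (if i \in labs [:: 1; 2]%N then am - ap'
          else if i \in labs [:: 3; 4]%N then am + ap'
          else if i == lab 5%N then ap - ap'
          else ap + ap')%:C.

(** The lambda_i are purely imaginary, so that lambda_i ^ 2 is real. *)
Definition Bmx : 'M[R]_9 := diag_mx (\row_i complex.Re (lambda i ^+ 2)).

(** M_B is indecomposable iff B is non-degenerate. *)
Definition indecomposable : Prop := Bmx \in unitmx.

Definition Bquad (p : pt R) : R :=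
  \sum_i Bmx i i * xcoord (ix i) p ^+ 2.

Definition gB (p : pt R) : 'M[R]_11 :=
  \matrix_(mu, nu)
    by_index (by_index 0 1 (fun=> 0) nu)
             (by_index 1 (- Bquad p) (fun=> 0) nu)
             (fun i => by_index 0 0 (fun j => (i == j)%:R) nu) mu.

Definition del (mu : 'I_11) : vfield R := fun=> delta_mx mu 0.

Definition frame (a : 'I_11) : vfield R :=
  by_index (del ix_p)
           (fun p => del ix_m p + (2^-1 * Bquad p)%:C *: del ix_p p)
           (fun i => del (ix i)) a.

Definition nabla (mu : 'I_11) (xi : sfield R) : sfield R := fun p =>
  by_index (pdV ix_p xi p)
    (pdV ix_m xi p
     + 2^-1 *: \sum_i (lambda i ^+ 2 * (xcoord (ix i) p)%:C)
                        *: (Gamma_p R *m Gamma gamma i *m xi p))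
    (fun i => pdV (ix i) xi p) mu.

Definition lieD (K : vfield R) (xi : sfield R) : sfield R := fun p =>
  along nabla K xi p
  - 4^-1 *: \sum_mu \sum_nu
      cov_frame gB frame K mu nu p *: (Gamma_up2 gamma mu nu *m xi p).

Local Notation g_ s := (gammaI gamma (labs s%N)).
Local Notation G_ s := (GammaI gamma (labs s%N)).

Definition Xp : 'M[C]_16 := 2^-1 *: (1 + g_ [:: 1; 2; 3; 4]).
Definition Xm : 'M[C]_16 := 2^-1 *: (1 - g_ [:: 1; 2; 3; 4]).

Definition cbar : 'M[C]_16 := (ap%:C *: Xp + am%:C *: Xm) * g_ [:: 1; 2; 5].
Definition dd : 'M[C]_16 := (ap'%:C *: Xp + am'%:C *: Xm) * g_ [:: 1; 2; 5].

(** s_{cbar,d}(e_i). *)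
Definition scd (i : 'I_9) : 'M[C]_16 := cbar * gamma i - gamma i * dd.

Definition Dconn (mu : 'I_11) (xi : sfield R) : sfield R := fun p =>
  nabla mu xi p +
  by_index 0
    (col_mx (cbar *m usubmx (xi p)) (dd *m dsubmx (xi p)))
    (fun i => - ((Num.sqrt 2)%:C^-1 *: col_mx (scd i *m dsubmx (xi p)) 0)) mu.

Definition xi_field (u1 u2 : 'cV[C]_16) : sfield R := fun p =>
  let E A := expM (- (xcoord ix_m p)%:C *: A) in
  col_mx (E cbar *m u1
          + (Num.sqrt 2)%:C^-1 *:
              \sum_i (xcoord (ix i) p)%:C *: (scd i *m (E dd *m u2)))
         (E dd *m u2).

Definition K1 : set (sfield R) :=
  [set xi | exists u1 u2, Xm *m u2 = 0 /\ xi = xi_field u1 u2].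

(** [K_i] and [K_ij] carry the sign opposite to the one printed in the source,
    which lists cos(lambda_i x^-) d_i + lambda_i sin(lambda_i x^-) x^i d_+ and
    x^j d_i - x^i d_j.  The span [K0] is the same, but the printed signs do not
    match [K_p], [K_m], [K_is] in [odd_bracket]: with
    X_i = C(xi1, Gamma_125 Gamma_i eta2) + C(eta1, Gamma_125 Gamma_i xi2), the
    K_(i)-component of [K_m, {xi, eta}] would be i lambda_i X_i, and that of
    {L_(K_m) xi, eta} + {xi, L_(K_m) eta} would be - i lambda_i X_i, so the bracket
    would not be equivariant. *)
Definition K_p : vfield R := fun p => - del ix_p p.
Definition K_m : vfield R := fun p => - del ix_m p.
Definition K_i (i : 'I_9) : vfield R := fun p =>
  let z := lambda i * (xcoord ix_m p)%:C in
  - (cosC z *: del (ix i) p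
     + (lambda i * sinC z * (xcoord (ix i) p)%:C) *: del ix_p p).
Definition K_is (i : 'I_9) : vfield R := fun p =>
  let z := lambda i * (xcoord ix_m p)%:C in
  - (lambda i * sinC z) *: del (ix i) p
  + (lambda i ^+ 2 * cosC z * (xcoord (ix i) p)%:C) *: del ix_p p.
Definition K_ij (i j : 'I_9) : vfield R := fun p =>
  (xcoord (ix i) p)%:C *: del (ix j) p - (xcoord (ix j) p)%:C *: del (ix i) p.

Definition rot_pair (i j : 'I_9) : bool :=
  has (fun s => (i \in labs s) && (j \in labs s))
      [:: [:: 1; 2]; [:: 3; 4]; [:: 6; 7; 8; 9]]%N.

Definition K0_generators : set (vfield R) :=
  [set K_p] `|` [set K_m] `|` range K_i `|` range K_is
  `|` [set K | exists i j, rot_pair i j /\ K = K_ij i j].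

Definition K0 : set (vfield R) := lspan (V := pt R -> 'cV[C]_11) K0_generators.

Definition odd_bracket (CV : 'cV[C]_16 -> 'cV[C]_16 -> C)
    (xi1 xi2 eta1 eta2 : 'cV[C]_16) : vfield R := fun p =>
  let B (M : 'M[C]_(16 + 16)) (x y : spinor R) := Cform CV x (M *m y) in
  let x1 := in_Sm xi1 in let x2 := in_Sp xi2 in
  let y1 := in_Sm eta1 in let y2 := in_Sp eta2 in
  let Gp := Gamma_p R in
  B (Gamma_m R) x1 y1 *: K_p p
  + B Gp x2 y2 *: K_m p
  + \sum_i (B (Gamma gamma i) x1 y2 + B (Gamma gamma i) y1 x2) *: K_i i p
  + \sum_i ('i / lambda i * (B (G_ [:: 1; 2; 5] *m Gamma gamma i) x1 y2
                             + B (G_ [:: 1; 2; 5] *m Gamma gamma i) y1 x2))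
             *: K_is i p
  + ('i * lambda (lab 1%N) * B (Gp *m G_ [:: 5]) x2 y2) *: K_ij (lab 1%N) (lab 2%N) p
  + ('i * lambda (lab 3%N) * B (Gp *m G_ [:: 1; 2; 3; 4; 5]) x2 y2)
      *: K_ij (lab 3%N) (lab 4%N) p
  + ('i * lambda (lab 6%N) / 2) *:
      \sum_(j <- labs [:: 6; 7; 8; 9]%N) \sum_(k <- labs [:: 6; 7; 8; 9]%N)
        B (Gp *m GammaI gamma (labs [:: 1; 2; 5]%N ++ [:: j; k])) x2 y2 *: K_ij j k p.

End CahenWallach.

(* Main.v *)
Require Import Defs.
From HB Require Import structures.
From mathcomp Require Import all_boot all_order all_algebra.
From mathcomp Require Import complex.
From mathcomp Require Import all_classical all_reals all_analysis.
From mathcomp Require Import ring lra.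

(** The proof turns every object of the statement into finitely many coefficients,
    so that the axioms of a superalgebra become identities of Clifford algebra.

    Everything is governed by two commuting involutions of the spinor module,
    T = gamma_125 and Q = gamma_1234. Each generator commutes or anticommutes with
    each of them, and the four sign patterns are the blocks {1,2}, {3,4}, {5} and
    {6,..,9}, on each of which lambda is constant. On the eigenspace Q = (-1)^b
    the maps cbar and d are real multiples of T, so s(e_i) is a real multiple
    [nu b i] of T gamma_i, with [nu false i] = i lambda_i. Consequently the operator
    cbar s(e_i) - s(e_i) d + lambda_i^2 gamma_i vanishes on Q = 1 and is
    nu(true,i)^2 - nu(false,i)^2 times gamma_i on Q = -1 ([obstruction_split]).

    This operator decides which sections are parallel. Its vanishing on Q = 1 makes
    the fields of K_1 parallel ([xi_parallel]). Conversely, by the symmetry of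
    second derivatives it annihilates the second component of every parallel
    section ([par_obstruction]). If all the numbers nu(true,i)^2 - nu(false,i)^2
    were zero then the connection form would satisfy the Maurer-Cartan equation and
    D would be flat ([D_flat]). So when D is not flat, X^- kills the value at the
    origin of the second component of a parallel section ([nonflat_Xm]), and the
    parallel equation, a linear differential equation along x^- with
    diagonalizable coefficients, integrates to a field of K_1 ([par_xi]).

    The elements of K_0 are the fields [KV th] whose coordinates [th] consist of the
    coefficients of K_+, K_-, K_i, K_i^* and a rotation preserving the blocks
    ([K0E]). In these coordinates the commutator is [commutator_data]
    ([lie_bracket_KV]), and the spinorial Lie derivative maps the section with
    initial values (u1, u2) to the one with initial values ([act_minus], [act_plus])
    ([lieD_xi]): conjugation by the exponentials turns the translation part into a
    field along x^- with zero derivative ([translation_constant]). That these maps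
    represent K_0 follows from the brackets of cbar, d and the rotations with
    gamma_i and s(e_i) ([act_plus_kbr], [act_minus_kbr]).

    The odd-odd bracket is the Killing field with coordinates [bracket_data], which
    are values of C_V on the initial values ([odd_bracketE]). For C_V the maps
    gamma_i and Q are symmetric, hence T, cbar, d and the rotations are
    skew-symmetric, and the derivation property is proved one coordinate at a time
    ([bracket_data_equivariant]). *)

Set Implicit Arguments.
Unset Strict Implicit.
Unset Printing Implicit Defensive.

Import Order.TTheory GRing.Theory Num.Theory.
Import numFieldNormedType.Exports.

Local Open Scope ring_scope.
Local Open Scope complex_scope.

(** * Partial derivatives and smoothness *)

Section ComplexDerivatives.
Variable R : realType.
Local Notation C := R[i].
Implicit Types (mu : 'I_11) (p : pt R).

(** The value of a partial derivative is recorded together with its existence,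
    so that sum, product and chain rules compose without side conditions. *)
Definition is_pdC mu (f : pt R -> C) p (l : C) : Prop :=
  is_derive p (delta_mx 0 mu) (fun q => complex.Re (f q)) (complex.Re l) /\
  is_derive p (delta_mx 0 mu) (fun q => complex.Im (f q)) (complex.Im l).

Definition is_pdM m n mu (F : pt R -> 'M[C]_(m, n)) p (L : 'M[C]_(m, n)) :=
  forall i j, is_pdC mu (fun q => F q i j) p (L i j).

Lemma is_pdC_eq mu f p l l' : is_pdC mu f p l' -> l' = l -> is_pdC mu f p l.
Proof. by move=> h <-. Qed.

Lemma is_pdM_eq m n mu (F : pt R -> 'M[C]_(m, n)) p L L' :
  is_pdM mu F p L' -> L' = L -> is_pdM mu F p L.
Proof. by move=> h <-. Qed.

Lemma is_pdC_ext mu f g p l : is_pdC mu g p l -> f =1 g -> is_pdC mu f p l.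
Proof. by move=> h /funext ->. Qed.

Lemma is_pdM_ext m n mu (F G : pt R -> 'M[C]_(m, n)) p L :
  is_pdM mu G p L -> F =1 G -> is_pdM mu F p L.
Proof. by move=> h /funext ->. Qed.

Lemma is_pdCE mu f p l : is_pdC mu f p l -> pdC mu f p = l.
Proof. by move=> [[_ h1] [_ h2]]; rewrite /pdC /pd h1 h2; case: l {h1 h2}. Qed.

Lemma is_pdVE n mu (F : pt R -> 'cV[C]_n) p L : is_pdM mu F p L -> pdV mu F p = L.
Proof.
by move=> h; apply/matrixP => i j; rewrite mxE (is_pdCE (h i 0)) (ord1 j).
Qed.

Lemma is_pdC_cst mu (c : C) p : is_pdC mu (fun=> c) p 0.
Proof. by split; exact: is_derive_cst. Qed.

Lemma complexReD (x y : C) : complex.Re (x + y) = complex.Re x + complex.Re y.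
Proof. by case: x; case: y. Qed.
Lemma complexImD (x y : C) : complex.Im (x + y) = complex.Im x + complex.Im y.
Proof. by case: x; case: y. Qed.
Lemma complexReM (x y : C) : complex.Re (x * y) =
  complex.Re x * complex.Re y - complex.Im x * complex.Im y.
Proof. by case: x; case: y. Qed.
Lemma complexImM (x y : C) : complex.Im (x * y) =
  complex.Re x * complex.Im y + complex.Im x * complex.Re y.
Proof. by case: x; case: y. Qed.
Lemma complexReN (x : C) : complex.Re (- x) = - complex.Re x. Proof. by case: x. Qed.
Lemma complex_ext (x y : C) : complex.Re x = complex.Re y -> complex.Im x = complex.Im y ->
  x = y.
Proof. by case: x; case: y => ? ? ? ? /= -> ->. Qed.

Lemma is_pdC_add mu f g p l k : is_pdC mu f p l -> is_pdC mu g p k ->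
  is_pdC mu (fun q => f q + g q) p (l + k).
Proof.
move=> [f1 f2] [g1 g2]; split.
  rewrite complexReD (_ : (fun q => _) =
    (fun q => complex.Re (f q)) + (fun q => complex.Re (g q))).
    exact: is_deriveD.
  by apply/funext => q; rewrite complexReD.
rewrite complexImD (_ : (fun q => _) =
  (fun q => complex.Im (f q)) + (fun q => complex.Im (g q))).
  exact: is_deriveD.
by apply/funext => q; rewrite complexImD.
Qed.

Lemma is_pdC_mul mu f g p l k : is_pdC mu f p l -> is_pdC mu g p k ->
  is_pdC mu (fun q => f q * g q) p (l * g p + f p * k).
Proof.
move=> [f1 f2] [g1 g2]; split.
  rewrite (_ : (fun q => _) =
    (fun q => complex.Re (f q)) * (fun q => complex.Re (g q)) -
    (fun q => complex.Im (f q)) * (fun q => complex.Im (g q))); last first.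
    by apply/funext => q; rewrite complexReM.
  apply: is_derive_eq; rewrite complexReD !complexReM /GRing.scale /=; ring.
rewrite (_ : (fun q => _) =
    (fun q => complex.Re (f q)) * (fun q => complex.Im (g q)) +
    (fun q => complex.Im (f q)) * (fun q => complex.Re (g q))); last first.
  by apply/funext => q; rewrite complexImM.
apply: is_derive_eq; rewrite complexImD !complexImM /GRing.scale /=; ring.
Qed.

Lemma is_pdC_opp mu f p l : is_pdC mu f p l -> is_pdC mu (fun q => - f q) p (- l).
Proof.
move=> h; apply: (is_pdC_ext (g := fun q => (-1) * f q)); last first.
  by move=> q; rewrite mulN1r.
by apply: is_pdC_eq (is_pdC_mul (is_pdC_cst mu (-1) p) h) _; rewrite mul0r add0r mulN1r.
Qed.

Lemma is_pdC_sum (I : Type) (r : seq I) (P : pred I) mu (f : I -> pt R -> C) p l :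
  (forall i, P i -> is_pdC mu (f i) p (l i)) ->
  is_pdC mu (fun q => \sum_(i <- r | P i) f i q) p (\sum_(i <- r | P i) l i).
Proof.
move=> h; elim: r => [|x r IH].
  by rewrite big_nil; apply: is_pdC_ext (is_pdC_cst mu 0 p) _ => q; rewrite big_nil.
rewrite big_cons; case: ifP => Px.
  apply: is_pdC_ext (is_pdC_add (h x Px) IH) _ => q; by rewrite big_cons Px.
by apply: is_pdC_ext IH _ => q; rewrite big_cons Px.
Qed.

Lemma is_pdC_real mu (f : pt R -> R) p l : is_derive p (delta_mx 0 mu) f l ->
  is_pdC mu (fun q => (f q)%:C) p l%:C.
Proof. by move=> h; split => //=; exact: is_derive_cst. Qed.

Lemma is_derive_xcoord mu nu p :
  is_derive p (delta_mx 0 mu) (@xcoord R nu) (nu == mu)%:R.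
Proof.
have hd : differentiable (@xcoord R nu) p by exact: differentiable_coord.
split; first exact: diff_derivable.
have -> : (nu == mu)%:R = (delta_mx 0 mu : 'rV[R]_11) 0 nu by rewrite mxE.
have [f fE] : {f : {linear 'rV[R]_11 -> R} | @xcoord R nu = f}.
  have hlin : linear (@xcoord R nu).
    by move=> a u v; rewrite /xcoord !mxE.
  pose xl := GRing.isLinear.Build _ _ _ _ (@xcoord R nu) hlin.
  by exists (HB.pack_for {linear 'rV[R]_11 -> R} (@xcoord R nu) xl).
rewrite deriveE // fE diff_lin -?fE //.
by move=> q; apply: differentiable_continuous; move: (differentiable_coord q ord0 nu : differentiable (@xcoord R nu) q); rewrite fE.
Qed.

Lemma is_pdC_xcoord mu nu p :
  is_pdC mu (fun q => (xcoord nu q)%:C) p (nu == mu)%:R.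
Proof.
apply: is_pdC_eq (is_pdC_real (is_derive_xcoord mu nu p)) _.
by case: eqP.
Qed.

Lemma is_derive_xm mu (f : R -> R) p d :
  is_derive (xcoord ix_m p) 1 f d ->
  is_derive p (delta_mx 0 mu) (fun q => f (xcoord ix_m q)) ((ix_m == mu)%:R * d).
Proof.
move=> h.
have fd : differentiable f (xcoord ix_m p).
  by apply/derivable1_diffP; case: h.
have xd : differentiable (@xcoord R ix_m) p by exact: differentiable_coord.
have cd : differentiable (f \o @xcoord R ix_m) p by exact: differentiable_comp.
split; first exact: diff_derivable.
rewrite deriveE // (_ : (fun q => _) = f \o @xcoord R ix_m) //.
rewrite diff_comp //= -[X in 'd f _ X]deriveE //.
have [_ ->] := is_derive_xcoord mu ix_m p.
have -> : (ix_m == mu)%:R = (ix_m == mu)%:R *: (1 : R) :> R by rewrite /GRing.scale /= mulr1.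
rewrite linearZ /= -deriveE //; case: h => _ ->.
by rewrite /GRing.scale /= mulr1.
Qed.

Lemma is_derive_expR_lin (a x : R) :
  is_derive x 1 (fun t => expR (a * t)) (a * expR (a * x)).
Proof.
have h : is_derive x 1 ( *%R a) a.
  have -> : *%R a = (a \*: (@id R)) by apply/funext.
  by apply: is_derive_eq; rewrite /GRing.scale /= mulr1.
have := is_derive1_comp (is_derive_expR (a * x)) h.
by rewrite mulrC.
Qed.

Lemma is_pdC_exp mu (a : R) p :
  is_pdC mu (fun q => (expR (a * xcoord ix_m q))%:C) p
    ((ix_m == mu)%:R * (a%:C * (expR (a * xcoord ix_m p))%:C)).
Proof.
have h := is_derive_xm mu (is_derive_expR_lin a (xcoord ix_m p)).
apply: is_pdC_eq (is_pdC_real h) _.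
by rewrite !rmorphM /=; case: eqP => _; rewrite ?rmorph1 ?rmorph0.
Qed.

Lemma is_pdM_cst m n mu (A : 'M[C]_(m, n)) p : is_pdM mu (fun=> A) p 0.
Proof. by move=> i j; rewrite mxE; exact: is_pdC_cst. Qed.

Lemma is_pdM_add m n mu (F G : pt R -> 'M[C]_(m, n)) p L K :
  is_pdM mu F p L -> is_pdM mu G p K -> is_pdM mu (fun q => F q + G q) p (L + K).
Proof.
move=> hF hG i j; rewrite mxE; apply: is_pdC_ext (is_pdC_add (hF i j) (hG i j)) _ => q.
by rewrite mxE.
Qed.

Lemma is_pdM_opp m n mu (F : pt R -> 'M[C]_(m, n)) p L :
  is_pdM mu F p L -> is_pdM mu (fun q => - F q) p (- L).
Proof.
move=> hF i j; rewrite mxE; apply: is_pdC_ext (is_pdC_opp (hF i j)) _ => q.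
by rewrite mxE.
Qed.

Lemma is_pdM_mul m n k mu (F : pt R -> 'M[C]_(m, n)) (G : pt R -> 'M[C]_(n, k)) p L K :
  is_pdM mu F p L -> is_pdM mu G p K ->
  is_pdM mu (fun q => F q *m G q) p (L *m G p + F p *m K).
Proof.
move=> hF hG i j.
apply: (is_pdC_ext (g := fun q => \sum_l F q i l * G q l j)); last first.
  by move=> q; rewrite mxE.
apply: is_pdC_eq (is_pdC_sum _ (fun l _ => is_pdC_mul (hF i l) (hG l j))) _.
by rewrite !mxE -big_split.
Qed.

Lemma is_pdM_scale m n mu (f : pt R -> C) (G : pt R -> 'M[C]_(m, n)) p l K :
  is_pdC mu f p l -> is_pdM mu G p K ->
  is_pdM mu (fun q => f q *: G q) p (l *: G p + f p *: K).
Proof.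
move=> hf hG i j; rewrite !mxE.
by apply: is_pdC_ext (is_pdC_mul hf (hG i j)) _ => q; rewrite mxE.
Qed.

Lemma is_pdM_sum (I : Type) (r : seq I) (P : pred I) m n mu
    (F : I -> pt R -> 'M[C]_(m, n)) p L :
  (forall i, P i -> is_pdM mu (F i) p (L i)) ->
  is_pdM mu (fun q => \sum_(i <- r | P i) F i q) p (\sum_(i <- r | P i) L i).
Proof.
move=> h i j; rewrite summxE.
apply: is_pdC_ext (is_pdC_sum _ (fun k Pk => h k Pk i j)) _ => q.
by rewrite summxE.
Qed.

Lemma is_pdM_mull m n k mu (A : 'M[C]_(m, n)) (G : pt R -> 'M[C]_(n, k)) p K :
  is_pdM mu G p K -> is_pdM mu (fun q => A *m G q) p (A *m K).
Proof.
move=> h; apply: is_pdM_eq (is_pdM_mul (is_pdM_cst mu A p) h) _.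
by rewrite mul0mx add0r.
Qed.

Lemma is_pdM_mulr m n k mu (G : pt R -> 'M[C]_(m, n)) (A : 'M[C]_(n, k)) p K :
  is_pdM mu G p K -> is_pdM mu (fun q => G q *m A) p (K *m A).
Proof.
move=> h; apply: is_pdM_eq (is_pdM_mul h (is_pdM_cst mu A p)) _.
by rewrite mulmx0 addr0.
Qed.

Lemma is_pdM_scalec m n mu (c : C) (G : pt R -> 'M[C]_(m, n)) p K :
  is_pdM mu G p K -> is_pdM mu (fun q => c *: G q) p (c *: K).
Proof.
move=> h; apply: is_pdM_eq (is_pdM_scale (is_pdC_cst mu c p) h) _.
by rewrite scale0r add0r.
Qed.

Lemma is_pdM_scaler m n mu (f : pt R -> C) (A : 'M[C]_(m, n)) p l :
  is_pdC mu f p l -> is_pdM mu (fun q => f q *: A) p (l *: A).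
Proof.
move=> h; apply: is_pdM_eq (is_pdM_scale h (is_pdM_cst mu A p)) _.
by rewrite scaler0 addr0.
Qed.

Lemma is_pdM_col_mx m1 m2 n mu (F : pt R -> 'M[C]_(m1, n)) (G : pt R -> 'M[C]_(m2, n))
    p L K :
  is_pdM mu F p L -> is_pdM mu G p K ->
  is_pdM mu (fun q => col_mx (F q) (G q)) p (col_mx L K).
Proof.
move=> hF hG i j; rewrite mxE.
case E : (fintype.split i) => [k|k].
  by apply: is_pdC_ext (hF k j) _ => q; rewrite mxE E.
by apply: is_pdC_ext (hG k j) _ => q; rewrite mxE E.
Qed.

Lemma is_pdM_usubmx m1 m2 n mu (F : pt R -> 'M[C]_(m1 + m2, n)) p L :
  is_pdM mu F p L -> is_pdM mu (fun q => usubmx (F q)) p (usubmx L).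
Proof.
move=> h i j; rewrite mxE; apply: is_pdC_ext (h (lshift m2 i) j) _ => q.
by rewrite mxE.
Qed.

Lemma is_pdM_dsubmx m1 m2 n mu (F : pt R -> 'M[C]_(m1 + m2, n)) p L :
  is_pdM mu F p L -> is_pdM mu (fun q => dsubmx (F q)) p (dsubmx L).
Proof.
move=> h i j; rewrite mxE; apply: is_pdC_ext (h (rshift m1 i) j) _ => q.
by rewrite mxE.
Qed.

(** Contains the coefficients of the explicit fields below and is closed under
    partial derivatives, so that membership entails smoothness. *)
Inductive elementary : (pt R -> R) -> Prop :=
| elem_cst c : elementary (fun=> c)
| elem_coord mu : elementary (@xcoord R mu)
| elem_exp a : elementary (fun p => expR (a * xcoord ix_m p))
| elem_add f g : elementary f -> elementary g -> elementary (fun p => f p + g p)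
| elem_mul f g : elementary f -> elementary g -> elementary (fun p => f p * g p).

Lemma elementary_differentiable f : elementary f -> forall p, differentiable f p.
Proof.
elim=> {f} [c p|mu p|a p|f g _ hf _ hg p|f g _ hf _ hg p].
- exact: differentiable_cst.
- exact: differentiable_coord.
- have h := is_derive_expR_lin a (xcoord ix_m p).
  rewrite (_ : (fun q => _) = (fun t => expR (a * t)) \o @xcoord R ix_m) //.
  apply: differentiable_comp; first exact: differentiable_coord.
  by apply/derivable1_diffP; case: h.
- exact: differentiableD.
- exact: differentiableM.
Qed.

Lemma elementary_pd mu f : elementary f -> elementary (pd mu f).
Proof.
elim=> {f} [c|nu|a|f g ef hf eg hg|f g ef hf eg hg].
- rewrite (_ : pd mu _ = fun=> 0); first exact: elem_cst.
  by apply/funext => p; rewrite /pd derive_cst.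
- rewrite (_ : pd mu _ = fun=> (nu == mu)%:R); first exact: elem_cst.
  by apply/funext => p; have [_ h] := is_derive_xcoord mu nu p.
- rewrite (_ : pd mu _ =
    fun p => (ix_m == mu)%:R * (a * expR (a * xcoord ix_m p))).
    by apply: elem_mul; [exact: elem_cst|apply: elem_mul; [exact: elem_cst|exact: elem_exp]].
  apply/funext => p.
  by have [_ h] := is_derive_xm mu (is_derive_expR_lin a (xcoord ix_m p)).
- rewrite (_ : pd mu _ = fun p => pd mu f p + pd mu g p); first exact: elem_add.
  apply/funext => p; rewrite /pd.
  by apply: deriveD; apply: diff_derivable; exact: elementary_differentiable.
- rewrite (_ : pd mu _ = fun p => f p * pd mu g p + g p * pd mu f p).
    by apply: elem_add; apply: elem_mul.
  apply/funext => p; rewrite /pd.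
  by rewrite -[LHS]/('D_(delta_mx 0 mu) (f * g) p) deriveM //;
    apply: diff_derivable; exact: elementary_differentiable.
Qed.

Lemma elementary_smooth f : elementary f -> smoothR f.
Proof.
move=> ef s p; apply: elementary_differentiable.
by elim: s => //= mu s; exact: elementary_pd.
Qed.

Definition elemC (f : pt R -> C) :=
  elementary (fun p => complex.Re (f p)) /\ elementary (fun p => complex.Im (f p)).

Definition elemM m n (F : pt R -> 'M[C]_(m, n)) := forall i j, elemC (fun p => F p i j).

Lemma elemM_smooth n (F : pt R -> 'cV[C]_n) : elemM F -> smooth F.
Proof. by move=> h k; have [h1 h2] := h k 0; split; exact: elementary_smooth. Qed.

Lemma elemC_ext f g : elemC g -> f =1 g -> elemC f.
Proof. by move=> h /funext ->. Qed.

Lemma elemM_ext m n (F G : pt R -> 'M[C]_(m, n)) : elemM G -> F =1 G -> elemM F.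
Proof. by move=> h /funext ->. Qed.

Lemma elemC_cst c : elemC (fun=> c).
Proof. by split; exact: elem_cst. Qed.

Lemma elemC_real f : elementary f -> elemC (fun p => (f p)%:C).
Proof. by move=> h; split => //; exact: elem_cst. Qed.

Lemma elemC_add f g : elemC f -> elemC g -> elemC (fun p => f p + g p).
Proof.
move=> [f1 f2] [g1 g2]; split.
  rewrite (_ : (fun p => _) = (fun p => complex.Re (f p) + complex.Re (g p))).
    exact: elem_add.
  by apply/funext => p; rewrite complexReD.
rewrite (_ : (fun p => _) = (fun p => complex.Im (f p) + complex.Im (g p))).
  exact: elem_add.
by apply/funext => p; rewrite complexImD.
Qed.

Lemma elemC_mul f g : elemC f -> elemC g -> elemC (fun p => f p * g p).
Proof.
move=> [f1 f2] [g1 g2]; split.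
  rewrite (_ : (fun p => _) = (fun p => complex.Re (f p) * complex.Re (g p) +
    (-1) * (complex.Im (f p) * complex.Im (g p)))).
    by repeat (apply: elem_add || apply: elem_mul) => //; exact: elem_cst.
  by apply/funext => p; rewrite complexReM mulN1r.
rewrite (_ : (fun p => _) = (fun p => complex.Re (f p) * complex.Im (g p) +
  complex.Im (f p) * complex.Re (g p))).
  by repeat (apply: elem_add || apply: elem_mul).
by apply/funext => p; rewrite complexImM.
Qed.

Lemma elemC_opp f : elemC f -> elemC (fun p => - f p).
Proof.
move=> h; apply: elemC_ext (elemC_mul (elemC_cst (-1)) h) _ => p.
by rewrite mulN1r.
Qed.

Lemma elemC_sum (I : Type) (r : seq I) (P : pred I) (f : I -> pt R -> C) :
  (forall i, elemC (f i)) -> elemC (fun p => \sum_(i <- r | P i) f i p).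
Proof.
move=> h; elim: r => [|x r IH].
  by apply: elemC_ext (elemC_cst 0) _ => p; rewrite big_nil.
case Px : (P x).
  by apply: elemC_ext (elemC_add (h x) IH) _ => p; rewrite big_cons Px.
by apply: elemC_ext IH _ => p; rewrite big_cons Px.
Qed.

Lemma elemM_cst m n (A : 'M[C]_(m, n)) : elemM (fun=> A).
Proof. by move=> i j; exact: elemC_cst. Qed.

Lemma elemM_add m n (F G : pt R -> 'M[C]_(m, n)) :
  elemM F -> elemM G -> elemM (fun p => F p + G p).
Proof.
move=> h k i j; apply: elemC_ext (elemC_add (h i j) (k i j)) _ => p.
by rewrite mxE.
Qed.

Lemma elemM_scale m n f (G : pt R -> 'M[C]_(m, n)) :
  elemC f -> elemM G -> elemM (fun p => f p *: G p).
Proof.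
move=> h k i j; apply: elemC_ext (elemC_mul h (k i j)) _ => p.
by rewrite mxE.
Qed.

Lemma elemM_mul m n k (F : pt R -> 'M[C]_(m, n)) (G : pt R -> 'M[C]_(n, k)) :
  elemM F -> elemM G -> elemM (fun p => F p *m G p).
Proof.
move=> hF hG i j.
apply: (elemC_ext (g := fun p => \sum_l F p i l * G p l j)).
  by apply: elemC_sum => l; exact: elemC_mul.
by move=> p; rewrite mxE.
Qed.

Lemma elemM_sum (I : Type) (r : seq I) (P : pred I) m n (F : I -> pt R -> 'M[C]_(m, n)) :
  (forall i, elemM (F i)) -> elemM (fun p => \sum_(i <- r | P i) F i p).
Proof.
move=> h i j.
apply: (elemC_ext (g := fun p => \sum_(k <- r | P k) F k p i j)).
  by apply: elemC_sum => k; exact: h.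
by move=> p; rewrite summxE.
Qed.

Lemma elemM_col_mx m1 m2 n (F : pt R -> 'M[C]_(m1, n)) (G : pt R -> 'M[C]_(m2, n)) :
  elemM F -> elemM G -> elemM (fun p => col_mx (F p) (G p)).
Proof.
move=> hF hG i j; case E : (fintype.split i) => [k|k].
  by apply: elemC_ext (hF k j) _ => p; rewrite mxE E.
by apply: elemC_ext (hG k j) _ => p; rewrite mxE E.
Qed.

Lemma smooth_is_pdM n mu (F : pt R -> 'cV[C]_n) p : smooth F ->
  is_pdM mu F p (pdV mu F p).
Proof.
move=> h i j; rewrite (ord1 j) mxE; have [h1 h2] := h i.
by split; apply/derivableP; apply: diff_derivable; [exact: (h1 [::])|exact: (h2 [::])].
Qed.

Lemma smooth_pdV n mu (F : pt R -> 'cV[C]_n) : smooth F -> smooth (pdV mu F).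
Proof.
move=> h k; have [h1 h2] := h k; split => s p.
  rewrite (_ : (fun q => _) = pd mu (fun q => complex.Re (F q k 0))).
    by have := h1 (rcons s mu) p; rewrite foldr_rcons.
  by apply/funext => q; rewrite mxE.
rewrite (_ : (fun q => _) = pd mu (fun q => complex.Im (F q k 0))).
  by have := h2 (rcons s mu) p; rewrite foldr_rcons.
by apply/funext => q; rewrite mxE.
Qed.

End ComplexDerivatives.

(** * Functions with vanishing derivatives, and Schwarz's theorem *)

Section PartialDerivatives.
Variable R : realType.
Local Notation C := R[i].
Implicit Types (mu nu : 'I_11) (p q v : pt R) (f : pt R -> R).

Lemma is_derive_line f p v (s : R) : derivable f (p + s *: v) v ->
  is_derive s 1 (fun t => f (p + t *: v)) ('D_v f (p + s *: v)).
Proof.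
move=> h; have E : (fun k : R => k^-1 *: (((fun t => f (p + t *: v)) \o shift s)
    (k *: (1 : R)) - f (p + s *: v))) =
    (fun k : R => k^-1 *: ((f \o shift (p + s *: v)) (k *: v) - f (p + s *: v))).
  apply/funext => k /=; congr (_ *: (f _ - _)).
  by rewrite /shift /=; rewrite [k *: 1]mulr1 scalerDl addrCA.
split; first by rewrite /derivable E.
by rewrite /derive E.
Qed.

Lemma is_derive0_invariant f mu : (forall p, is_derive p (delta_mx 0 mu) f 0) ->
  forall p (s : R), f (p + s *: delta_mx 0 mu) = f p.
Proof.
move=> h p s.
pose g := fun t : R => f (p + t *: delta_mx 0 mu).
have : g s = g 0.
  apply: is_derive_0_is_cst => t.
  have [dv E] := h (p + t *: delta_mx 0 mu).
  by have := is_derive_line dv; rewrite E.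
by rewrite /g scale0r addr0.
Qed.

Lemma is_pdM0_invariant m n (F : pt R -> 'M[C]_(m, n)) mu :
  (forall p, is_pdM mu F p 0) -> forall p (s : R), F (p + s *: delta_mx 0 mu) = F p.
Proof.
move=> h p s; apply/matrixP => i j; apply: complex_ext.
  apply: (is_derive0_invariant (f := fun q => complex.Re (F q i j))) => q.
  by have [+ _] := h q i j; rewrite mxE.
apply: (is_derive0_invariant (f := fun q => complex.Im (F q i j))) => q.
by have [_ +] := h q i j; rewrite mxE.
Qed.

(** Every point is reached from the origin by moves along the coordinate axes. *)
Lemma is_pdM0_constant m n (F : pt R -> 'M[C]_(m, n)) :
  (forall mu p, is_pdM mu F p 0) -> forall p, F p = F 0.
Proof.
move=> h p; rewrite [in LHS](row_sum_delta p).
have : forall r : seq 'I_11, F (\sum_(j <- r) p 0 j *: delta_mx 0 j) = F 0.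
  elim=> [|k r IH]; first by rewrite big_nil.
  by rewrite big_cons addrC is_pdM0_invariant.
exact.
Qed.

Lemma mvt_line f p v (s : R) : 0 < s -> (forall q, differentiable f q) ->
  exists2 c, 0 < c < s & f (p + s *: v) - f p = 'D_v f (p + c *: v) * s.
Proof.
move=> s0 df.
have hd (t : R) := is_derive_line (@diff_derivable _ _ _ f _ v (df (p + t *: v))).
have hc : {within `[0, s], continuous (fun t : R => f (p + t *: v))}%classic.
  apply: continuous_subspaceT => t.
  by apply: differentiable_continuous; apply/derivable1_diffP; case: (hd t).
have [c cs E] := MVT s0 (fun t _ => hd t) hc.
exists c; first by move: cs; rewrite in_itv.
by move: E; rewrite scale0r addr0 subr0.
Qed.

(** Two applications of the mean value theorem: the mixed second difference
    quotient is a mixed second derivative at a nearby point. *)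
Lemma second_difference f p (s : R) mu nu : 0 < s -> smoothR f ->
  exists c d : R, [/\ 0 < c < s, 0 < d < s &
    f (p + s *: delta_mx 0 mu + s *: delta_mx 0 nu) - f (p + s *: delta_mx 0 mu)
      - (f (p + s *: delta_mx 0 nu) - f p)
    = pd nu (pd mu f) (p + c *: delta_mx 0 mu + d *: delta_mx 0 nu) * s ^+ 2].
Proof.
move=> s0 sf.
set u : pt R := delta_mx 0 mu; set v : pt R := delta_mx 0 nu.
have df q : differentiable f q := sf [::] q.
pose g q := f (q + s *: v) - f q.
have df' q : differentiable (fun r => f (r + s *: v)) q.
  apply: (@differentiable_comp _ _ _ _ (fun r : pt R => r + s *: v) f); last exact: df.
  have := @differentiableD _ _ _ (@id (pt R)) (cst (s *: v)) q.
  by apply.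
have dg q : differentiable g q by apply: differentiableB.
have [c cs E1] := mvt_line p u s0 dg.
have Dg q : 'D_u g q = pd mu f (q + s *: v) - pd mu f q.
  rewrite /pd -/u.
  have -> : 'D_u f (q + s *: v) = 'D_u (fun r => f (r + s *: v)) q.
    rewrite /derive.
    have E : (fun h : R => h^-1 *: ((f \o shift (q + s *: v)) (h *: u) - f (q + s *: v)))
        = (fun h : R => h^-1 *: (((fun r => f (r + s *: v)) \o shift q) (h *: u)
                                - f (q + s *: v))).
      by apply/funext => h /=; rewrite addrA.
    by rewrite E.
  by rewrite -deriveB //; [exact: (@diff_derivable _ _ _ _ _ u (df' q))|exact: (@diff_derivable _ _ _ _ _ u (df q))].
have [d ds E2] := mvt_line (p + c *: u) v s0 (sf [:: mu] : forall q, differentiable (pd mu f) q).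
exists c, d; split=> //; rewrite -/(g _) -/(g _) E1 Dg E2 expr2 mulrA.
by rewrite -/(pd nu (pd mu f) _).
Qed.

(** Schwarz: both iterated derivatives are limits of the same second difference
    quotient, which is symmetric in the two directions. *)
Lemma pd_comm f mu nu p : smoothR f -> pd mu (pd nu f) p = pd nu (pd mu f) p.
Proof.
move=> sf.
have close (a b : 'I_11) (e : R) : 0 < e -> exists2 d : R, 0 < d &
    forall c c' : R, 0 < c < d -> 0 < c' < d ->
    `|pd a (pd b f) p - pd a (pd b f) (p + c *: delta_mx 0 b + c' *: delta_mx 0 a)| < e.
  move=> e0.
  have hc : {for p, continuous (pd a (pd b f))}.
    exact: (differentiable_continuous (sf [:: a; b] p)).
  have /cvgrPdist_lt/(_ _ e0)/nbhs_ballP[d /= d0 hd] := hc.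
  (* c, c' < d / 4 keep the point at distance c + c' < d from p *)
  exists (d / 4); first by rewrite divr_gt0.
  move=> c c' /andP[c0 cd] /andP[c0' cd'].
  apply: hd; rewrite -ball_normE /ball_ /=.
  rewrite opprD addrA opprD addrA subrr add0r -opprD normrN.
  apply: (le_lt_trans (ler_normD _ _)); rewrite !normrZ.
  have n1 (k : 'I_11) : `|(delta_mx 0 k : 'rV[R]_11)| <= 1.
    have [->|/mx_norm_neq0[i E]] := eqVneq `|delta_mx 0 k : 'rV[R]_11| 0; first exact: ler01.
    rewrite [X in X <= _]E.
    by rewrite mxE; case: (_ && _); rewrite ?normr1 ?normr0 ?ler01.
  apply: (@le_lt_trans _ _ (c + c')); last by lra.
  apply: lerD.
    by rewrite gtr0_norm // ler_piMr // ltW.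
  by rewrite gtr0_norm // ler_piMr // ltW.
apply/eqP; rewrite -subr_eq0 -normr_le0; apply/negPn/negP; rewrite -ltNge => e0.
set e := `|_| in e0.
have e2 : 0 < e / 2 by rewrite divr_gt0.
have [d1 d10 h1] := close mu nu _ e2.
have [d2 d20 h2] := close nu mu _ e2.
pose s := Num.min d1 d2.
have s0 : 0 < s by rewrite lt_min d10.
have [c [c' [/andP[c0 cs] /andP[c0' cs'] E1]]] := second_difference p nu mu s0 sf.
have [k [k' [/andP[k0 ks] /andP[k0' ks'] E2]]] := second_difference p mu nu s0 sf.
have {}h1 := h1 c c'; have {}h2 := h2 k k'.
move: cs cs' ks ks'; rewrite !lt_min => /andP[c1 _] /andP[c1' _] /andP[_ k2] /andP[_ k2'].
rewrite c0 c1 c0' c1' in h1; rewrite k0 k2 k0' k2' in h2.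
have E : pd mu (pd nu f) (p + c *: delta_mx 0 nu + c' *: delta_mx 0 mu) =
         pd nu (pd mu f) (p + k *: delta_mx 0 mu + k' *: delta_mx 0 nu).
  move: E1 E2; set A := pd mu (pd nu f) _; set B := pd nu (pd mu f) _.
  have -> : p + s *: delta_mx 0 nu + s *: delta_mx 0 mu =
            p + s *: delta_mx 0 mu + s *: delta_mx 0 nu by rewrite addrAC.
  move: A B (f (p + s *: delta_mx 0 mu + s *: delta_mx 0 nu)) (f (p + s *: delta_mx 0 nu))
    (f (p + s *: delta_mx 0 mu)) (f p) => A B w x y z E1 E2.
  apply: (mulIf (x := s ^+ 2)); first by rewrite expf_neq0 // gt_eqF.
  by rewrite -E1 -E2; ring.
have : e < e / 2 + e / 2.
  apply: le_lt_trans (ltrD (h1 isT isT) (h2 isT isT)).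
  rewrite -[X in _ <= _ + X]normrN E.
  apply: le_trans (ler_normD _ _); rewrite /e.
  by rewrite opprB addrA subrK.
by rewrite -splitr ltxx.
Qed.

Lemma pdC_pdV n (F : pt R -> 'cV[C]_n) mu nu p i :
  pdC mu (fun q => pdV nu F q i 0) p =
    (pd mu (pd nu (fun q => complex.Re (F q i 0))) p) +i*
    (pd mu (pd nu (fun q => complex.Im (F q i 0))) p).
Proof.
have E1 : (fun q => complex.Re (pdV nu F q i 0)) = pd nu (fun q => complex.Re (F q i 0)).
  by apply/funext => q; rewrite mxE.
have E2 : (fun q => complex.Im (pdV nu F q i 0)) = pd nu (fun q => complex.Im (F q i 0)).
  by apply/funext => q; rewrite mxE.
by rewrite /pdC E1 E2.
Qed.

Lemma pdV_comm n (F : pt R -> 'cV[C]_n) mu nu p : smooth F ->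
  pdV mu (pdV nu F) p = pdV nu (pdV mu F) p.
Proof.
move=> h; apply/matrixP => i j; rewrite (ord1 j) {j}; have [h1 h2] := h i.
rewrite [LHS]mxE [RHS]mxE !pdC_pdV.
by rewrite (pd_comm mu nu p h1) (pd_comm mu nu p h2).
Qed.

End PartialDerivatives.

(** * Exponentials of diagonalizable matrices *)

Section MatrixExponential.
Variable R : realType.
Local Notation C := R[i].
Variable n : nat.
Implicit Types (A B : 'M[C]_n.+1) (p : pt R).

(** With such a resolution of the identity, the exponential is a finite sum of
    real exponentials and can be differentiated term by term. *)
Definition real_spectral (I : finType) A (e : I -> 'M[C]_n.+1) (x : I -> R) : Prop :=
  [/\ forall i j, e i * e j = if i == j then e i else 0, \sum_i e i = 1
    & A = \sum_i (x i)%:C *: e i].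

Definition real_diagonalizable A : Prop :=
  exists (I : finType) (e : I -> 'M[C]_n.+1) (x : I -> R), real_spectral A e x.

Lemma sum_idem (I : finType) (e : I -> 'M[C]_n.+1) (x y : I -> C) :
  (forall i j, e i * e j = if i == j then e i else 0) ->
  (\sum_i x i *: e i) * (\sum_i y i *: e i) = \sum_i (x i * y i) *: e i.
Proof.
move=> orth; rewrite mulr_suml; apply: eq_bigr => i _.
rewrite mulr_sumr (bigD1 i) //= big1 ?addr0; last first.
  move=> j ji; rewrite -scalerAl -scalerAr orth eq_sym (negPf ji).
  by rewrite !scaler0.
by rewrite -scalerAl -scalerAr orth eqxx scalerA.
Qed.

(** The powers of A are combinations of the same idempotents, so the exponential
    series splits into scalar ones. *)
Lemma spectral_exp (I : finType) A (e : I -> 'M[C]_n.+1) (x : I -> R) :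
  real_spectral A e x -> expM A = \sum_i (expR (x i))%:C *: e i.
Proof.
move=> [orth sum1 ->].
have pow k : (\sum_i (x i)%:C *: e i) ^+ k = \sum_i (x i ^+ k)%:C *: e i.
  elim: k => [|k IH].
    by rewrite expr0 -sum1; apply: eq_bigr => i _; rewrite expr0 scale1r.
  rewrite exprS IH sum_idem //; apply: eq_bigr => i _.
  by rewrite -rmorphM -exprS.
have part N a b : (\sum_(k < N) (k`!%:R^-1 : C) *:
      (\sum_i (x i)%:C *: e i) ^+ k) a b =
    \sum_i (series (exp_coeff (x i)) N)%:C * e i a b.
  rewrite summxE; under eq_bigr => k _ do rewrite mxE pow summxE mulr_sumr.
  rewrite exchange_big /=; apply: eq_bigr => i _.
  rewrite /series /= big_mkord rmorph_sum mulr_suml /=; apply: eq_bigr => k _.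
  rewrite mxE mulrA; congr (_ * _).
  by rewrite /exp_coeff rmorphM /= fmorphV rmorph_nat mulrC.
have cvgs (y : I -> R) : ((fun N => \sum_i series (exp_coeff (x i)) N * y i)
    @ \oo --> \sum_i expR (x i) * y i)%classic.
  have : forall r : seq I, ((fun N => \sum_(i <- r) series (exp_coeff (x i)) N * y i)
      @ \oo --> \sum_(i <- r) expR (x i) * y i)%classic.
    elim=> [|i r IH].
      rewrite big_nil (_ : (fun N => _) = (fun=> 0)); first exact: cvg_cst.
      by apply/funext => N; rewrite big_nil.
    rewrite big_cons (_ : (fun N => _) = (fun N => series (exp_coeff (x i)) N * y i +
      \sum_(i <- r) series (exp_coeff (x i)) N * y i)); last first.
      by apply/funext => N; rewrite big_cons.
    apply: cvgD => //; apply: cvgMr_tmp.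
    exact: is_cvg_series_exp_coeff.
  exact.
apply/matrixP => a b; rewrite mxE summxE /limC.
have ReE (y : R) (z : C) : complex.Re (y%:C * z) = y * complex.Re z.
  by rewrite complexReM /= mul0r subr0.
have ImE (y : R) (z : C) : complex.Im (y%:C * z) = y * complex.Im z.
  by rewrite complexImM /= mul0r addr0.
have Resum (y : I -> C) : complex.Re (\sum_i y i) = \sum_i complex.Re (y i).
  exact: (big_morph _ (@complexReD R) (erefl : complex.Re (0 : C) = 0)).
have Imsum (y : I -> C) : complex.Im (\sum_i y i) = \sum_i complex.Im (y i).
  exact: (big_morph _ (@complexImD R) (erefl : complex.Im (0 : C) = 0)).
apply: complex_ext => /=.
  rewrite Resum (eq_bigr (fun i => expR (x i) * complex.Re (e i a b))); last first.
    by move=> i _; rewrite mxE ReE.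
  rewrite -(cvg_lim _ (cvgs (fun i => complex.Re (e i a b)))) //.
  congr (limn _); apply/funext => N; rewrite part Resum.
  by apply: eq_bigr => i _; rewrite ReE.
rewrite Imsum (eq_bigr (fun i => expR (x i) * complex.Im (e i a b))); last first.
  by move=> i _; rewrite mxE ImE.
rewrite -(cvg_lim _ (cvgs (fun i => complex.Im (e i a b)))) //.
congr (limn _); apply/funext => N; rewrite part Imsum.
by apply: eq_bigr => i _; rewrite ImE.
Qed.

Lemma spectral_scale (I : finType) A (e : I -> 'M[C]_n.+1) (x : I -> R) (t : R) :
  real_spectral A e x -> real_spectral (- t%:C *: A) e (fun i => - x i * t).
Proof.
move=> [orth sum1 ->]; split=> //.
rewrite scaler_sumr; apply: eq_bigr => i _.
by rewrite scalerA rmorphM rmorphN /= mulrC mulrN mulNr.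
Qed.

Lemma expM_spectral (I : finType) A (e : I -> 'M[C]_n.+1) (x : I -> R) (t : R) :
  real_spectral A e x ->
  expM (- t%:C *: A) = \sum_i (expR (- x i * t))%:C *: e i.
Proof. by move=> h; rewrite (spectral_exp (spectral_scale t h)). Qed.

Lemma expM_at0 A : real_diagonalizable A -> expM (- (0 : R)%:C *: A) = 1.
Proof.
move=> [I [e [x h]]]; rewrite (expM_spectral _ h); case: h => _ <- _.
by apply: eq_bigr => i _; rewrite mulr0 expR0 scale1r.
Qed.

Lemma expM_inverse A (t : R) : real_diagonalizable A ->
  expM (- (- t)%:C *: A) *m expM (- t%:C *: A) = 1%:M.
Proof.
move=> [I [e [x h]]]; rewrite !(expM_spectral _ h); case: h => orth sum1 _.
rewrite [LHS](sum_idem _ _ orth) -[RHS]sum1; apply: eq_bigr => i _.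
by rewrite -rmorphM -expRD mulrN addNr expR0 scale1r.
Qed.

(** An intertwiner maps each eigenspace of B into the eigenspace of A with the
    same eigenvalue, so it intertwines every function of A and B. *)
Lemma expM_intertwine A B S (t : R) :
  real_diagonalizable A -> real_diagonalizable B ->
  A *m S = S *m B -> expM (- t%:C *: A) *m S = S *m expM (- t%:C *: B).
Proof.
move=> [I [e [x hA]]] [J [f [y hB]]] AB.
rewrite (expM_spectral _ hA) (expM_spectral _ hB).
case: hA => orthe sume AE; case: hB => orthf sumf BE.
have key i j (z : R -> C) :
    z (x i) *: (e i *m S *m f j) = z (y j) *: (e i *m S *m f j).
  have [->//|xy] := eqVneq (x i) (y j).
  suff -> : e i *m S *m f j = 0 by rewrite !scaler0.
  have hl : e i *m A = (x i)%:C *: e i.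
    rewrite AE mulmx_sumr (bigD1 i) //= big1 ?addr0; last first.
      by move=> k ki; rewrite -scalemxAr -[e i *m e k]/(e i * e k) orthe eq_sym
        (negPf ki) scaler0.
    by rewrite -scalemxAr -[e i *m e i]/(e i * e i) orthe eqxx.
  have hr : B *m f j = (y j)%:C *: f j.
    rewrite BE mulmx_suml (bigD1 j) //= big1 ?addr0; last first.
      by move=> k kj; rewrite -scalemxAl -[f k *m f j]/(f k * f j) orthf
        (negPf kj) scaler0.
    by rewrite -scalemxAl -[f j *m f j]/(f j * f j) orthf eqxx.
  have : e i *m (A *m S) *m f j = e i *m (S *m B) *m f j by rewrite AB.
  rewrite mulmxA hl -!mulmxA hr -scalemxAl -!scalemxAr => /eqP.
  rewrite -subr_eq0 -scalerBl scaler_eq0 -rmorphB /= mulmxA => /orP[|/eqP//].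
  by rewrite (fmorph_eq0 (real_complex R)) subr_eq0 (negPf xy).
have -> : (\sum_i (expR (- x i * t))%:C *: e i) *m S =
    \sum_i \sum_j (expR (- x i * t))%:C *: (e i *m S *m f j).
  rewrite mulmx_suml; apply: eq_bigr => i _.
  rewrite -scalemxAl -scaler_sumr -mulmx_sumr sumf; congr (_ *: _).
  by rewrite [RHS]mulmx1.
rewrite exchange_big mulmx_sumr /=; apply: eq_bigr => j _.
rewrite (eq_bigr _ (fun i _ => key i j (fun z => (expR (- z * t))%:C))).
rewrite -scaler_sumr -!mulmx_suml sume -scalemxAr; congr (_ *: _).
by rewrite -[X in X *m _]/(1%:M *m S) mul1mx.
Qed.

Lemma is_pdM_expM mu A p : real_diagonalizable A ->
  is_pdM mu (fun q => expM (- (xcoord ix_m q)%:C *: A)) p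
    (- (ix_m == mu)%:R *: (A *m expM (- (xcoord ix_m p)%:C *: A))).
Proof.
move=> [I [e [x h]]].
apply: (is_pdM_ext (G := fun q => \sum_i (expR (- x i * xcoord ix_m q))%:C *: e i));
  last by move=> q; exact: expM_spectral.
apply: is_pdM_eq.
  apply: is_pdM_sum => i _; apply: is_pdM_scaler; exact: is_pdC_exp.
rewrite (expM_spectral _ h); case: h => orth sum1 ->.
rewrite [X in _ *: X](sum_idem _ _ orth) scaler_sumr; apply: eq_bigr => i _.
by rewrite scalerA rmorphN /= !mulNr mulrN.
Qed.

Lemma real_diagonalizable_opp A : real_diagonalizable A -> real_diagonalizable (- A).
Proof.
move=> [I [e [x [orth sum1 ->]]]]; exists I, e, (fun i => - x i); split=> //.
by rewrite -sumrN; apply: eq_bigr => i _; rewrite rmorphN scaleNr.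
Qed.

Lemma expM_opp A (t : R) : expM (- t%:C *: - A) = expM (- (- t)%:C *: A).
Proof. by rewrite scalerN scaleNr opprK rmorphN opprK. Qed.

Lemma is_pdM_expM_opp mu A p : real_diagonalizable A ->
  is_pdM mu (fun q => expM (- (- xcoord ix_m q)%:C *: A)) p
    ((ix_m == mu)%:R *: (A *m expM (- (- xcoord ix_m p)%:C *: A))).
Proof.
move=> hA; apply: is_pdM_ext; last by move=> q; rewrite -expM_opp.
apply: is_pdM_eq (is_pdM_expM mu p (real_diagonalizable_opp hA)) _.
by rewrite expM_opp mulNmx scalerN scaleNr opprK.
Qed.

Lemma elemM_expM A : real_diagonalizable A ->
  elemM (fun q : pt R => expM (- (xcoord ix_m q)%:C *: A)).
Proof.
move=> [I [e [x h]]].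
apply: (elemM_ext (G := fun q => \sum_i (expR (- x i * xcoord ix_m q))%:C *: e i));
  last by move=> q; exact: expM_spectral.
apply: elemM_sum => i; apply: elemM_scale; last exact: elemM_cst.
by apply: elemC_real; exact: elem_exp.
Qed.

End MatrixExponential.

(** * The Clifford module and its two commuting involutions *)

Lemma eq_lab (i : 'I_9) (k : nat) : (0 < k <= 9)%N -> (i == lab k) = (i.+1 == k).
Proof.
by move=> /andP[k0 k9]; rewrite -val_eqE /= inordK -1?ltnS ?prednK // -eqSS prednK.
Qed.

Lemma mem_labs (i : 'I_9) (s : seq nat) : all (fun k => 0 < k <= 9)%N s ->
  (i \in labs s) = (i.+1 \in s).
Proof.
by elim: s => //= k s IH /andP[hk /IH hs]; rewrite !inE -hs eq_lab.
Qed.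

Lemma uniq_labs (s : seq nat) : all (fun k => 0 < k <= 9)%N s ->
  uniq (labs s) = uniq s.
Proof.
elim: s => //= k s IH /andP[hk hs]; rewrite IH // mem_labs //.
have /eqP E : (lab k).+1 == k by rewrite -eq_lab.
by rewrite E.
Qed.

Lemma rot_pairE (i j : 'I_9) : rot_pair i j =
  has (fun s : seq nat => (i.+1 \in s) && (j.+1 \in s)) [:: [:: 1; 2]; [:: 3; 4]; [:: 6; 7; 8; 9]]%N.
Proof. by rewrite /rot_pair /has !mem_labs. Qed.

Lemma rot_pair_sym i j : rot_pair i j = rot_pair j i.
Proof. by rewrite !rot_pairE /= !(andbC (j.+1 \in _)). Qed.

(** Whether gamma_i commutes with gamma_125. *)
Definition comm125 (i : 'I_9) : bool := i.+1 \in [:: 1; 2; 5]%N.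
(** Whether gamma_i anticommutes with gamma_1234. *)
Definition anti1234 (i : 'I_9) : bool := i.+1 \in [:: 1; 2; 3; 4]%N.

Lemma rot_pair_same i j : rot_pair i j ->
  comm125 i = comm125 j /\ anti1234 i = anti1234 j.
Proof.
rewrite rot_pairE /comm125 /anti1234.
by case: i => [[|[|[|[|[|[|[|[|[|i]]]]]]]]] //= hi];
   case: j => [[|[|[|[|[|[|[|[|[|j]]]]]]]]] //= hj].
Qed.

(** The signs against gamma_125 and gamma_1234 separate the four blocks
    {1,2}, {3,4}, {5} and {6,..,9}. *)
Lemma same_rot_pair i j : i != j -> comm125 i = comm125 j -> anti1234 i = anti1234 j ->
  rot_pair i j.
Proof.
rewrite rot_pairE /comm125 /anti1234.
by case: i => [[|[|[|[|[|[|[|[|[|i]]]]]]]]] //= hi];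
   case: j => [[|[|[|[|[|[|[|[|[|j]]]]]]]]] //= hj].
Qed.

Section Involutions.
Variable R : realType.
Local Notation C := R[i].
Variable M : algType C.
Implicit Types (A J Q T : M).

Lemma two_neq0 : (2 : C) != 0. Proof. by rewrite pnatr_eq0. Qed.

Lemma half_double (V : lmodType C) (x : V) : 2^-1 *: (x + x) = x.
Proof. by rewrite -mulr2n -[x *+ 2]scaler_nat scalerA mulVf ?two_neq0 ?scale1r. Qed.

Definition proj (J : M) (b : bool) : M := 2^-1 *: (1 + (-1) ^+ b *: J).

Lemma proj_sum J : proj J false + proj J true = 1.
Proof.
rewrite /proj -scalerDr addrACA -scalerDl subrr scale0r addr0.
by rewrite half_double.
Qed.

Lemma proj_J J b : J * J = 1 -> J * proj J b = (-1) ^+ b *: proj J b.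
Proof.
move=> JJ; rewrite /proj -scalerAr mulrDr mulr1 -scalerAr JJ.
rewrite [RHS]scalerA mulrC -[RHS]scalerA; congr (_ *: _).
by rewrite scalerDr scalerA -expr2 sqrr_sign scale1r addrC.
Qed.

Lemma proj_mul J b c : J * J = 1 ->
  proj J b * proj J c = if b == c then proj J b else 0.
Proof.
move=> JJ; rewrite {1}/proj -scalerAl mulrDl mul1r -scalerAl proj_J // scalerA -signr_addb.
case: eqP => [<-|/eqP]; first by rewrite addbb scale1r half_double.
by case: b; case: c => // _; rewrite /= scaleN1r subrr scaler0.
Qed.

Lemma proj_diff J : proj J false - proj J true = J.
Proof.
rewrite /proj -scalerBr opprD addrACA subrr add0r -scalerBl opprK scalerDl scale1r.
by rewrite half_double.
Qed.

Lemma proj_comm J A b : A * J = J * A -> A * proj J b = proj J b * A.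
Proof.
by move=> h; rewrite /proj -scalerAr -scalerAl mulrDr mulrDl mulr1 mul1r -scalerAr
  -scalerAl h.
Qed.

Lemma proj2_mul Q T b c b' c' : Q * Q = 1 -> T * T = 1 -> T * Q = Q * T ->
  proj Q b * proj T c * (proj Q b' * proj T c') =
  if (b == b') && (c == c') then proj Q b * proj T c else 0.
Proof.
move=> QQ TT TQ.
have -> : proj Q b * proj T c * (proj Q b' * proj T c') =
    (proj Q b * proj Q b') * (proj T c * proj T c').
  rewrite -!mulrA; congr (_ * _); rewrite !mulrA; congr (_ * _).
  by apply: proj_comm; apply/esym; apply: proj_comm.
rewrite !proj_mul //.
by case: (b == b'); case: (c == c'); rewrite /= ?mul0r ?mulr0.
Qed.

Lemma proj2_sum Q T : \sum_b \sum_c proj Q b * proj T c = 1.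
Proof.
by rewrite !big_bool /= -!mulrDr addrC (addrC (proj T true)) !proj_sum !mulr1 proj_sum.
Qed.

(** The common shape of cbar and d: a real multiple of T on each eigenspace of Q. *)
Definition split_mul Q T (x0 x1 : R) : M :=
  (x0%:C *: proj Q false + x1%:C *: proj Q true) * T.

Lemma proj2_expand Q T (x0 x1 : R) :
  split_mul Q T x0 x1 =
  \sum_b \sum_(c : bool) ((-1) ^+ c * (if b then x1 else x0))%:C *: (proj Q b * proj T c).
Proof.
rewrite /split_mul !big_bool /= -{1}(proj_diff T).
rewrite mulrBr !mulrDl -!scalerAl !expr0 !expr1 !mul1r !mulN1r !rmorphN /= !scaleNr.
by rewrite [RHS]addrACA -opprD [RHS]addrC [X in _ = X - _]addrC [X in _ = _ - X]addrC.
Qed.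

Lemma split_mul_comm Q T (x0 x1 : R) A : A * Q = Q * A -> A * T = T * A ->
  A * split_mul Q T x0 x1 = split_mul Q T x0 x1 * A.
Proof.
move=> AQ AT; rewrite /split_mul.
move: (proj_comm false AQ) (proj_comm true AQ).
move: (proj Q false) (proj Q true) => P0 P1 h0 h1.
rewrite mulrA -[RHS]mulrA -AT [RHS]mulrA; congr (_ * _).
by rewrite mulrDr mulrDl -!scalerAr -!scalerAl h0 h1.
Qed.

End Involutions.

Section InvolutionMatrices.
Variable R : realType.
Local Notation C := R[i].
Variable n : nat.
Local Notation M := 'M[C]_n.+1.
Implicit Types (A J Q T : M).

Lemma double_spectral (I J : finType) A (F : I -> J -> M) (x : I -> J -> R) :
  (forall i j i' j', F i j * F i' j' = if (i == i') && (j == j') then F i j else 0) ->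
  \sum_i \sum_j F i j = 1 -> A = \sum_i \sum_j (x i j)%:C *: F i j ->
  real_diagonalizable A.
Proof.
move=> orth sum1 AE.
exists (I * J)%type, (fun p => F p.1 p.2), (fun p => x p.1 p.2); split.
- by move=> [i j] [i' j']; rewrite orth xpair_eqE.
- by rewrite -sum1 pair_bigA.
- by rewrite AE pair_bigA.
Qed.

(** The products of the eigenprojections of Q and T resolve the identity. *)
Lemma involutions_diag Q T (x0 x1 : R) : Q * Q = 1 -> T * T = 1 -> T * Q = Q * T ->
  real_diagonalizable (split_mul Q T x0 x1).
Proof.
move=> QQ TT TQ.
exact: (double_spectral (fun b c b' c' => proj2_mul b c b' c' QQ TT TQ)
  (proj2_sum Q T) (proj2_expand Q T x0 x1)).
Qed.

Lemma proj_act J (b c : bool) (u : 'cV[C]_n.+1) : J *m u = (-1) ^+ b *: u ->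
  proj J c *m u = if b == c then u else 0.
Proof.
move=> Ju; rewrite /proj -scalemxAl mulmxDl mul1mx -scalemxAl Ju scalerA -signr_addb.
by case: b {Ju}; case: c; rewrite /= ?expr0 ?expr1 ?scaleN1r ?scale1r ?half_double
  ?subrr ?scaler0.
Qed.

Lemma proj_true_act0 J (u : 'cV[C]_n.+1) : proj J true *m u = 0 -> J *m u = u.
Proof.
rewrite /proj -scalemxAl mulmxDl mul1mx expr1 scaleN1r mulNmx => /eqP.
by rewrite scaler_eq0 invr_eq0 (negPf (two_neq0 R)) subr_eq0 => /eqP.
Qed.

Lemma proj_eigen J (b : bool) (u : 'cV[C]_n.+1) : J * J = 1 ->
  J *m (proj J b *m u) = (-1) ^+ b *: (proj J b *m u).
Proof. by move=> JJ; rewrite mulmxA mulmxE proj_J // scalemxAl. Qed.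

Lemma split_mul_act Q T (x0 x1 : R) (b : bool) (u : 'cV[C]_n.+1) :
  Q *m (T *m u) = (-1) ^+ b *: (T *m u) ->
  split_mul Q T x0 x1 *m u = (if b then x1 else x0)%:C *: (T *m u).
Proof.
move=> Qu; rewrite /split_mul -mulmxE.
move: (proj_act false Qu) (proj_act true Qu).
move: (proj Q false) (proj Q true) => P0 P1 h0 h1.
rewrite -mulmxA mulmxDl -!scalemxAl h0 h1.
by case: b {h0 h1 Qu}; rewrite /= ?scaler0 ?addr0 ?add0r.
Qed.

End InvolutionMatrices.

Section CliffordModule.
Variable R : realType.
Local Notation C := R[i].
Variable gamma : gammas R.
Hypothesis hgamma : clifford_rep gamma.
Local Notation M16 := 'M[C]_16.

Lemma gamma_sq i : gamma i * gamma i = -1.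
Proof.
have := hgamma i i; rewrite eqxx mulr1 -mulr2n -scaler_nat => h.
apply: (scalerI (two_neq0 R)); rewrite h.
by rewrite -scalemx1 scaleNr scalerN.
Qed.

Lemma gamma_anti i j : i != j -> gamma i * gamma j = - (gamma j * gamma i).
Proof.
move=> ij; apply/eqP; rewrite -subr_eq0 opprK hgamma (negPf ij) mulr0 oppr0.
by rewrite raddf0.
Qed.

Lemma gamma_comm i j : gamma i * gamma j =
  - ((2 * (i == j)%:R) *: 1) - gamma j * gamma i.
Proof. by apply/eqP; rewrite -subr_eq opprK hgamma -scalemx1 scaleNr. Qed.

Definition blade (s : seq 'I_9) : M16 := \prod_(k <- s) gamma k.

Lemma gammaIE s : uniq s -> gammaI gamma s = blade s.
Proof. by rewrite /gammaI => ->. Qed.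

Lemma blade_cons k s : blade (k :: s) = gamma k * blade s.
Proof. by rewrite /blade big_cons. Qed.

(** Moving a generator past a blade costs one sign for each other generator. *)
Lemma gamma_blade i s : uniq s ->
  gamma i * blade s = (-1) ^+ (odd (size s) (+) (i \in s)) *: (blade s * gamma i).
Proof.
elim: s => [_|k s IH /= /andP[ks us]].
  by rewrite /blade big_nil mulr1 mul1r scale1r.
rewrite blade_cons inE mulrA; have [ik|ik] := eqVneq i k.
  rewrite ik in IH *.
  by rewrite -mulrA [in LHS]IH // (negPf ks) addbF /= addbT negbK -scalerAr mulrA.
rewrite gamma_anti // mulNr -!mulrA IH // -scalerAr -scaleNr /=.
by congr (_ *: _); case: (odd _); case: (i \in s); rewrite /= ?expr0 ?expr1 ?opprK.
Qed.

Lemma blade_rev s : uniq s -> blade (rev s) = (-1) ^+ 'C(size s, 2) *: blade s.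
Proof.
elim: s => [_|k s IH /= /andP[ks us]]; first by rewrite /blade !big_nil scale1r.
rewrite rev_cons {1}/blade -cats1 big_cat big_seq1 /= -/(blade _) IH // blade_cons.
rewrite gamma_blade // (negPf ks) addbF scalerA binS bin1 -scalerAl; congr (_ *: _).
by rewrite exprD signr_odd -mulrA -expr2 sqrr_sign mulr1.
Qed.

Lemma blade_sq s : uniq s -> blade s * blade s = (-1) ^+ 'C((size s).+1, 2) *: 1.
Proof.
elim: s => [_|k s IH /= /andP[ks us]].
  by rewrite /blade !big_nil mulr1 expr0 scale1r.
rewrite blade_cons -mulrA (mulrA (blade s)).
have -> : blade s * gamma k = (-1) ^+ (size s) *: (gamma k * blade s).
  by rewrite gamma_blade // (negPf ks) addbF signr_odd scalerA -expr2 sqrr_sign scale1r.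
rewrite -scalerAl -scalerAr -(mulrA (gamma k)) IH // mulrA gamma_sq -scalerAr mulr1.
by rewrite !scalerN !scalerA [in RHS]binS bin1 addnC exprD exprS mulN1r mulNr scaleNr.
Qed.

(** Locked, as is [Q1234], so that unification does not compare matrix products. *)
Definition T125 : M16 := locked (gammaI gamma (labs [:: 1; 2; 5]%N)).
Definition Q1234 : M16 := locked (gammaI gamma (labs [:: 1; 2; 3; 4]%N)).

Lemma T125E : T125 = blade (labs [:: 1; 2; 5]%N).
Proof. by rewrite /T125 -lock gammaIE // uniq_labs. Qed.

Lemma Q1234E : Q1234 = blade (labs [:: 1; 2; 3; 4]%N).
Proof. by rewrite /Q1234 -lock gammaIE // uniq_labs. Qed.

Lemma T125_sq : T125 * T125 = 1.
Proof. by rewrite T125E blade_sq ?uniq_labs //= -signr_odd expr0 scale1r. Qed.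

Lemma Q1234_sq : Q1234 * Q1234 = 1.
Proof. by rewrite Q1234E blade_sq ?uniq_labs //= -signr_odd expr0 scale1r. Qed.

Lemma gamma_T i : gamma i * T125 = (-1) ^+ (~~ comm125 i) *: (T125 * gamma i).
Proof. by rewrite T125E gamma_blade ?uniq_labs // mem_labs. Qed.

Lemma gamma_Q i : gamma i * Q1234 = (-1) ^+ (anti1234 i) *: (Q1234 * gamma i).
Proof. by rewrite Q1234E gamma_blade ?uniq_labs // mem_labs. Qed.

Lemma blade_Q s : blade s * Q1234 =
  (-1) ^+ (odd (count anti1234 s)) *: (Q1234 * blade s).
Proof.
elim: s => [|k s IH]; first by rewrite /blade big_nil mulr1 mul1r scale1r.
rewrite blade_cons -mulrA IH -scalerAr (mulrA (gamma k) Q1234) gamma_Q -scalerAl scalerA mulrA.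
by congr (_ *: _); rewrite /= oddD signr_addb mulrC oddb.
Qed.

Lemma TQ_comm : T125 * Q1234 = Q1234 * T125.
Proof.
rewrite T125E blade_Q (_ : count _ _ = 2%N) ?scale1r //.
by rewrite /= /anti1234 /lab !inordK.
Qed.

Variables x0 x1 : R.

Definition twoparam : M16 := split_mul Q1234 T125 x0 x1.

Lemma twoparam_diag : real_diagonalizable twoparam.
Proof.
have := @involutions_diag R 15 Q1234 T125 x0 x1.
by move/(_ Q1234_sq)/(_ T125_sq)/(_ TQ_comm).
Qed.

Lemma Q_gamma_act i (b : bool) (u : 'cV[C]_16) : Q1234 *m u = (-1) ^+ b *: u ->
  Q1234 *m (gamma i *m u) = (-1) ^+ (b (+) anti1234 i) *: (gamma i *m u).
Proof.
move=> Qu; have -> : Q1234 *m (gamma i *m u) =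
    (-1) ^+ (anti1234 i) *: (gamma i *m (Q1234 *m u)).
  rewrite !mulmxA -[gamma i *m _]/(gamma i * _) gamma_Q -scalemxAl scalerA -expr2 sqrr_sign.
  by rewrite scale1r.
by rewrite Qu -scalemxAr scalerA signr_addb mulrC.
Qed.

Lemma Q_T_act (b : bool) (u : 'cV[C]_16) : Q1234 *m u = (-1) ^+ b *: u ->
  Q1234 *m (T125 *m u) = (-1) ^+ b *: (T125 *m u).
Proof.
by move=> Qu; rewrite mulmxA -[_ *m T125]/(_ * _) -TQ_comm -mulmxA Qu -scalemxAr.
Qed.

Lemma twoparam_act (b : bool) (u : 'cV[C]_16) : Q1234 *m u = (-1) ^+ b *: u ->
  twoparam *m u = (if b then x1 else x0)%:C *: (T125 *m u).
Proof. by move=> Qu; apply: split_mul_act; exact: Q_T_act. Qed.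

Lemma twoparam_comm (A : M16) : A * Q1234 = Q1234 * A -> A * T125 = T125 * A ->
  A * twoparam = twoparam * A.
Proof. exact: split_mul_comm. Qed.

Lemma T_gamma_T i (u : 'cV[C]_16) : T125 *m (gamma i *m (T125 *m u)) =
  (-1) ^+ (~~ comm125 i) *: (gamma i *m u).
Proof.
rewrite (mulmxA (gamma i)) -[gamma i *m _]/(gamma i * _) gamma_T -scalemxAl -scalemxAr.
by rewrite !mulmxA -[T125 *m T125]/(T125 * T125) T125_sq mul1mx.
Qed.

Lemma TT_act (u : 'cV[C]_16) : T125 *m (T125 *m u) = u.
Proof. by rewrite mulmxA -[T125 *m T125]/(T125 * T125) T125_sq mul1mx. Qed.

End CliffordModule.

(** * Rotations on spinors, and the maps cbar, d and s *)

Section SpinRotations.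
Variable R : realType.
Local Notation C := R[i].
Variable gamma : gammas R.
Hypothesis hgamma : clifford_rep gamma.
Implicit Types (Rm : 'M[C]_9).

(** Skew-symmetric and block diagonal: these rotations preserve lambda and their
    spin lifts commute with gamma_125 and gamma_1234. *)
Definition rotation Rm : Prop :=
  (forall i j, Rm j i = - Rm i j) /\ (forall i j, ~~ rot_pair i j -> Rm i j = 0).

Definition spin Rm : 'M[C]_16 :=
  4^-1 *: \sum_i \sum_j Rm i j *: (gamma i * gamma j).

Lemma rotation_same Rm i j : rotation Rm -> Rm i j != 0 ->
  comm125 i = comm125 j /\ anti1234 i = anti1234 j.
Proof.
move=> [_ h] nz; apply: rot_pair_same; apply/negPn/negP => /h e.
by rewrite e eqxx in nz.
Qed.

(** If gamma_i and gamma_j take the same sign past J then the two signs cancel in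
    gamma_i gamma_j. *)
Lemma spin_blade Rm (J : 'M[C]_16) (s : 'I_9 -> bool) :
  (forall i, gamma i * J = (-1) ^+ s i *: (J * gamma i)) ->
  (forall i j, Rm i j != 0 -> s i = s j) -> spin Rm * J = J * spin Rm.
Proof.
move=> hJ hs; rewrite /spin -scalerAl -scalerAr; congr (_ *: _).
rewrite mulr_suml mulr_sumr; apply: eq_bigr => i _.
rewrite mulr_suml mulr_sumr; apply: eq_bigr => j _.
rewrite -scalerAl -scalerAr; have [->|nz] := eqVneq (Rm i j) 0; first by rewrite !scale0r.
rewrite -mulrA hJ -scalerAr mulrA hJ -scalerAl [_ ^+ _ *: (_ *: _)]scalerA (hs _ _ nz) -signr_addb addbb.
by rewrite scale1r mulrA.
Qed.

Lemma spin_T Rm : rotation Rm -> spin Rm * T125 gamma = T125 gamma * spin Rm.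
Proof.
move=> hR; apply: (spin_blade (s := fun i => ~~ comm125 i)) => [i|i j nz].
  exact: gamma_T.
by have [-> _] := rotation_same hR nz.
Qed.

Lemma spin_Q Rm : rotation Rm -> spin Rm * Q1234 gamma = Q1234 gamma * spin Rm.
Proof.
move=> hR; apply: (spin_blade (s := anti1234)) => [i|i j nz].
  exact: gamma_Q.
by have [_ ->] := rotation_same hR nz.
Qed.

Lemma gamma_pair_comm i j k : gamma i * gamma j * gamma k - gamma k * (gamma i * gamma j) =
  (2 * (i == k)%:R) *: gamma j - (2 * (j == k)%:R) *: gamma i.
Proof.
rewrite -mulrA (gamma_comm hgamma j k) mulrBr mulrN -scalerAr mulr1 (mulrA (gamma i)).
rewrite (gamma_comm hgamma i k) mulrBl mulNr -scalerAl mul1r -mulrA.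
move: (_ *: gamma i) (_ *: gamma j) (gamma k * _) => x y z.
by rewrite opprB opprK [z + y]addrC addrA addrK addrC.
Qed.

Lemma spin_gamma Rm k : rotation Rm ->
  spin Rm * gamma k - gamma k * spin Rm = \sum_j Rm k j *: gamma j.
Proof.
move=> [anti _]; rewrite /spin -scalerAl -scalerAr -scalerBr.
rewrite mulr_suml mulr_sumr -sumrB.
have E i : (\sum_j Rm i j *: (gamma i * gamma j)) * gamma k -
    gamma k * (\sum_j Rm i j *: (gamma i * gamma j)) =
    \sum_j ((2 * (i == k)%:R * Rm i j) *: gamma j - (2 * (j == k)%:R * Rm i j) *: gamma i).
  rewrite mulr_suml mulr_sumr -sumrB; apply: eq_bigr => j _.
  rewrite -scalerAl -scalerAr -scalerBr gamma_pair_comm scalerBr !scalerA.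
  by rewrite !(mulrC (Rm i j)).
rewrite (eq_bigr _ (fun i _ => E i)) {E}.
under eq_bigr => i _ do rewrite sumrB.
rewrite sumrB.
have -> : \sum_i \sum_j (2 * (i == k)%:R * Rm i j) *: gamma j = \sum_j (2 * Rm k j) *: gamma j.
  rewrite (bigD1 k) //= [X in _ + X]big1 ?addr0.
    by apply: eq_bigr => j _; rewrite eqxx mulr1.
  by move=> i ik; apply: big1 => j _; rewrite (negPf ik) mulr0 mul0r scale0r.
have -> : \sum_i \sum_j (2 * (j == k)%:R * Rm i j) *: gamma i = \sum_i (2 * Rm i k) *: gamma i.
  apply: eq_bigr => i _; rewrite (bigD1 k) //= eqxx mulr1 big1 ?addr0 //.
  by move=> j jk; rewrite (negPf jk) mulr0 mul0r scale0r.
rewrite -sumrB scaler_sumr; apply: eq_bigr => j _.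
rewrite -scalerBl scalerA (anti k j); congr (_ *: _); by field.
Qed.

(** The commutator with a spin lift is a derivation, given on each factor of
    gamma_i gamma_j by [spin_gamma]. *)
Lemma spin_spin Rm Rm' : rotation Rm -> rotation Rm' ->
  spin Rm * spin Rm' - spin Rm' * spin Rm = spin (Rm' *m Rm - Rm *m Rm').
Proof.
move=> hR hR'; have [anti _] := hR.
have hS k := spin_gamma k hR.
rewrite [spin Rm']/spin [in RHS]/spin.
move: (spin Rm) hS => S hS; rewrite -scalerAr -scalerAl -scalerBr; congr (_ *: _).
rewrite mulr_sumr mulr_suml -sumrB.
have E i : S * (\sum_j Rm' i j *: (gamma i * gamma j)) -
    (\sum_j Rm' i j *: (gamma i * gamma j)) * S =
    \sum_j \sum_k ((Rm' i j * Rm i k) *: (gamma k * gamma j) +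
                   (Rm' i j * Rm j k) *: (gamma i * gamma k)).
  rewrite mulr_sumr mulr_suml -sumrB; apply: eq_bigr => j _.
  rewrite -scalerAl -scalerAr -scalerBr.
  have -> : S * (gamma i * gamma j) - gamma i * gamma j * S =
     (S * gamma i - gamma i * S) * gamma j +
     gamma i * (S * gamma j - gamma j * S).
    by rewrite mulrBl mulrBr !mulrA addrA subrK.
  rewrite !hS mulr_suml mulr_sumr -big_split scaler_sumr /=.
  by apply: eq_bigr => k _; rewrite -scalerAl -scalerAr scalerDr !scalerA.
rewrite (eq_bigr _ (fun i _ => E i)) {E}.
under eq_bigr => i _ do under eq_bigr => j _ do rewrite big_split.
under eq_bigr => i _ do rewrite big_split.
rewrite big_split /= addrC.
have -> : \sum_i \sum_j \sum_k (Rm' i j * Rm j k) *: (gamma i * gamma k) =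
   \sum_i \sum_j (Rm' *m Rm) i j *: (gamma i * gamma j).
  apply: eq_bigr => i _; rewrite exchange_big /=; apply: eq_bigr => k _.
  by rewrite mxE scaler_suml.
have -> : \sum_i \sum_j \sum_k (Rm' i j * Rm i k) *: (gamma k * gamma j) =
   - \sum_i \sum_j (Rm *m Rm') i j *: (gamma i * gamma j).
  rewrite -sumrN [LHS]exchange_big /=.
  under eq_bigr => j _ do rewrite exchange_big /=.
  rewrite [LHS]exchange_big /=.
  apply: eq_bigr => k _; rewrite -sumrN; apply: eq_bigr => j _.
  rewrite mxE scaler_suml -sumrN; apply: eq_bigr => i _.
  by rewrite (anti k i) mulrN scaleNr mulrC.
rewrite -sumrB; apply: eq_bigr => i _; rewrite -sumrB; apply: eq_bigr => j _.
by rewrite -scalerBl !mxE.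
Qed.

Lemma spin_linear (a : C) Rm Rm' : spin (a *: Rm + Rm') = a *: spin Rm + spin Rm'.
Proof.
rewrite /spin scalerA mulrC -scalerA -scalerDr; congr (_ *: _).
rewrite scaler_sumr -big_split; apply: eq_bigr => i _.
rewrite scaler_sumr -big_split; apply: eq_bigr => j _.
by rewrite !mxE scalerDl scalerA.
Qed.

End SpinRotations.

Section StructureMaps.
Variable R : realType.
Local Notation C := R[i].
Variables ap am ap' am' : R.
Variable gamma : gammas R.
Hypothesis hgamma : clifford_rep gamma.
Implicit Types (u : 'cV[C]_16) (Rm : 'M[C]_9).

Local Notation T := (T125 gamma).
Local Notation Q := (Q1234 gamma).
Local Notation cb := (cbar ap am gamma).
Local Notation dm := (dd ap' am' gamma).
Local Notation sc := (scd ap am ap' am' gamma).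
Local Notation lam := (lambda ap am ap').

Lemma Xp_proj : Xp gamma = proj Q false.
Proof. by rewrite /Xp /proj /Q1234 -lock expr0 scale1r. Qed.

Lemma Xm_proj : Xm gamma = proj Q true.
Proof. by rewrite /Xm /proj /Q1234 -lock expr1 scaleN1r. Qed.

Lemma cbarE : cb = twoparam gamma ap am.
Proof. by rewrite /cbar Xp_proj Xm_proj /twoparam /split_mul /T125 -lock. Qed.

Lemma ddE : dm = twoparam gamma ap' am'.
Proof. by rewrite /dd Xp_proj Xm_proj /twoparam /split_mul /T125 -lock. Qed.

Lemma cbar_diag : real_diagonalizable cb.
Proof. by rewrite cbarE; exact: twoparam_diag. Qed.

Lemma dd_diag : real_diagonalizable dm.
Proof. by rewrite ddE; exact: twoparam_diag. Qed.

(** The real number through which s(e_i) acts on the eigenspace Q = (-1)^b, see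
    [scd_act]. *)
Definition nu (b : bool) (i : 'I_9) : R :=
  (if b (+) anti1234 i then am else ap) - (-1) ^+ (~~ comm125 i) * (if b then am' else ap').

Lemma lambda_nu i : lam i = - 'i * (nu false i)%:C.
Proof.
rewrite /lambda /nu !mem_labs // eq_lab // /anti1234 /comm125.
congr (_ * (_)%:C).
case: i => [[|[|[|[|[|[|[|[|[|i]]]]]]]]] hi] //=;
  by rewrite ?expr0 ?expr1 ?mul1r ?mulN1r ?opprK.
Qed.

Lemma i_lambda i : 'i * lam i = (nu false i)%:C.
Proof. by rewrite lambda_nu mulrA mulrN -expr2 sqrCi opprK mul1r. Qed.

Lemma lambda_sq i : lam i ^+ 2 = - (nu false i ^+ 2)%:C.
Proof. by rewrite lambda_nu exprMn sqrrN sqrCi mulN1r rmorphXn. Qed.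

Lemma lambda_sq_real i : (complex.Re (lam i ^+ 2))%:C = lam i ^+ 2.
Proof. by rewrite lambda_sq complexReN /= rmorphN. Qed.

Lemma lambda_neq0 i : indecomposable ap am ap' -> lam i != 0.
Proof.
rewrite /indecomposable unitmxE det_diag unitfE => /prodf_neq0 /(_ i isT).
by apply: contraNneq; rewrite mxE => ->; rewrite expr0n.
Qed.

Lemma rotation_lambda Rm i j : rotation Rm -> Rm i j * lam i = Rm i j * lam j.
Proof.
move=> hR; have [->|nz] := eqVneq (Rm i j) 0; first by rewrite !mul0r.
have [e1 e2] := rotation_same hR nz.
by rewrite !lambda_nu /nu e1 e2.
Qed.

Lemma Xm0_Q u : Xm gamma *m u = 0 -> Q *m u = u.
Proof.
by rewrite Xm_proj; exact: proj_true_act0.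
Qed.

Lemma Q_Xm0 u : Q *m u = u -> Xm gamma *m u = 0.
Proof.
move=> h; rewrite Xm_proj (@proj_act _ _ _ false) //.
by rewrite h expr0 scale1r.
Qed.

Lemma Q_Xm u : Q *m (Xm gamma *m u) = (-1) ^+ true *: (Xm gamma *m u).
Proof.
by rewrite Xm_proj; apply: proj_eigen; exact: Q1234_sq.
Qed.

Lemma scd_mul i u : sc i *m u = cb *m (gamma i *m u) - gamma i *m (dm *m u).
Proof. by rewrite /scd; move: cb dm => c d; rewrite -!mulmxE mulmxBl -!mulmxA. Qed.

Lemma cbar_act (b : bool) u : Q *m u = (-1) ^+ b *: u ->
  cb *m u = (if b then am else ap)%:C *: (T *m u).
Proof. by rewrite cbarE; exact: twoparam_act. Qed.

Lemma dd_act (b : bool) u : Q *m u = (-1) ^+ b *: u ->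
  dm *m u = (if b then am' else ap')%:C *: (T *m u).
Proof. by rewrite ddE; exact: twoparam_act. Qed.

Lemma scd_act i (b : bool) u : Q *m u = (-1) ^+ b *: u ->
  sc i *m u = (nu b i)%:C *: (T *m (gamma i *m u)).
Proof.
move=> Qu; rewrite scd_mul.
have := cbar_act (Q_gamma_act hgamma i Qu); have := dd_act Qu.
have : gamma i *m (T *m u) = (-1) ^+ (~~ comm125 i) *: (T *m (gamma i *m u)).
  by have := gamma_T hgamma i; rewrite -!mulmxE => E; rewrite !mulmxA E -scalemxAl.
move: cb dm T => c d t hT -> ->; rewrite -scalemxAr hT.
rewrite scalerA -scalerBl /nu; congr (_ *: _).
by rewrite rmorphB rmorphM rmorphXn rmorphN rmorph1 /= [X in _ = _ - X]mulrC.
Qed.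

(** The commutator of the two exponents through [s_i] is what obstructs the
    existence of parallel sections on the eigenspace [Q = (-1)^b]. *)
Lemma obstruction_act i (b : bool) u : Q *m u = (-1) ^+ b *: u ->
  cb *m (sc i *m u) - sc i *m (dm *m u) = (nu b i ^+ 2)%:C *: (gamma i *m u).
Proof.
move=> Qu; have QTu := Q_T_act hgamma Qu.
have := scd_act i Qu; have := scd_act i QTu; have := dd_act Qu.
have := cbar_act (Q_T_act hgamma (Q_gamma_act hgamma i Qu)).
rewrite (T_gamma_T hgamma) (TT_act hgamma).
move: cb dm (sc i) T => c d s t hc hd hs1 hs2.
rewrite hs2 hd -!scalemxAr hc hs1.
rewrite !scalerA -scalerBl; congr (_ *: _).
rewrite rmorphXn expr2 /= [X in _ = _ * X](_ : _ = (if b (+) anti1234 i then am else ap)%:C -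
  (-1) ^+ (~~ comm125 i) * (if b then am' else ap')%:C); first by ring.
by rewrite /nu rmorphB rmorphM rmorphXn rmorphN rmorph1.
Qed.

Lemma spin_cbar Rm : rotation Rm -> spin gamma Rm * cb = cb * spin gamma Rm.
Proof. by move=> hR; rewrite cbarE; apply: twoparam_comm; [exact: spin_Q|exact: spin_T]. Qed.

Lemma spin_dd Rm : rotation Rm -> spin gamma Rm * dm = dm * spin gamma Rm.
Proof. by move=> hR; rewrite ddE; apply: twoparam_comm; [exact: spin_Q|exact: spin_T]. Qed.

Lemma Q_dd : Q * dm = dm * Q.
Proof. by rewrite ddE; apply: twoparam_comm => //; rewrite (TQ_comm hgamma). Qed.

Lemma spin_scd Rm k : rotation Rm ->
  spin gamma Rm * sc k - sc k * spin gamma Rm = \sum_j Rm k j *: sc j.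
Proof.
move=> hR; have := spin_gamma hgamma k hR.
move: (spin_cbar hR) (spin_dd hR); rewrite /scd.
move: (spin gamma Rm) cb dm => S c d hc hd hg.
have -> : S * (c * gamma k - gamma k * d) - (c * gamma k - gamma k * d) * S =
    c * (S * gamma k - gamma k * S) - (S * gamma k - gamma k * S) * d.
  have e1 : S * (c * gamma k) = c * (S * gamma k) by rewrite !mulrA hc.
  have e2 : gamma k * d * S = gamma k * S * d by rewrite -!mulrA hd.
  rewrite !mulrBr !mulrBl e1 e2 !mulrA.
  by rewrite !opprB [LHS]addrACA [RHS]addrACA; congr (_ + _); exact: addrC.
rewrite hg mulr_sumr mulr_suml -sumrB; apply: eq_bigr => j _.
by rewrite -scalerAr -scalerAl scalerBr.
Qed.

End StructureMaps.

(** * Killing fields in coordinates *)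

Section Indices.

Lemma by_index_p (A : Type) (x y : A) f : by_index x y f ix_p = x.
Proof. by rewrite /by_index /ix_p -[lshift _ _]/(unsplit (inl ord0)) fintype.unsplitK. Qed.

Lemma by_index_m (A : Type) (x y : A) f : by_index x y f ix_m = y.
Proof. by rewrite /by_index /ix_m -[lshift _ _]/(unsplit (inl ord_max)) fintype.unsplitK. Qed.

Lemma by_index_ix (A : Type) (x y : A) f i : by_index x y f (ix i) = f i.
Proof. by rewrite /by_index /ix -[rshift _ _]/(unsplit (inr i)) fintype.unsplitK. Qed.

Definition by_indexE := (by_index_p, by_index_m, by_index_ix).

Variant index_spec : 'I_11 -> Prop :=
| IndexP : index_spec ix_p
| IndexM : index_spec ix_m
| IndexI i : index_spec (ix i).

Lemma indexP mu : index_spec mu.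
Proof.
have <- : unsplit (@fintype.split 2 9 mu) = mu by exact: fintype.splitK.
case: (@fintype.split 2 9 mu) => [k|i]; last exact: IndexI.
case: (unliftP ord0 k) => [j ->|->]; last exact: IndexP.
rewrite (_ : lift _ _ = ord_max); first exact: IndexM.
by apply: val_inj; rewrite /= (ord1 j).
Qed.

Lemma sum_index (V : nmodType) (F : 'I_11 -> V) :
  \sum_mu F mu = F ix_p + F ix_m + \sum_i F (ix i).
Proof.
rewrite (@big_split_ord _ _ _ 2 9) /= big_ord_recl big_ord1; congr (_ + F _ + _).
by apply: val_inj.
Qed.

Lemma ix_pm : (ix_p == ix_m) = false. Proof. by []. Qed.
Lemma ix_mp : (ix_m == ix_p) = false. Proof. by []. Qed.
Lemma ix_pi i : (ix_p == ix i) = false. Proof. by []. Qed.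
Lemma ix_ip i : (ix i == ix_p) = false. Proof. by []. Qed.
Lemma ix_mi i : (ix_m == ix i) = false. Proof. by []. Qed.
Lemma ix_im i : (ix i == ix_m) = false. Proof. by []. Qed.
Lemma ix_ij i j : (ix i == ix j) = (i == j).
Proof. by rewrite /ix (inj_eq (@rshift_inj 2 9)). Qed.

Definition ix_eqE := (ix_pm, ix_mp, ix_pi, ix_ip, ix_mi, ix_im, ix_ij, eqxx).

End Indices.

Section KillingFields.
Variable R : realType.
Local Notation C := R[i].
Variables ap am ap' : R.
Local Notation lam := (lambda ap am ap').
Local Notation mu_ i := (nu ap am ap' 0 false i).
Implicit Types (p : pt R) (mu rho : 'I_11) (i j : 'I_9).

(** Up to constants, [chl] and [shl] are the derivatives of each other; as lambda
    is imaginary they are hyperbolic functions of x^-. *)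
Definition chl i (t : R) : C := cosC (lam i * t%:C).
Definition shl i (t : R) : C := lam i * sinC (lam i * t%:C).

Lemma expC_real (x : R) : expC x%:C = (expR x)%:C.
Proof. by rewrite /expC /= cos0 sin0 mulr1. Qed.

Lemma i_lambda_t i (t : R) : 'i * (lam i * t%:C) = (mu_ i * t)%:C.
Proof. by rewrite mulrA (i_lambda ap am ap' 0) -rmorphM. Qed.

Lemma chlE i t : chl i t = (expR (mu_ i * t))%:C / 2 + (expR (- mu_ i * t))%:C / 2.
Proof. by rewrite /chl /cosC i_lambda_t -rmorphN !expC_real mulrDl mulNr. Qed.

Lemma shlE i t : shl i t = (mu_ i)%:C * ((expR (- mu_ i * t))%:C / 2 - (expR (mu_ i * t))%:C / 2).
Proof.
rewrite /shl /sinC i_lambda_t -rmorphN !expC_real (lambda_nu ap am ap' 0) !mulNr.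
have i0 : ('i : C) != 0 by rewrite neq0Ci.
by field.
Qed.

Lemma chl0 i : chl i 0 = 1.
Proof. by rewrite chlE !mulr0 expR0 rmorph1; field. Qed.

Lemma shl0 i : shl i 0 = 0.
Proof. by rewrite shlE !mulr0 expR0 subrr mulr0. Qed.

(** The Wronskian of two solutions of the oscillator equation is constant; this
    makes the x^+ coefficient of a commutator constant. *)
Lemma chl_shl i t : lam i ^+ 2 * chl i t ^+ 2 + shl i t ^+ 2 = lam i ^+ 2.
Proof.
have : (expR (mu_ i * t))%:C * (expR (- mu_ i * t))%:C = 1 :> C.
  by rewrite -rmorphM -expRD mulNr subrr expR0.
rewrite chlE shlE (lambda_sq ap am ap' 0) rmorphXn /=.
move: (mu_ i)%:C (expR _)%:C (expR _)%:C => x z y zy.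
have -> : - x ^+ 2 * (y / 2 + z / 2) ^+ 2 + (x * (z / 2 - y / 2)) ^+ 2 = - x ^+ 2 * (y * z) by field.
by rewrite zy mulr1.
Qed.

Lemma is_pdC_chl mu i p :
  is_pdC mu (fun q => chl i (xcoord ix_m q)) p
    ((ix_m == mu)%:R * - shl i (xcoord ix_m p)).
Proof.
apply: is_pdC_ext; last by move=> q; exact: chlE.
apply: is_pdC_eq.
  apply: is_pdC_add; apply: is_pdC_mul; first [exact: is_pdC_exp|exact: is_pdC_cst].
rewrite shlE rmorphN /=; by field.
Qed.

Lemma is_pdC_shl mu i p :
  is_pdC mu (fun q => shl i (xcoord ix_m q)) p
    ((ix_m == mu)%:R * (lam i ^+ 2 * chl i (xcoord ix_m p))).
Proof.
apply: is_pdC_ext; last by move=> q; exact: shlE.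
apply: is_pdC_eq.
  apply: is_pdC_mul; first exact: is_pdC_cst.
  apply: is_pdC_add; last apply: is_pdC_opp; apply: is_pdC_mul;
    first [exact: is_pdC_exp|exact: is_pdC_cst].
rewrite chlE (lambda_sq ap am ap' 0) rmorphN rmorphXn /=; by field.
Qed.

Lemma elemC_chl i : elemC (fun q : pt R => chl i (xcoord ix_m q)).
Proof.
apply: elemC_ext; last by move=> q; exact: chlE.
by apply: elemC_add; apply: elemC_mul; first [exact: elemC_cst
  |apply: elemC_real; exact: elem_exp].
Qed.

Lemma elemC_shl i : elemC (fun q : pt R => shl i (xcoord ix_m q)).
Proof.
apply: elemC_ext; last by move=> q; exact: shlE.
apply: elemC_mul; first exact: elemC_cst.
by apply: elemC_add; last apply: elemC_opp; apply: elemC_mul; first [exact: elemC_cst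
  |apply: elemC_real; exact: elem_exp].
Qed.

(** Coordinates on K_0: the coefficients of K_-, K_+, K_i, K_i^* and of the
    rotations. *)
Record kdata := KData
  { km : C; kc : C; ka : 'I_9 -> C; kb : 'I_9 -> C; kr : 'M[C]_9 }.

Implicit Type th : kdata.

(** The parts of the components along d_i and d_+ that depend on x^-; [kg] is
    minus the derivative of [kf]. *)
Definition kf th i (t : R) : C := - (ka th i * chl i t + kb th i * shl i t).
Definition kg th i (t : R) : C := kb th i * lam i ^+ 2 * chl i t - ka th i * shl i t.

Lemma kfE th i t : kf th i t = - (ka th i * chl i t + kb th i * shl i t).
Proof. by []. Qed.
Lemma kgE th i t : kg th i t = kb th i * lam i ^+ 2 * chl i t - ka th i * shl i t.
Proof. by []. Qed.

Local Notation tm p := (xcoord ix_m p).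
Local Notation xc i p := (xcoord (ix i) p)%:C.

(** The Killing field with coordinates [th]. *)
Definition KV th : vfield R := fun p => \col_mu
  by_index (- kc th + \sum_i xc i p * kg th i (tm p)) (- km th)
    (fun i => kf th i (tm p) + \sum_j xc j p * kr th j i) mu.

Definition dKV th rho p : 'cV[C]_11 := \col_mu
  by_index (by_index 0 (\sum_i xc i p * (lam i ^+ 2 * kf th i (tm p)))
                       (fun j => kg th j (tm p)) rho)
    0 (fun i => by_index 0 (- kg th i (tm p)) (fun j => kr th j i) rho) mu.

Lemma is_pdC_kf mu th i p :
  is_pdC mu (fun q => kf th i (tm q)) p ((ix_m == mu)%:R * - kg th i (tm p)).
Proof.
apply: is_pdC_eq.
  apply: is_pdC_opp; apply: is_pdC_add; apply: is_pdC_mul;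
    first [exact: is_pdC_cst|exact: is_pdC_chl|exact: is_pdC_shl].
by rewrite /kg; ring.
Qed.

Lemma is_pdC_kg mu th i p :
  is_pdC mu (fun q => kg th i (tm q)) p
    ((ix_m == mu)%:R * (lam i ^+ 2 * kf th i (tm p))).
Proof.
apply: is_pdC_eq.
  apply: is_pdC_add; last apply: is_pdC_opp; apply: is_pdC_mul;
    first [exact: is_pdC_cst|exact: is_pdC_chl|exact: is_pdC_shl].
by rewrite /kf; ring.
Qed.

Lemma is_pdM_KV rho th p : is_pdM rho (KV th) p (dKV th rho p).
Proof.
move=> mu j; rewrite (ord1 j) {j} mxE.
apply: is_pdC_ext; last by move=> q; rewrite mxE.
case: (indexP mu) => [||i]; rewrite !by_indexE.
- apply: is_pdC_ext; last by move=> q; rewrite by_indexE.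
  apply: is_pdC_eq.
    apply: is_pdC_add; first exact: is_pdC_cst.
    apply: is_pdC_sum => i _; apply: is_pdC_mul; first exact: is_pdC_xcoord.
    exact: is_pdC_kg.
  rewrite add0r; case: (indexP rho) => [||k]; rewrite ?by_indexE.
  + by rewrite big1 // => i _; rewrite !ix_eqE !mul0r mulr0 addr0.
  + by apply: eq_bigr => i _; rewrite !ix_eqE mul0r add0r mul1r.
  + rewrite (bigD1 k) //= big1 ?addr0; last first.
      by move=> i ik; rewrite !ix_eqE (negPf ik) !mul0r mulr0 addr0.
    by rewrite !ix_eqE !mul0r mul1r mulr0 addr0.
- by apply: is_pdC_ext (is_pdC_cst _ _ _) _ => q; rewrite by_indexE.
- apply: is_pdC_ext; last by move=> q; rewrite by_indexE.
  apply: is_pdC_eq.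
    apply: is_pdC_add; first exact: is_pdC_kf.
    apply: is_pdC_sum => j _; apply: is_pdC_mul; first exact: is_pdC_xcoord.
    exact: is_pdC_cst.
  case: (indexP rho) => [||k]; rewrite ?by_indexE.
  + rewrite ix_mp mul0r add0r big1 // => j _; by rewrite !ix_eqE mul0r mulr0 addr0.
  + rewrite eqxx mul1r big1 ?addr0 // => j _; by rewrite !ix_eqE mul0r mulr0 addr0.
  + rewrite ix_mi mul0r add0r (bigD1 k) //= big1 ?addr0; last first.
      by move=> j jk; rewrite ix_eqE (negPf jk) mul0r mulr0 addr0.
    by rewrite eqxx mul1r mulr0 addr0.
Qed.

Lemma elemM_KV th : elemM (KV th).
Proof.
have hx i : elemC (fun q : pt R => xc i q) by apply: elemC_real; exact: elem_coord.
move=> mu j; apply: elemC_ext; last by move=> q; rewrite mxE.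
case: (indexP mu) => [||i].
- apply: elemC_ext; last by move=> q; rewrite by_indexE.
  apply: elemC_add; first exact: elemC_cst.
  apply: elemC_sum => i; apply: elemC_mul => //.
  apply: elemC_add; last apply: elemC_opp; apply: elemC_mul;
    first [exact: elemC_cst|exact: elemC_chl|exact: elemC_shl].
- by apply: elemC_ext (elemC_cst _) _ => q; rewrite by_indexE.
- apply: elemC_ext; last by move=> q; rewrite by_indexE.
  apply: elemC_add.
    apply: elemC_opp; apply: elemC_add; apply: elemC_mul;
    first [exact: elemC_cst|exact: elemC_chl|exact: elemC_shl].
  by apply: elemC_sum => k; apply: elemC_mul => //; exact: elemC_cst.
Qed.

Lemma pdV_KV rho th p : pdV rho (KV th) p = dKV th rho p.
Proof. exact: is_pdVE (is_pdM_KV rho th p). Qed.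

Lemma KV_p th p : KV th p ix_p 0 = - kc th + \sum_i xc i p * kg th i (tm p).
Proof. by rewrite mxE by_indexE. Qed.
Lemma KV_m th p : KV th p ix_m 0 = - km th.
Proof. by rewrite mxE by_indexE. Qed.
Lemma KV_i th p i : KV th p (ix i) 0 = kf th i (tm p) + \sum_j xc j p * kr th j i.
Proof. by rewrite mxE by_indexE. Qed.

Definition kadd (a : C) th th' : kdata :=
  KData (a * km th + km th') (a * kc th + kc th')
    (fun i => a * ka th i + ka th' i) (fun i => a * kb th i + kb th' i)
    (a *: kr th + kr th').

Lemma KV_linear a th th' : KV (kadd a th th') = a *: KV th + KV th'.
Proof.
apply/funext => p; apply/matrixP => mu j; rewrite (ord1 j) {j} !mxE.
case: (indexP mu) => [||i]; rewrite !by_indexE /=.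
- rewrite [X in _ + X](_ : _ = a * (\sum_i xc i p * kg th i (tm p)) +
    \sum_i xc i p * kg th' i (tm p)); first by ring.
  rewrite mulr_sumr -big_split; apply: eq_bigr => i _; rewrite /kg /=; ring.
- by rewrite opprD mulrN.
- rewrite mulrDr mulr_sumr addrACA -big_split /=; congr (_ + _).
    by rewrite /kf /=; ring.
  by apply: eq_bigr => j _; rewrite !mxE; ring.
Qed.

End KillingFields.

Notation KVE := (KV_p, KV_m, KV_i).

(** * The Lie algebra K_0 *)

Section LinearSpan.
Variable R : realType.
Local Notation C := R[i].
Variables (V : lmodType C) (S : set V).

Lemma lspan_subspace : is_subspace (lspan S).
Proof.
split.
  exists 0%N, (fun=> 0), (fun=> 0); split; first by case.
  by rewrite big_ord0.
move=> c u v [n [a [w [hw ->]]]] [m [b [z [hz ->]]]].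
exists (n + m)%N, (fun k => match fintype.split k with inl i => c * a i | inr j => b j end),
  (fun k => match fintype.split k with inl i => w i | inr j => z j end); split.
  by move=> k; case: (fintype.split k).
rewrite big_split_ord scaler_sumr /=; congr (_ + _); apply: eq_bigr => i _.
  by rewrite -[lshift _ _]/(unsplit (inl i)) fintype.unsplitK scalerA.
by rewrite -[rshift _ _]/(unsplit (inr i)) fintype.unsplitK.
Qed.

Lemma lspan_gen v : S v -> lspan S v.
Proof.
move=> h; exists 1%N, (fun=> 1), (fun=> v); split=> //.
by rewrite big_ord1 scale1r.
Qed.

Lemma lspanZ a v : lspan S v -> lspan S (a *: v).
Proof.
move=> h; have [h0 hl] := lspan_subspace.
by rewrite -[a *: v]addr0; apply: hl.
Qed.

Lemma lspanD u v : lspan S u -> lspan S v -> lspan S (u + v).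
Proof.
move=> h k; have [_ hl] := lspan_subspace.
by rewrite -[u]scale1r; apply: hl.
Qed.

Lemma lspan_sum (I : Type) (r : seq I) (F : I -> V) :
  (forall i, lspan S (F i)) -> lspan S (\sum_(i <- r) F i).
Proof.
move=> h; elim: r => [|i r IH]; first by rewrite big_nil; case: lspan_subspace.
by rewrite big_cons; exact: lspanD.
Qed.

Lemma lspan_min (P : V -> Prop) : P 0 -> (forall a u v, P u -> P v -> P (a *: u + v)) ->
  (forall v, S v -> P v) -> forall v, lspan S v -> P v.
Proof.
move=> P0 Pl PS v [n [a [w [hw ->]]]].
elim: n a w hw => [|n IH] a w hw; first by rewrite big_ord0.
rewrite big_ord_recl; apply: Pl; first exact: PS.
exact: IH.
Qed.

End LinearSpan.

Section EvenPart.
Variable R : realType.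
Local Notation C := R[i].
Variables ap am ap' : R.
Local Notation KV := (KV ap am ap').
Local Notation kf := (kf ap am ap').
Local Notation kg := (kg ap am ap').
Local Notation tm p := (xcoord ix_m p).
Local Notation xc i p := (xcoord (ix i) p)%:C.
Implicit Types (p : pt R) (mu rho : 'I_11) (i j : 'I_9) (th : kdata R).

Definition kp_data : kdata R := KData 0 1 (fun=> 0) (fun=> 0) 0.
Definition km_data : kdata R := KData 1 0 (fun=> 0) (fun=> 0) 0.
Definition ki_data i : kdata R := KData 0 0 (fun j => (j == i)%:R) (fun=> 0) 0.
Definition kis_data i : kdata R := KData 0 0 (fun=> 0) (fun j => (j == i)%:R) 0.
Definition kij_data i j : kdata R :=
  KData 0 0 (fun=> 0) (fun=> 0) (delta_mx i j - delta_mx j i).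

Lemma kf_coef th i t : ka th i = 0 -> kb th i = 0 -> kf th i t = 0.
Proof. by move=> h k; rewrite kfE h k !mul0r addr0 oppr0. Qed.

Lemma kg_coef th i t : ka th i = 0 -> kb th i = 0 -> kg th i t = 0.
Proof. by move=> h k; rewrite kgE h k !mul0r subrr. Qed.

Lemma rot0_sum p i : \sum_j xc j p * (0 : 'M[C]_9) j i = 0.
Proof. by apply: big1 => j _; rewrite mxE mulr0. Qed.

Lemma del_entry mu nu p : (@del R nu p) mu 0 = (mu == nu)%:R.
Proof. by rewrite mxE eqxx andbT. Qed.

Lemma KV_kp : KV kp_data = @K_p R.
Proof.
apply/funext => p; apply/matrixP => mu j; rewrite (ord1 j) mxE [RHS]mxE del_entry.
case: (indexP mu) => [||i]; rewrite !by_indexE ?ix_eqE /=.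
- by rewrite big1 ?addr0 // => i _; rewrite kg_coef ?mulr0.
- by [].
- by rewrite kf_coef // rot0_sum addr0 oppr0.
Qed.

Lemma KV_km : KV km_data = @K_m R.
Proof.
apply/funext => p; apply/matrixP => mu j; rewrite (ord1 j) mxE [RHS]mxE del_entry.
case: (indexP mu) => [||i]; rewrite !by_indexE ?ix_eqE /=.
- by rewrite big1 ?addr0 // => i _; rewrite kg_coef ?mulr0.
- by [].
- by rewrite kf_coef // rot0_sum addr0 oppr0.
Qed.

Lemma KV_ki i : KV (ki_data i) = K_i ap am ap' i.
Proof.
apply/funext => p; apply/matrixP => mu j; rewrite (ord1 j) mxE /K_i !mxE.
rewrite -/(chl ap am ap' i (tm p)) -/(shl ap am ap' i (tm p)) !eqxx !andbT.
case: (indexP mu) => [||k]; rewrite !by_indexE ?ix_eqE /=.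
- rewrite oppr0 add0r mulr0 add0r mulr1 (bigD1 i) //= big1 ?addr0; last first.
    by move=> k ki; rewrite kgE /= (negPf ki) !mul0r subrr mulr0.
  by rewrite kgE /= eqxx mul0r mul0r mul1r add0r mulrN mulrC.
- by rewrite !mulr0 addr0.
- by rewrite rot0_sum addr0 kfE /= mul0r addr0 mulr0 addr0 mulrC; case: eqP => [->|_];
    rewrite ?mulr0.
Qed.

Lemma KV_kis i : KV (kis_data i) = K_is ap am ap' i.
Proof.
apply/funext => p; apply/matrixP => mu j; rewrite (ord1 j) mxE /K_is !mxE.
rewrite -/(chl ap am ap' i (tm p)) -/(shl ap am ap' i (tm p)) !eqxx !andbT.
case: (indexP mu) => [||k]; rewrite !by_indexE ?ix_eqE /=.
- rewrite oppr0 add0r mulr0 add0r mulr1 (bigD1 i) //= big1 ?addr0; last first.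
    by move=> k ki; rewrite kgE /= (negPf ki) !mul0r subrr mulr0.
  by rewrite kgE /= eqxx mul0r mul1r subr0 mulrC.
- by rewrite !mulr0 addr0 oppr0.
- by rewrite rot0_sum addr0 kfE /= mul0r add0r mulr0 addr0 mulrC; case: eqP => [->|_];
    rewrite ?mulr0 ?mulr1 ?oppr0.
Qed.

Lemma KV_kij i j : KV (kij_data i j) = @K_ij R i j.
Proof.
apply/funext => p; apply/matrixP => mu k; rewrite (ord1 k) mxE /K_ij !mxE !eqxx !andbT {k}.
case: (indexP mu) => [||k]; rewrite !by_indexE ?ix_eqE /=.
- rewrite !mulr0 subrr oppr0 add0r big1 // => k _; by rewrite kg_coef ?mulr0.
- by rewrite !mulr0 subrr oppr0.
- rewrite kf_coef // add0r.
  under eq_bigr => l _ do rewrite !mxE mulrBr.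
  rewrite sumrB (bigD1 i) //= [X in _ + X - _]big1 ?addr0; last first.
    by move=> l li; rewrite (negPf li) mulr0.
  rewrite (bigD1 j) //= [X in _ - (_ + X)]big1 ?addr0; last first.
    by move=> l li; rewrite (negPf li) mulr0.
  by rewrite !eqxx.
Qed.

Lemma rotation0 : rotation (0 : 'M[C]_9).
Proof. by split=> [i j|i j _]; rewrite !mxE ?oppr0. Qed.

Lemma rotation_linear a (S T : 'M[C]_9) : rotation S -> rotation T -> rotation (a *: S + T).
Proof.
move=> [h1 h2] [k1 k2]; split=> [i j|i j hij]; rewrite !mxE.
  by rewrite h1 k1 mulrN opprD.
by rewrite h2 // k2 // mulr0 addr0.
Qed.

Lemma rotation_kij i j : rot_pair i j -> rotation (delta_mx i j - delta_mx j i : 'M[C]_9).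
Proof.
move=> hij; split=> [k l|k l]; rewrite !mxE.
  by rewrite opprB andbC [X in _ - X](_ : _ = ((k == i) && (l == j))%:R) // andbC.
move=> hkl; case: andP => [[/eqP e1 /eqP e2]|_]; first by rewrite e1 e2 hij in hkl.
case: andP => [[/eqP e1 /eqP e2]|_]; first by rewrite e1 e2 rot_pair_sym hij in hkl.
by rewrite subrr.
Qed.

(** Block diagonal matrices are closed under products because the blocks are
    disjoint. *)
Lemma rotation_comm (S T : 'M[C]_9) : rotation S -> rotation T -> rotation (S *m T - T *m S).
Proof.
move=> [h1 h2] [k1 k2]; have tr : rot_pair = rot_pair by [].
split=> [i j|i j hij].
  rewrite !mxE opprB; congr (_ - _); apply: eq_bigr => k _; rewrite mulrC.
    by rewrite k1 h1 mulrNN.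
  by rewrite h1 k1 mulrNN.
have tri k : rot_pair i k -> rot_pair k j -> False.
  move: hij; rewrite !rot_pairE.
  by case: i => [[|[|[|[|[|[|[|[|[|i]]]]]]]]] //= hi];
     case: j => [[|[|[|[|[|[|[|[|[|j]]]]]]]]] //= hj];
     case: k => [[|[|[|[|[|[|[|[|[|k]]]]]]]]] //= hk].
have z (A B : 'M[C]_9) : (forall i j, ~~ rot_pair i j -> A i j = 0) ->
    (forall i j, ~~ rot_pair i j -> B i j = 0) -> (A *m B) i j = 0.
  move=> hA hB; rewrite mxE; apply: big1 => k _.
  case: (boolP (rot_pair i k)) => [ik|/hA ->]; last by rewrite mul0r.
  case: (boolP (rot_pair k j)) => [kj|/hB ->]; last by rewrite mulr0.
  by case: (tri k ik kj).
by rewrite mxE z // mxE z // oppr0 addr0.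
Qed.

Lemma kdata_ext th th' : km th = km th' -> kc th = kc th' -> ka th =1 ka th' ->
  kb th =1 kb th' -> kr th = kr th' -> th = th'.
Proof.
by case: th th' => [m c a b r] [m' c' a' b' r'] /= -> -> /funext -> /funext -> ->.
Qed.

Lemma KV_zero : KV (KData 0 0 (fun=> 0) (fun=> 0) 0) = 0.
Proof.
have := KV_linear ap am ap' (-1) kp_data kp_data; rewrite scaleN1r addNr => <-.
congr KV; apply: kdata_ext => //= [||i|i|]; by rewrite ?scaler0 ?mulr0 ?addr0 // mulN1r addNr.
Qed.

Lemma pick_sum (f : 'I_9 -> C) j : \sum_i f i * (j == i)%:R = f j.
Proof.
rewrite (bigD1 j) //= eqxx mulr1 big1 ?addr0 // => i ij.
by rewrite eq_sym (negPf ij) mulr0.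
Qed.

Lemma antisym_expand (S : 'M[C]_9) : (forall i j, S j i = - S i j) ->
  \sum_i \sum_j (2^-1 * S i j) *: (delta_mx i j - delta_mx j i) = S.
Proof.
move=> anti; have E : \sum_i \sum_j S i j *: delta_mx i j = S by rewrite -matrix_sum_delta.
have E' : \sum_i \sum_j S i j *: (delta_mx j i : 'M[C]_9) = - S.
  rewrite exchange_big -[in RHS]E -sumrN; apply: eq_bigr => i _.
  by rewrite -sumrN; apply: eq_bigr => j _; rewrite anti scaleNr.
transitivity (2^-1 *: (S - - S)); last by rewrite opprK half_double.
rewrite -{2}E -E' -sumrB scaler_sumr; apply: eq_bigr => i _.
by rewrite -sumrB scaler_sumr; apply: eq_bigr => j _; rewrite -scalerBr scalerA.
Qed.

Lemma KV_sum_ki (a : 'I_9 -> C) (r : seq 'I_9) :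
  KV (KData 0 0 (fun j => \sum_(i <- r) a i * (j == i)%:R) (fun=> 0) 0) =
  \sum_(i <- r) a i *: K_i ap am ap' i.
Proof.
elim: r => [|i r IH].
  by rewrite big_nil -KV_zero; congr KV; apply: kdata_ext => //= j; rewrite big_nil.
rewrite big_cons -IH -KV_ki -KV_linear; congr KV; apply: kdata_ext => //= [||j|j|];
  by rewrite ?big_cons ?scaler0 ?mulr0 ?addr0.
Qed.

Lemma KV_sum_kis (b : 'I_9 -> C) (r : seq 'I_9) :
  KV (KData 0 0 (fun=> 0) (fun j => \sum_(i <- r) b i * (j == i)%:R) 0) =
  \sum_(i <- r) b i *: K_is ap am ap' i.
Proof.
elim: r => [|i r IH].
  by rewrite big_nil -KV_zero; congr KV; apply: kdata_ext => //= j; rewrite big_nil.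
rewrite big_cons -IH -KV_kis -KV_linear; congr KV; apply: kdata_ext => //= [||j|j|];
  by rewrite ?big_cons ?scaler0 ?mulr0 ?addr0.
Qed.

Definition KV_rot (S : 'M[C]_9) : vfield R := KV (KData 0 0 (fun=> 0) (fun=> 0) S).

Lemma KV_rot_linear a S S' : KV_rot (a *: S + S') = a *: KV_rot S + KV_rot S'.
Proof.
by rewrite -KV_linear; congr KV; apply: kdata_ext => //= [||i|i]; rewrite mulr0 addr0.
Qed.

Lemma KV_rot0 : KV_rot 0 = 0. Proof. exact: KV_zero. Qed.

Lemma KV_rot_sum (I : Type) (r : seq I) (f : I -> C) (i j : I -> 'I_9) :
  KV_rot (\sum_(k <- r) f k *: (delta_mx (i k) (j k) - delta_mx (j k) (i k))) =
  \sum_(k <- r) f k *: K_ij (i k) (j k).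
Proof.
elim: r => [|k r IH]; first by rewrite !big_nil KV_rot0.
by rewrite !big_cons KV_rot_linear IH -KV_kij.
Qed.

Lemma KV_split th : KV th = kc th *: @K_p R + km th *: @K_m R
  + \sum_i ka th i *: K_i ap am ap' i + \sum_i kb th i *: K_is ap am ap' i + KV_rot (kr th).
Proof.
rewrite -KV_sum_ki -KV_sum_kis -KV_kp -KV_km -!addrA.
rewrite -[KV (KData 0 0 (fun=> 0) _ 0)]scale1r -KV_linear.
rewrite -[KV (KData 0 0 _ (fun=> 0) 0)]scale1r -!KV_linear.
congr KV; apply: kdata_ext => /= [||i|i|].
- by rewrite !mulr0 !addr0 mulr1 add0r.
- by rewrite !mulr0 !addr0 mulr1.
- by rewrite pick_sum !mulr0 !add0r mul1r !addr0.
- by rewrite pick_sum !mulr0 !add0r mul1r !addr0.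
- by rewrite !scaler0 !add0r.
Qed.

Lemma KV_in_K0 th : rotation (kr th) -> K0 ap am ap' (KV th).
Proof.
move=> [hr1 hr2]; rewrite KV_split /K0; set G := K0_generators _ _ _.
have gen a X : G X -> lspan G (a *: X) by move=> h; apply: lspanZ; exact: lspan_gen.
apply: lspanD; first apply: lspanD; first apply: lspanD; first apply: lspanD.
- by apply: gen; left; left; left; left.
- by apply: gen; left; left; left; right.
- by apply: lspan_sum => i; apply: gen; left; left; right; exists i.
- by apply: lspan_sum => i; apply: gen; left; right; exists i.
rewrite -[kr th](antisym_expand hr1) pair_bigA KV_rot_sum /=.
apply: lspan_sum => -[i j] /=; case: (boolP (rot_pair i j)) => [hij|/hr2 ->].
  by apply: gen; right; exists i, j.
by rewrite mulr0 scale0r; case: (lspan_subspace G).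
Qed.

(** With K_0 described by coordinates, its closure properties become statements
    about coefficients. *)
Lemma K0E : K0 ap am ap' = [set X | exists th, rotation (kr th) /\ X = KV th]%classic.
Proof.
apply/seteqP; split => X /=.
  apply: (lspan_min (P := fun X => exists th, rotation (kr th) /\ X = KV th)).
  - exists (kij_data (lab 1) (lab 1)); rewrite KV_kij; split.
      by apply: rotation_kij; rewrite /rot_pair /has !mem_labs // /lab inordK.
    apply/funext => p; by rewrite /K_ij subrr.
  - move=> a u v [th [h ->]] [th' [h' ->]]; exists (kadd a th th'); split.
      exact: rotation_linear.
    by rewrite KV_linear.
  - move=> v [[[[->|->]|[i _ <-]]|[i _ <-]]|[i [j [hij ->]]]].
    + by exists kp_data; rewrite KV_kp; split=> //; exact: rotation0.
    + by exists km_data; rewrite KV_km; split=> //; exact: rotation0.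
    + by exists (ki_data i); rewrite KV_ki; split=> //; exact: rotation0.
    + by exists (kis_data i); rewrite KV_kis; split=> //; exact: rotation0.
    + by exists (kij_data i j); rewrite KV_kij; split=> //; exact: rotation_kij.
by move=> [th [hr ->]]; exact: KV_in_K0.
Qed.

End EvenPart.

(** * Commutators and the Killing equation *)

Section Brackets.
Variable R : realType.
Local Notation C := R[i].
Variables ap am ap' : R.
Local Notation lam := (lambda ap am ap').
Local Notation ch := (chl ap am ap').
Local Notation sh := (shl ap am ap').
Local Notation KV := (KV ap am ap').
Local Notation dKV := (dKV ap am ap').
Local Notation kf := (kf ap am ap').
Local Notation kg := (kg ap am ap').
Local Notation tm p := (xcoord ix_m p).
Local Notation xc i p := (xcoord (ix i) p)%:C.
Implicit Types (p : pt R) (mu rho : 'I_11) (i j : 'I_9) (th : kdata R) (S T : 'M[C]_9).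

(** The structure constants of K_0. *)
Definition commutator_data th th' : kdata R := KData 0
  (\sum_i lam i ^+ 2 * (ka th i * kb th' i - ka th' i * kb th i))
  (fun i => - (lam i ^+ 2 * (km th * kb th' i - km th' * kb th i))
            + \sum_k (ka th k * kr th' k i - ka th' k * kr th k i))
  (fun i => km th * ka th' i - km th' * ka th i
            + \sum_k (kb th k * kr th' k i - kb th' k * kr th k i))
  (kr th *m kr th' - kr th' *m kr th).

(** What depends on i through lambda_i is constant on the blocks of a rotation. *)
Lemma rotation_fun S (h : 'I_9 -> C) i j :
  (forall i j, comm125 i = comm125 j -> anti1234 i = anti1234 j -> h i = h j) ->
  rotation S -> S i j * h i = S i j * h j.
Proof.
move=> hh hS; have [->|nz] := eqVneq (S i j) 0; first by rewrite !mul0r.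
by have [e1 e2] := rotation_same hS nz; rewrite (hh i j).
Qed.

Lemma nu_same i j : comm125 i = comm125 j -> anti1234 i = anti1234 j ->
  nu ap am ap' 0 false i = nu ap am ap' 0 false j.
Proof. by rewrite /nu => -> ->. Qed.

Lemma rotation_ch S i j t : rotation S -> S i j * ch i t = S i j * ch j t.
Proof.
apply: (rotation_fun (h := fun i => ch i t)) => k l h1 h2.
by rewrite !chlE (nu_same h1 h2).
Qed.

Lemma rotation_sh S i j t : rotation S -> S i j * sh i t = S i j * sh j t.
Proof.
apply: (rotation_fun (h := fun i => sh i t)) => k l h1 h2.
by rewrite !shlE (nu_same h1 h2).
Qed.

Lemma rotation_lam2 S i j : rotation S -> S i j * lam i ^+ 2 = S i j * lam j ^+ 2.
Proof.
apply: (rotation_fun (h := fun i => lam i ^+ 2)) => k l h1 h2.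
by rewrite !(lambda_nu ap am ap' 0) (nu_same h1 h2).
Qed.

Lemma sum_kf_rot S th i t : rotation S -> \sum_k kf th k t * S k i =
  - ((\sum_k ka th k * S k i) * ch i t + (\sum_k kb th k * S k i) * sh i t).
Proof.
move=> hS; rewrite !mulr_suml -big_split -sumrN; apply: eq_bigr => k _ /=.
rewrite kfE.
transitivity (- (ka th k * (S k i * ch k t) + kb th k * (S k i * sh k t))); first by ring.
by rewrite rotation_ch // rotation_sh //; ring.
Qed.

Lemma sum_kg_rot S th i t : rotation S -> \sum_k kg th k t * S k i =
  (\sum_k kb th k * S k i) * (lam i ^+ 2 * ch i t) - (\sum_k ka th k * S k i) * sh i t.
Proof.
move=> hS; rewrite !mulr_suml -sumrB; apply: eq_bigr => k _ /=.
rewrite kgE.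
transitivity (kb th k * (S k i * lam k ^+ 2) * ch k t - ka th k * (S k i * sh k t)); first by ring.
rewrite rotation_lam2 // rotation_sh //.
transitivity (kb th k * lam i ^+ 2 * (S k i * ch k t) - ka th k * (S k i * sh i t)); first by ring.
by rewrite rotation_ch //; ring.
Qed.

Lemma lie_bracketE (X Y : vfield R) p mu : lie_bracket X Y p mu 0 =
  \sum_rho (X p rho 0 * pdV rho Y p mu 0 - Y p rho 0 * pdV rho X p mu 0).
Proof.
rewrite /lie_bracket summxE; apply: eq_bigr => rho _.
move: (pdV rho Y p) (pdV rho X p) => V W.
by rewrite mxE [X in X + _]mxE [X in _ + X]mxE [X in _ - X]mxE.
Qed.

Lemma dKV_p th rho p : dKV th rho p ix_p 0 =
  by_index 0 (\sum_i xc i p * (lam i ^+ 2 * kf th i (tm p))) (fun j => kg th j (tm p)) rho.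
Proof. by rewrite mxE by_indexE. Qed.
Lemma dKV_m th rho p : dKV th rho p ix_m 0 = 0.
Proof. by rewrite mxE by_indexE. Qed.
Lemma dKV_i th rho p i : dKV th rho p (ix i) 0 =
  by_index 0 (- kg th i (tm p)) (fun j => kr th j i) rho.
Proof. by rewrite mxE by_indexE. Qed.

Local Notation dKVE := (dKV_p, dKV_m, dKV_i).

(** Rotations commute with the profiles [chl] and [shl], since lambda is constant
    on blocks; the products of two profiles combine by [chl_shl]. *)
Lemma lie_bracket_KV th th' : rotation (kr th) -> rotation (kr th') ->
  lie_bracket (KV th) (KV th') = KV (commutator_data th th').
Proof.
move=> hr hr'; apply/funext => p; apply/matrixP => mu z; rewrite (ord1 z) {z}.
have [anti _] := hr; have [anti' _] := hr'.
rewrite lie_bracketE; under eq_bigr => rho _ do rewrite !pdV_KV.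
rewrite sum_index; set t := tm p.
case: (indexP mu) => [||i]; rewrite ?KVE ?dKVE ?by_indexE; last 1 first.
- under [X in _ + X = _]eq_bigr => j _ do rewrite !KVE !dKVE !by_indexE !mulrDl.
  rewrite sumrB !big_split /= -/t !sum_kf_rot // kfE /=.
  have mm : \sum_j xc j p * (kr th *m kr th' - kr th' *m kr th) j i =
      \sum_k (\sum_j xc j p * kr th j k) * kr th' k i -
      \sum_k (\sum_j xc j p * kr th' j k) * kr th k i.
    under [X in _ = X - _]eq_bigr => k _ do rewrite mulr_suml.
    under [X in _ = _ - X]eq_bigr => k _ do rewrite mulr_suml.
    rewrite [X in _ = X - _]exchange_big [X in _ = _ - X]exchange_big -sumrB /=.
    apply: eq_bigr => j _; rewrite !mxE mulrBr !mulr_sumr.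
    by congr (_ - _); apply: eq_bigr => k _; rewrite mulrA.
  rewrite mm !sumrB !kgE !mulr0 subrr add0r; ring.
- under [X in _ + X = _]eq_bigr => i _ do rewrite !KVE !dKVE !by_indexE.
  rewrite !mulr0 subrr add0r /= -/t.
  have flip S th1 i : rotation S -> \sum_j S i j * kg th1 j t = - \sum_j kg th1 j t * S j i.
    by move=> [aS _]; rewrite -sumrN; apply: eq_bigr => j _; rewrite (aS j i) mulNr mulrC.
  have e th1 th2 : rotation (kr th1) ->
      \sum_i (kf th1 i t + \sum_j xc j p * kr th1 j i) * kg th2 i t =
      \sum_i kf th1 i t * kg th2 i t - \sum_i xc i p * \sum_j kg th2 j t * kr th1 j i.
    move=> h; under eq_bigr => i _ do rewrite mulrDl mulr_suml.
    rewrite big_split /= exchange_big /=; congr (_ + _); rewrite -sumrN; apply: eq_bigr => j _.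
    rewrite -mulrN -flip // mulr_sumr; apply: eq_bigr => i _; by rewrite mulrA.
  rewrite sumrB !e //.
  have c i : kf th i t * kg th' i t - kf th' i t * kg th i t =
     - (lam i ^+ 2 * (ka th i * kb th' i - ka th' i * kb th i)).
    rewrite -(chl_shl ap am ap' i t) !kfE !kgE; ring.
  have re (w A B S1 S2 : C) : w + (A - S1 - (B - S2)) = (A - B) + (w - (S1 - S2)) by ring.
  rewrite re -[X in X + _ = _]sumrB (eq_bigr _ (fun i _ => c i)) sumrN; congr (_ + _).
  rewrite -sumrB [X in X - _ - _]mulr_sumr [X in _ - X - _]mulr_sumr -!sumrB.
  apply: eq_bigr => i _ /=.
  rewrite !sum_kg_rot // !kfE !kgE /= !sumrB; ring.
- under [X in _ + X = _]eq_bigr => i _ do rewrite !KVE !dKVE.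
  by rewrite /= !mulr0 subrr add0r oppr0 big1 ?addr0 // => i _; rewrite !mulr0 subrr.
Qed.

End Brackets.

Notation dKVE := (dKV_p, dKV_m, dKV_i).

Section Metric.
Variable R : realType.
Local Notation C := R[i].
Variables ap am ap' : R.
Local Notation lam := (lambda ap am ap').
Local Notation KV := (KV ap am ap').
Local Notation dKV := (dKV ap am ap').
Local Notation xc i p := (xcoord (ix i) p)%:C.
Local Notation gB := (gB ap am ap').
Local Notation Bquad := (Bquad ap am ap').
Implicit Types (p : pt R) (mu nu rho : 'I_11) (i j : 'I_9) (th : kdata R).

Definition bet i : R := complex.Re (lam i ^+ 2).

Lemma betE i : (bet i)%:C = lam i ^+ 2.
Proof. exact: (lambda_sq_real ap am ap' 0 i). Qed.

Lemma BquadE p : Bquad p = \sum_i bet i * xcoord (ix i) p ^+ 2.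
Proof. by apply: eq_bigr => i _; rewrite !mxE eqxx mulr1n. Qed.

Definition dQ mu p : R := by_index 0 0 (fun i => 2 * (bet i * xcoord (ix i) p)) mu.

Lemma is_derive_Bquad mu p : is_derive p (delta_mx 0 mu) Bquad (dQ mu p).
Proof.
rewrite (_ : Bquad = \sum_(i < 9) (bet i \*: (@xcoord R (ix i) * @xcoord R (ix i)))); last first.
  by apply/funext => q; rewrite BquadE fct_sumE; apply: eq_bigr => i _; rewrite expr2.
have h i := is_deriveM (is_derive_xcoord mu (ix i) p) (is_derive_xcoord mu (ix i) p).
apply: is_derive_eq (is_derive_sum (fun i => is_deriveZ (bet i) (h i))) _.
rewrite /dQ; case: (indexP mu) => [||k]; rewrite ?by_indexE.
- by apply: big1 => i _; rewrite ix_eqE /GRing.scale /= !mulr0 addr0 mulr0.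
- by apply: big1 => i _; rewrite ix_eqE /GRing.scale /= !mulr0 addr0 mulr0.
- rewrite (bigD1 k) //= big1 ?addr0; last first.
    by move=> i ik; rewrite ix_eqE (negPf ik) /GRing.scale /= !mulr0 addr0 mulr0.
  by rewrite eqxx /GRing.scale /= !mulr1; ring.
Qed.

(* the only non-constant component of the metric is g_{--} *)
Lemma pd_gB rho mu nu p : pd rho (fun q => gB q mu nu) p =
  if (mu == ix_m) && (nu == ix_m) then - dQ rho p else 0.
Proof.
have cst (c : R) : (fun q => gB q mu nu) = (fun=> c) -> pd rho (fun q => gB q mu nu) p = 0.
  by move=> ->; rewrite /pd derive_cst.
case: (indexP mu) cst => [||i]; case: (indexP nu) => [||j] cst; rewrite ?ix_eqE /=;
  try by (apply: cst; apply/funext => q; rewrite mxE !by_indexE).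
rewrite (_ : (fun q => _) = - Bquad).
  by rewrite /pd; have [_ ->] := is_deriveN (is_derive_Bquad rho p).
by apply/funext => q; rewrite mxE !by_indexE.
Qed.

Definition gBinv p : 'M[R]_11 := \matrix_(mu, nu)
  by_index (by_index (Bquad p) 1 (fun=> 0) nu) (by_index 1 0 (fun=> 0) nu)
           (fun i => by_index 0 0 (fun j => (i == j)%:R) nu) mu.

Lemma gB_inv p : invmx (gB p) = gBinv p.
Proof.
have E : gBinv p *m gB p = 1%:M.
  apply/matrixP => mu nu; rewrite !mxE sum_index.
  under eq_bigr => k _ do rewrite !mxE !by_indexE.
  rewrite !mxE !by_indexE.
  case: (indexP mu) => [||i]; case: (indexP nu) => [||j]; rewrite ?by_indexE ?ix_eqE;
    try (rewrite [X in _ + X]big1; last by move=> k _; rewrite !by_indexE ?mul0r ?mulr0);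
    rewrite ?mul0r ?mulr0 ?mul1r ?mulr1 ?add0r ?addr0 ?subrr //.
  rewrite (bigD1 i) //= big1 => [|k ki].
    by rewrite !by_indexE eqxx mul1r addr0.
  by rewrite !by_indexE eq_sym (negPf ki) mul0r.
have [u _] := mulmx1_unit E.
have u' : gB p \in unitmx by have [] := mulmx1_unit E.
by rewrite -[RHS]mulmx1 -(mulmxV u') mulmxA E mul1mx.
Qed.

(** Lowering an index: only the row of x^- sees the non-constant entry. *)
Definition low p (V : 'cV[C]_11) nu : C :=
  by_index (V ix_m 0) (V ix_p 0 - (Bquad p)%:C * V ix_m 0) (fun i => V (ix i) 0) nu.

Lemma gB_sym p mu nu : gB p mu nu = gB p nu mu.
Proof.
rewrite !mxE; case: (indexP mu) => [||i]; case: (indexP nu) => [||j]; rewrite ?by_indexE //.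
by rewrite eq_sym.
Qed.

Lemma real_complex0 : (0 : R)%:C = 0 :> C. Proof. by []. Qed.
Lemma real_complex1 : (1 : R)%:C = 1 :> C. Proof. by []. Qed.

Lemma lowE p (V : 'cV[C]_11) nu : \sum_rho (gB p nu rho)%:C * V rho 0 = low p V nu.
Proof.
rewrite sum_index /low !mxE !by_indexE.
under eq_bigr => k _ do rewrite mxE by_indexE.
case: (indexP nu) => [||j]; rewrite ?by_indexE.
- rewrite [X in _ + X]big1; last by move=> k _; rewrite !by_indexE ?real_complex0 mul0r.
  by rewrite ?real_complex0 ?real_complex1 mul0r add0r mul1r addr0.
- rewrite [X in _ + X]big1; last by move=> k _; rewrite !by_indexE ?real_complex0 mul0r.
  by rewrite ?real_complex1 mul1r addr0 rmorphN mulNr.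
- rewrite ?real_complex0 !mul0r !add0r (bigD1 j) //= [X in _ + X]big1 ?addr0 => [|k kj].
    by rewrite !by_indexE eqxx ?real_complex1 mul1r.
  by rewrite !by_indexE eq_sym (negPf kj) ?real_complex0 mul0r.
Qed.

(** The rotation preserves lambda^2, so the bilinear form is skew. *)
Lemma rot_quadratic th p : rotation (kr th) ->
  \sum_i lam i ^+ 2 * xc i p * (\sum_j xc j p * kr th j i) = 0.
Proof.
move=> hr; have [anti _] := hr.
set s := LHS; suff : s = - s.
  by move=> /eqP; rewrite -addr_eq0 -mulr2n mulrn_eq0 => /eqP.
rewrite {1}/s; under eq_bigr => i _ do rewrite mulr_sumr.
rewrite exchange_big /s -sumrN /=; apply: eq_bigr => j _.
rewrite mulr_sumr -sumrN; apply: eq_bigr => i _.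
rewrite (anti i j).
have := rotation_lam2 ap am ap' i j hr; move=> E.
transitivity (- (xc i p * xc j p * (kr th i j * lam i ^+ 2))); first by ring.
rewrite E; ring.
Qed.

(** The derivative of g_{--} along the field is balanced by the growth of its x^+
    component, up to [rot_quadratic]; elsewhere the metric is constant and the
    equation is skew-symmetry of the covariant derivative. *)
Lemma killing_KV th : rotation (kr th) -> killing gB (KV th).
Proof.
move=> hr; have [anti _] := hr; split; first exact: elemM_smooth (elemM_KV _ _ _ th).
move=> p mu nu; rewrite !big_split /=.
under [X in _ + X + _ = _]eq_bigr => rho _ do rewrite gB_sym pdV_KV.
under [X in _ + X = _]eq_bigr => rho _ do rewrite pdV_KV.
rewrite !lowE.
under eq_bigr => rho _ do rewrite pd_gB.
have m0 rho : dKV th rho p ix_m 0 = 0 by rewrite mxE by_indexE.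
rewrite /low !m0 !mulr0 !subr0.
have z : ~~ ((mu == ix_m) && (nu == ix_m)) -> \sum_rho KV th p rho 0 *
    (if (mu == ix_m) && (nu == ix_m) then - dQ rho p else 0)%:C = 0.
  by move=> /negPf ->; apply: big1 => rho _; rewrite mulr0.
case: (boolP ((mu == ix_m) && (nu == ix_m))) z => [/andP[/eqP -> /eqP ->] _|n /(_ isT)].
  rewrite /= sum_index /dQ !by_indexE !dKVE !by_indexE oppr0 !mulr0 !add0r.
  rewrite -addrA -mulr2n -[X in _ + X]mulr_natl mulr_sumr -big_split /=.
  transitivity (-2 * \sum_i lam i ^+ 2 * xc i p * (\sum_j xc j p * kr th j i)).
    rewrite mulr_sumr; apply: eq_bigr => i _.
    by rewrite by_indexE KV_i rmorphN !rmorphM /= betE rmorph_nat; ring.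
  by rewrite rot_quadratic // mulr0.
move=> ->; rewrite add0r.
case: (indexP mu) n => [||i]; case: (indexP nu) => [||j] n;
  rewrite ?by_indexE ?dKVE ?by_indexE ?addr0 ?add0r ?addNr ?addrN //.
  by rewrite (anti i j) addrN.
Qed.

End Metric.

(** * Covariant and spinorial Lie derivatives *)

Section LeviCivita.
Variable R : realType.
Local Notation C := R[i].
Variables ap am ap' : R.
Local Notation lam := (lambda ap am ap').
Local Notation KV := (KV ap am ap').
Local Notation dKV := (dKV ap am ap').
Local Notation kg := (kg ap am ap').
Local Notation tm p := (xcoord ix_m p).
Local Notation xc i p := (xcoord (ix i) p)%:C.
Local Notation gB := (gB ap am ap').
Local Notation Bquad := (Bquad ap am ap').
Local Notation bet := (bet ap am ap').
Implicit Types (p : pt R) (mu nu rho : 'I_11) (i j : 'I_9) (th : kdata R).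

(** Half of the partial derivatives of g_{--}, which generate all the Christoffel
    symbols. *)
Definition half_dg mu p : R := by_index 0 0 (fun i => - (bet i * xcoord (ix i) p)) mu.

Lemma half_dgE mu p : 2^-1 * - dQ ap am ap' mu p = half_dg mu p.
Proof.
rewrite /dQ /half_dg; case: (indexP mu) => [||i]; rewrite !by_indexE ?oppr0 ?mulr0 //.
by rewrite mulrN mulKf // pnatr_eq0.
Qed.

Lemma christoffelE rho mu nu p : christoffel gB rho mu nu p =
  by_index ((nu == ix_m)%:R * half_dg mu p + (mu == ix_m)%:R * half_dg nu p) 0
    (fun i => - (((mu == ix_m) && (nu == ix_m))%:R * half_dg (ix i) p)) rho.
Proof.
rewrite /christoffel gB_inv; under eq_bigr => s _ do rewrite !pd_gB.
have e (b : bool) (x : R) : (if b then - x else 0) = b%:R * - x.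
  by case: b; rewrite ?mul1r ?mul0r.
rewrite sum_index !e !ix_eqE !andbF !andbT !mxE !by_indexE /=.
rewrite (_ : dQ ap am ap' ix_p p = 0); last by rewrite /dQ by_indexE.
rewrite (_ : dQ ap am ap' ix_m p = 0); last by rewrite /dQ by_indexE.
under eq_bigr => k _ do rewrite !e !mxE !by_indexE.
case: (indexP rho) => [||i]; rewrite !by_indexE.
- rewrite big1 => [|k _]; last by rewrite !by_indexE mul0r.
  by rewrite -!half_dgE; ring.
- rewrite big1 => [|k _]; last by rewrite !by_indexE mul0r.
  by ring.
- rewrite (bigD1 i) //= big1 => [|k ki]; last by rewrite !by_indexE eq_sym (negPf ki) mul0r.
  by rewrite !by_indexE eqxx mul1r -!half_dgE; ring.
Qed.

(** Besides the rotation and up to skew-symmetry, the only components of the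
    covariant derivative of the Killing field. *)
Definition kk th i p : C := kg th i (tm p) + km th * (lam i ^+ 2 * xc i p).

Lemma levi_KV mu th p : rotation (kr th) -> levi_civita gB mu (KV th) p =
  \col_rho by_index (by_index 0 0 (fun j => kk th j p) mu) 0
     (fun i => by_index 0 (- kk th i p) (fun j => kr th j i) mu) rho.
Proof.
move=> hr; apply/matrixP => rho z; rewrite (ord1 z) {z} !mxE -[pdC _ _ _]/(_) .
have -> : pdC mu (fun q => KV th q rho 0) p = dKV th mu p rho 0.
  exact: is_pdCE (is_pdM_KV _ _ _ _ _ _ _ _).
under eq_bigr => nu _ do rewrite christoffelE.
have hb i : (half_dg (ix i) p)%:C = - (lam i ^+ 2 * xc i p).
  by rewrite /half_dg by_indexE rmorphN rmorphM /= betE.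
have hp : half_dg ix_p p = 0 by rewrite /half_dg by_indexE.
have hm : half_dg ix_m p = 0 by rewrite /half_dg by_indexE.
rewrite sum_index !ix_eqE !andbF !andbT.
case: (indexP rho) => [||i]; rewrite ?by_indexE ?dKVE.
- under [X in _ + (_ + X) = _]eq_bigr => k _ do
    rewrite by_indexE ix_eqE mul0r add0r rmorphM /= hb KVE.
  case: (indexP mu) => [||j]; rewrite ?by_indexE ?ix_eqE ?hp ?hm.
  + rewrite big1 => [|k _]; first by rewrite !mulr0 !addr0 real_complex0 !mul0r !addr0.
    by rewrite (_ : (false%:R : R)%:C = 0 :> C) // !mul0r.
  + rewrite !mulr0 !addr0 real_complex0 !mul0r !add0r.
    rewrite -big_split /=.
    transitivity (- \sum_k lam k ^+ 2 * xc k p * (\sum_j xc j p * kr th j k)); last first.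
      by rewrite rot_quadratic // oppr0.
    rewrite -sumrN; apply: eq_bigr => k _.
    by rewrite (_ : (true%:R : R)%:C = 1 :> C) //; ring.
  + rewrite big1 => [|k _]; last by rewrite (_ : (false%:R : R)%:C = 0 :> C) // !mul0r.
    by rewrite !mulr0 !mul1r [false%:R * _]mul0r !addr0 mul0r add0r hb KVE /kk; ring.
- rewrite !mul0r big1 ?addr0 // => k _; by rewrite by_indexE mul0r.
- under [X in _ + (_ + X) = _]eq_bigr => k _ do rewrite by_indexE [false%:R * _]mul0r oppr0 real_complex0 mul0r.
  rewrite big1 // [false%:R * _]mul0r oppr0 real_complex0 mul0r add0r addr0.
  case: (indexP mu) => [||j]; rewrite ?by_indexE ?ix_eqE /= ?mul0r ?mul1r ?oppr0 ?mul0r ?addr0 //.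
  by rewrite rmorphN /= hb KVE /kk; ring.
Qed.

Lemma frame_p a p : frame ap am ap' a p ix_p 0 = by_index 1 (2^-1 * Bquad p)%:C (fun=> 0) a.
Proof.
case: (indexP a) => [||i]; rewrite /frame !by_indexE ?mxE ?ix_eqE ?eqxx //=.
by rewrite add0r mulr1.
Qed.
Lemma frame_m a p : frame ap am ap' a p ix_m 0 = by_index 0 1 (fun=> 0) a.
Proof.
case: (indexP a) => [||i]; rewrite /frame !by_indexE ?mxE ?ix_eqE ?eqxx //=.
by rewrite mulr0 addr0.
Qed.
Lemma frame_i a p i : frame ap am ap' a p (ix i) 0 = by_index 0 0 (fun j => (i == j)%:R) a.
Proof.
case: (indexP a) => [||j]; rewrite /frame !by_indexE ?mxE ?ix_eqE ?eqxx ?andbT //=.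
by rewrite mulr0 addr0.
Qed.

Lemma cov_KV th a b p : rotation (kr th) ->
  cov_frame gB (frame ap am ap') (KV th) a b p =
  by_index 0 (by_index 0 0 (fun j => kk th j p) a)
    (fun i => by_index 0 (- kk th i p) (fun j => kr th j i) a) b.
Proof.
move=> hr; rewrite /cov_frame.
set L := fun mu => by_index 0 (by_index 0 0 (fun j => kk th j p) mu)
    (fun i => by_index 0 (- kk th i p) (fun j => kr th j i) mu) b.
have inner mu : \sum_nu \sum_rho frame ap am ap' a p mu 0 * (gB p nu rho)%:C *
    levi_civita gB mu (KV th) p nu 0 * frame ap am ap' b p rho 0 =
    frame ap am ap' a p mu 0 * L mu.
  have -> : L mu = \sum_nu levi_civita gB mu (KV th) p nu 0 *
      low ap am ap' p (frame ap am ap' b p) nu.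
    rewrite /L sum_index levi_KV // !mxE !by_indexE mul0r addr0.
    under eq_bigr => k _ do rewrite mxE by_indexE.
    case: (indexP b) => [||i]; rewrite /low !by_indexE.
    - rewrite frame_m by_indexE mulr0 add0r big1 // => k _.
      by rewrite !by_indexE frame_i by_indexE mulr0.
    - rewrite frame_m !by_indexE mulr1 big1 ?addr0 // => k _.
      by rewrite !by_indexE frame_i by_indexE mulr0.
    - rewrite frame_m !by_indexE mulr0 add0r (bigD1 i) //= big1 ?addr0.
        by rewrite !by_indexE frame_i by_indexE eqxx mulr1.
      by move=> k ki; rewrite !by_indexE frame_i by_indexE (negPf ki) mulr0.
  rewrite mulr_sumr; apply: eq_bigr => nu _; rewrite -lowE !mulr_sumr.
  by apply: eq_bigr => rho _; rewrite -!mulrA; congr (_ * _); rewrite mulrCA.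
rewrite (eq_bigr _ (fun mu _ => inner mu)) sum_index frame_p frame_m.
under eq_bigr => k _ do rewrite frame_i.
rewrite (_ : L ix_p = 0); last first.
  by rewrite /L !by_indexE; case: (indexP b) => [||i]; rewrite !by_indexE.
rewrite mulr0 add0r -/(L a); case: (indexP a) => [||j]; rewrite by_indexE.
- rewrite mul0r add0r big1 => [|k _]; last by rewrite by_indexE mul0r.
  by rewrite /L !by_indexE; case: (indexP b) => [||i]; rewrite !by_indexE.
- by rewrite mul1r big1 ?addr0 // => k _; rewrite by_indexE mul0r.
- rewrite mul0r add0r (bigD1 j) //= by_indexE eqxx mul1r big1 ?addr0 // => k kj.
  by rewrite by_indexE (negPf kj) mul0r.
Qed.

End LeviCivita.

Section SpinorialLieDerivative.
Variable R : realType.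
Local Notation C := R[i].
Variables ap am ap' : R.
Variable gamma : gammas R.
Hypothesis hgamma : clifford_rep gamma.
Local Notation lam := (lambda ap am ap').
Local Notation KV := (KV ap am ap').
Local Notation kg := (kg ap am ap').
Local Notation tm p := (xcoord ix_m p).
Local Notation xc i p := (xcoord (ix i) p)%:C.
Local Notation sq2 := (Num.sqrt 2 : R)%:C.
Implicit Types (p : pt R) (u v : 'cV[C]_16) (i j : 'I_9) (th : kdata R).

Lemma sq2_sq : sq2 * sq2 = 2 :> C.
Proof. by rewrite -rmorphM /= -expr2 sqr_sqrtr ?ler0n // rmorph_nat. Qed.

Lemma sq2_neq0 : sq2 != 0 :> C.
Proof.
apply/eqP => h; have /eqP := sq2_sq.
by rewrite h mul0r eq_sym pnatr_eq0.
Qed.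

Lemma half_sq2 : 2^-1 * sq2 = sq2^-1 :> C.
Proof. by have h := sq2_neq0; rewrite -sq2_sq; field. Qed.

Lemma Gamma_pi_act i u v :
  (Gamma_p R *m Gamma gamma i) *m col_mx u v = sq2 *: col_mx (gamma i *m v) 0.
Proof.
rewrite /Gamma_p /Gamma -!scalemxAl mulmx_block mul_block_col; congr (_ *: _).
by rewrite !(mul0mx, mulmx0, mul1mx, mulmx1, add0r, addr0).
Qed.

Lemma Gamma_ip_act i u v :
  (Gamma gamma i *m Gamma_p R) *m col_mx u v = - (sq2 *: col_mx (gamma i *m v) 0).
Proof.
rewrite /Gamma_p /Gamma -scalemxAr -!scalemxAl mulmx_block mul_block_col -scalerN.
rewrite opp_col_mx oppr0; congr (_ *: _).
by rewrite !(mul0mx, mulmx0, mul1mx, mulmx1, add0r, addr0) mulNmx.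
Qed.

Lemma Gamma_ij_act i j u v : (Gamma gamma i *m Gamma gamma j) *m col_mx u v =
  col_mx ((gamma i * gamma j) *m u) ((gamma i * gamma j) *m v).
Proof.
rewrite /Gamma mulmx_block mul_block_col mulNmx mulmxN opprK.
by rewrite !(mul0mx, mulmx0, add0r, addr0).
Qed.

Lemma Gamma_up2_anti mu nu : Gamma_up2 gamma nu mu = - Gamma_up2 gamma mu nu.
Proof. by rewrite /Gamma_up2 -scalerN opprB. Qed.

Lemma Gamma_up2_mi i u v :
  Gamma_up2 gamma ix_m (ix i) *m col_mx u v = sq2 *: col_mx (gamma i *m v) 0.
Proof.
rewrite /Gamma_up2 /Gamma_up !by_indexE -scalemxAl mulmxBl Gamma_pi_act Gamma_ip_act.
by rewrite opprK half_double.
Qed.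

Lemma Gamma_up2_ij i j u v : Gamma_up2 gamma (ix i) (ix j) *m col_mx u v =
  2^-1 *: (col_mx ((gamma i * gamma j) *m u) ((gamma i * gamma j) *m v)
           - col_mx ((gamma j * gamma i) *m u) ((gamma j * gamma i) *m v)).
Proof.
by rewrite /Gamma_up2 /Gamma_up !by_indexE -scalemxAl mulmxBl !Gamma_ij_act.
Qed.

Lemma spin_act th (w : 'cV[C]_16) : rotation (kr th) ->
  spin gamma (kr th) *m w = 4^-1 *: \sum_i \sum_j kr th i j *: ((gamma i * gamma j) *m w).
Proof.
move=> _; rewrite /spin -scalemxAl; congr (_ *: _).
rewrite mulmx_suml; apply: eq_bigr => i _; rewrite mulmx_suml; apply: eq_bigr => j _.
by rewrite scalemxAl.
Qed.

Lemma sum_col_mx0 (I : finType) (c : I -> C) (f : I -> 'cV[C]_16) :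
  \sum_i c i *: (col_mx (f i) 0 : spinor R) = col_mx (\sum_i c i *: f i) 0.
Proof.
apply/matrixP => x y; rewrite summxE !mxE; case E1 : (fintype.split x) => [z|z].
  by rewrite summxE; apply: eq_bigr => i _; rewrite !mxE E1.
by rewrite mxE big1 // => i _; rewrite !mxE E1 mxE mulr0.
Qed.

Lemma sum_antisym_col (S : 'M[C]_9) (f g : 'I_9 -> 'I_9 -> 'cV[C]_16) :
  (forall i j, S j i = - S i j) ->
  \sum_i \sum_j S i j *: (2^-1 *: ((col_mx (f i j) (g i j) : spinor R)
                                   - col_mx (f j i) (g j i))) =
  col_mx (\sum_i \sum_j S i j *: f i j) (\sum_i \sum_j S i j *: g i j).
Proof.
move=> anti.
have half (h : 'I_9 -> 'I_9 -> C) :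
    \sum_i \sum_j S i j * (2^-1 * (h i j - h j i)) = \sum_i \sum_j S i j * h i j.
  have flip : \sum_i \sum_j S i j * h j i = - \sum_i \sum_j S i j * h i j.
    rewrite exchange_big -sumrN; apply: eq_bigr => i _; rewrite -sumrN.
    by apply: eq_bigr => j _; rewrite (anti i j) mulNr.
  transitivity (2^-1 * (\sum_i \sum_j S i j * h i j - \sum_i \sum_j S i j * h j i)).
    rewrite -sumrB mulr_sumr; apply: eq_bigr => i _; rewrite -sumrB mulr_sumr.
    by apply: eq_bigr => j _; ring.
  rewrite flip; move: (\sum_i _) => x; by field.
apply/matrixP => x y; rewrite !mxE; case E1 : (fintype.split x) => [z|z]; rewrite !summxE.
  transitivity (\sum_i \sum_j S i j * (2^-1 * (f i j z y - f j i z y))).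
    by apply: eq_bigr => i _; rewrite summxE; apply: eq_bigr => j _; rewrite !mxE E1.
  rewrite (half (fun i j => f i j z y)); apply: eq_bigr => i _.
  by rewrite summxE; apply: eq_bigr => j _; rewrite mxE.
transitivity (\sum_i \sum_j S i j * (2^-1 * (g i j z y - g j i z y))).
  by apply: eq_bigr => i _; rewrite summxE; apply: eq_bigr => j _; rewrite !mxE E1.
rewrite (half (fun i j => g i j z y)); apply: eq_bigr => i _.
by rewrite summxE; apply: eq_bigr => j _; rewrite mxE.
Qed.

Lemma nabla_p xi p : nabla ap am ap' gamma ix_p xi p = pdV ix_p xi p.
Proof. by rewrite /nabla by_indexE. Qed.

Lemma nabla_i xi p i : nabla ap am ap' gamma (ix i) xi p = pdV (ix i) xi p.
Proof. by rewrite /nabla by_indexE. Qed.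

Lemma nabla_m xi p : nabla ap am ap' gamma ix_m xi p = pdV ix_m xi p +
  sq2^-1 *: col_mx (\sum_i (lam i ^+ 2 * xc i p) *: (gamma i *m dsubmx (xi p))) 0.
Proof.
rewrite -sum_col_mx0 /nabla by_indexE -half_sq2 -scalerA [sq2 *: _]scaler_sumr.
congr (_ + _ *: _); apply: eq_bigr => i _.
by rewrite -{1}[xi p]vsubmxK Gamma_pi_act !scalerA mulrC.
Qed.

(** The curvature term hidden in [nabla] along the x^- axis cancels against the
    part of the covariant derivative of the Killing field that involves x^i. *)
Lemma lieD_KV th xi p : rotation (kr th) -> lieD ap am ap' gamma (KV th) xi p =
  \sum_mu KV th p mu 0 *: pdV mu xi p +
  col_mx (sq2^-1 *: (\sum_i kg th i (tm p) *: (gamma i *m dsubmx (xi p)))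
            - spin gamma (kr th) *m usubmx (xi p))
         (- (spin gamma (kr th) *m dsubmx (xi p))).
Proof.
move=> hr; have [anti _] := hr; rewrite /lieD /along.
under [X in _ - _ *: X]eq_bigr => mu _ do under eq_bigr => nu _ do rewrite cov_KV //.
rewrite -[xi p]vsubmxK; set u := usubmx (xi p); set v := dsubmx (xi p).
rewrite col_mxKu col_mxKd.
have E : \sum_mu KV th p mu 0 *: nabla ap am ap' gamma mu xi p =
   \sum_mu KV th p mu 0 *: pdV mu xi p - (km th * sq2^-1) *:
     col_mx (\sum_i (lam i ^+ 2 * xc i p) *: (gamma i *m v)) 0.
  rewrite !sum_index nabla_p nabla_m.
  rewrite (eq_bigr _ (fun i _ => congr1 (fun z => KV th p (ix i) 0 *: z) (nabla_i xi p i))).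
  have cm : KV th p ix_m 0 * sq2^-1 = - (km th * sq2^-1) by rewrite KVE mulNr.
  by rewrite scalerDr scalerA cm scaleNr addrA addrAC.
rewrite E -addrA; congr (_ + _).
set S := spin gamma (kr th).
pose F mu nu := by_index 0 (by_index 0 0 (fun j => kk ap am ap' th j p) mu)
      (fun i => by_index 0 (- kk ap am ap' th i p) (fun j => kr th j i) mu) nu *:
      (Gamma_up2 gamma mu nu *m col_mx u v).
pose K : spinor R := \sum_i kk ap am ap' th i p *: (sq2 *: col_mx (gamma i *m v) 0).
have A1 : \sum_mu \sum_nu F mu nu = - 2 *: K + 4 *: col_mx (S *m u) (S *m v).
  have hp : \sum_nu F ix_p nu = 0.
    apply: big1 => nu _; rewrite /F.
    by case: (indexP nu) => [||i]; rewrite !by_indexE scale0r.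
  have hm : \sum_nu F ix_m nu = - K.
    rewrite sum_index /F !by_indexE [X in X + _ + _]scale0r [X in _ + X + _]scale0r !add0r.
    rewrite /K -sumrN; apply: eq_bigr => i _.
    by rewrite !by_indexE scaleNr Gamma_up2_mi.
  have hk : \sum_k \sum_nu F (ix k) nu =
      - K + \sum_k \sum_i kr th k i *: (Gamma_up2 gamma (ix k) (ix i) *m col_mx u v).
    rewrite -sumrN -big_split; apply: eq_bigr => k _ /=.
    rewrite sum_index /F !by_indexE [X in X + _ + _]scale0r add0r; congr (_ + _).
      by rewrite Gamma_up2_anti mulNmx scalerN Gamma_up2_mi.
    by apply: eq_bigr => i _; rewrite !by_indexE.
  clearbody F K; rewrite sum_index hp hm hk add0r.
  rewrite addrA -[X in X + _]mulr2n -scaler_nat scaleNr -scalerN; congr (_ + _).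
  have h4 (w : 'cV[C]_16) : 4 *: (S *m w) = \sum_i \sum_j kr th i j *: ((gamma i * gamma j) *m w).
    by rewrite /S spin_act // scalerA divff ?scale1r // pnatr_eq0.
  rewrite scale_col_mx (h4 u) (h4 v).
  have := sum_antisym_col (fun i j => (gamma i * gamma j) *m u)
    (fun i j => (gamma i * gamma j) *m v) anti.
  apply: etrans; apply: eq_bigr => i _; apply: eq_bigr => j _; congr (_ *: _).
  exact: Gamma_up2_ij.
rewrite -[X in _ - _ *: X]/(\sum_mu \sum_nu F mu nu) A1 {A1 E} /K.
have cs : \sum_i kk ap am ap' th i p *: (sq2 *: col_mx (gamma i *m v) 0) =
    sq2 *: (col_mx (\sum_i kg th i (tm p) *: (gamma i *m v)) 0 +
            km th *: \sum_i (lam i ^+ 2 * xc i p) *: (col_mx (gamma i *m v) 0 : spinor R)).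
  rewrite -sum_col_mx0 scaler_sumr -big_split scaler_sumr; apply: eq_bigr => i _ /=.
  by rewrite !scalerA -scalerDl scalerA mulrC.
rewrite [X in _ *: (_ *: X + _)]cs.
rewrite sum_col_mx0 -/v.
move: (\sum_i _ *: (gamma i *m v)) (\sum_i _ *: (gamma i *m v)) => a b.
move: (S *m u) (S *m v) => su sv.
rewrite -half_sq2; apply/matrixP => x y; rewrite !mxE.
by case: (fintype.split x) => z; rewrite !mxE; field.
Qed.

End SpinorialLieDerivative.

(** * The action on the sections of K_1 *)

Section XiFields.
Variable R : realType.
Local Notation C := R[i].
Variables (c d : 'M[C]_16) (s : 'I_9 -> 'M[C]_16).
Hypotheses (hc : real_diagonalizable c) (hd : real_diagonalizable d).
Local Notation tm p := (xcoord ix_m p).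
Local Notation xc i p := (xcoord (ix i) p)%:C.
Local Notation sq2 := (Num.sqrt 2 : R)%:C.
Local Notation E A p := (expM (- (tm p)%:C *: A)).
Local Notation Ei A p := (expM (- (- tm p)%:C *: A)).
Implicit Types (p : pt R) (mu : 'I_11) (u v : 'cV[C]_16) (A : 'M[C]_16).

Lemma E_Ei A p : real_diagonalizable A -> E A p *m Ei A p = 1%:M.
Proof. by move=> hA; have := expM_inverse (- tm p) hA; rewrite opprK. Qed.

Lemma E_comm A B p : real_diagonalizable A -> A *m B = B *m A -> E A p *m B = B *m E A p.
Proof. by move=> hA; exact: expM_intertwine. Qed.

Lemma Ei_comm A B p : real_diagonalizable A -> A *m B = B *m A -> Ei A p *m B = B *m Ei A p.
Proof. by move=> hA; exact: expM_intertwine. Qed.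

Lemma E_0 A : real_diagonalizable A -> E A 0 = 1%:M.
Proof. by move=> hA; rewrite /xcoord mxE expM_at0. Qed.

Lemma Ei_0 A : real_diagonalizable A -> Ei A 0 = 1%:M.
Proof. by move=> hA; rewrite /xcoord mxE oppr0 expM_at0. Qed.

(** The sections of K_1 with cbar, d and s kept abstract: their calculus depends
    only on the diagonalizability of the two exponents. *)
Definition gxi u1 u2 : sfield R := fun p =>
  col_mx (E c p *m u1 + sq2^-1 *: \sum_i xc i p *: (s i *m (E d p *m u2))) (E d p *m u2).

Lemma is_pdM_E A mu u p : real_diagonalizable A ->
  is_pdM mu (fun q => E A q *m u) p (- (ix_m == mu)%:R *: (A *m (E A p *m u))).
Proof.
move=> hA; apply: is_pdM_eq (is_pdM_mulr u (is_pdM_expM mu p hA)) _.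
by rewrite -scalemxAl mulmxA.
Qed.

Lemma is_pdM_gxi mu u1 u2 p : is_pdM mu (gxi u1 u2) p
  (col_mx (- (ix_m == mu)%:R *: (c *m (E c p *m u1)) + sq2^-1 *:
     \sum_i ((ix i == mu)%:R *: (s i *m (E d p *m u2)) +
             xc i p *: (s i *m (- (ix_m == mu)%:R *: (d *m (E d p *m u2))))))
    (- (ix_m == mu)%:R *: (d *m (E d p *m u2)))).
Proof.
apply: is_pdM_col_mx; last exact: is_pdM_E.
apply: is_pdM_add; first exact: is_pdM_E.
apply: is_pdM_scalec; apply: is_pdM_sum => i _.
apply: is_pdM_scale; first exact: is_pdC_xcoord.
by apply: is_pdM_mull; exact: is_pdM_E.
Qed.

Lemma pd_gxi_p u1 u2 p : pdV ix_p (gxi u1 u2) p = 0.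
Proof.
rewrite (is_pdVE (is_pdM_gxi ix_p u1 u2 p)) ix_mp oppr0 !scale0r big1 ?scaler0 ?addr0 ?col_mx0 //.
by move=> i _; rewrite ix_ip !scale0r mulmx0 scaler0 addr0.
Qed.

Lemma pd_gxi_i i u1 u2 p :
  pdV (ix i) (gxi u1 u2) p = col_mx (sq2^-1 *: (s i *m (E d p *m u2))) 0.
Proof.
rewrite (is_pdVE (is_pdM_gxi (ix i) u1 u2 p)) ix_mi oppr0 !scale0r add0r.
congr (col_mx (_ *: _) _); rewrite (bigD1 i) //= big1 ?addr0 => [|k ki].
  by rewrite eqxx scale1r mulmx0 scaler0 addr0.
by rewrite ix_ij (negPf ki) scale0r mulmx0 scaler0 addr0.
Qed.

Lemma pd_gxi_m u1 u2 p : pdV ix_m (gxi u1 u2) p =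
  col_mx (- (c *m (E c p *m u1)) -
    sq2^-1 *: \sum_i xc i p *: (s i *m (d *m (E d p *m u2)))) (- (d *m (E d p *m u2))).
Proof.
rewrite (is_pdVE (is_pdM_gxi ix_m u1 u2 p)) eqxx !scaleN1r; congr (col_mx (_ + _) _).
rewrite -scalerN -sumrN; congr (_ *: _); apply: eq_bigr => i _.
by rewrite ix_im scale0r add0r mulmxN scalerN.
Qed.

Lemma elemM_gxi u1 u2 : elemM (gxi u1 u2).
Proof.
have hE A u : real_diagonalizable A -> elemM (fun q => E A q *m u).
  by move=> hA; apply: elemM_mul; [exact: elemM_expM|exact: elemM_cst].
apply: elemM_col_mx; last exact: hE.
apply: elemM_add; first exact: hE.
apply: elemM_scale; first exact: elemC_cst.
apply: elemM_sum => i; apply: elemM_scale; first by apply: elemC_real; exact: elem_coord.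
by apply: elemM_mul; [exact: elemM_cst|exact: hE].
Qed.

Lemma gxi_linear a u1 u2 v1 v2 :
  gxi (a *: u1 + v1) (a *: u2 + v2) = a *: gxi u1 u2 + gxi v1 v2.
Proof.
apply/funext => p; rewrite -[RHS]/(a *: gxi u1 u2 p + gxi v1 v2 p) /gxi.
move: (E c p) (E d p) => e f.
rewrite scale_col_mx add_col_mx !mulmxDr -!scalemxAr; congr col_mx.
rewrite scalerDr addrACA; congr (_ + _).
rewrite scalerA mulrC -scalerA -scalerDr; congr (_ *: _).
rewrite scaler_sumr -big_split; apply: eq_bigr => i _ /=.
by rewrite mulmxDr -scalemxAr scalerDr !scalerA mulrC.
Qed.

Lemma gxi_u u1 u2 : usubmx (gxi u1 u2 0) = u1.
Proof.
rewrite /gxi col_mxKu (E_0 hc) mul1mx big1 ?scaler0 ?addr0 // => i _.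
by rewrite /xcoord mxE scale0r.
Qed.

Lemma gxi_d u1 u2 : dsubmx (gxi u1 u2 0) = u2.
Proof. by rewrite /gxi col_mxKd (E_0 hd) mul1mx. Qed.

End XiFields.

Section OddPart.
Variable R : realType.
Local Notation C := R[i].
Variables ap am ap' am' : R.
Variable gamma : gammas R.
Hypothesis hgamma : clifford_rep gamma.
Local Notation lam := (lambda ap am ap').
Local Notation KV := (KV ap am ap').
Local Notation kf := (kf ap am ap').
Local Notation kg := (kg ap am ap').
Local Notation cb := (cbar ap am gamma).
Local Notation dm := (dd ap' am' gamma).
Local Notation sc := (scd ap am ap' am' gamma).
Local Notation Q := (Q1234 gamma).
Local Notation xi := (xi_field ap am ap' am' gamma).
Local Notation tm p := (xcoord ix_m p).
Local Notation xc i p := (xcoord (ix i) p)%:C.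
Local Notation sq2 := (Num.sqrt 2 : R)%:C.
Local Notation E A p := (expM (- (tm p)%:C *: A)).
Local Notation Ei A p := (expM (- (- tm p)%:C *: A)).
Implicit Types (p : pt R) (u v : 'cV[C]_16) (i j : 'I_9) (th : kdata R).

Lemma xi_field_gxi : xi = gxi cb dm sc.
Proof. by []. Qed.

Lemma Q_E p u : Q *m u = u -> Q *m (E dm p *m u) = E dm p *m u.
Proof.
move=> Qu; rewrite mulmxA -(E_comm p (dd_diag ap' am' hgamma)); first by rewrite -mulmxA Qu.
by rewrite !mulmxE (Q_dd ap' am' hgamma).
Qed.

(** The integrability condition of the parallel transport equation. *)
Lemma curvature_act i v : Q *m v = v ->
  cb *m (sc i *m v) - sc i *m (dm *m v) = - (lam i ^+ 2 *: (gamma i *m v)).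
Proof.
move=> Qv; rewrite (@obstruction_act _ _ _ _ _ _ hgamma i false) ?expr0 ?scale1r //.
by rewrite (lambda_sq ap am ap' am') scaleNr opprK.
Qed.

(** The action of a Killing field on the initial values (u1, u2) of a section;
    the first component is [act_minus]. *)
Definition act_plus th u2 : 'cV[C]_16 := km th *: (dm *m u2) - spin gamma (kr th) *m u2.
Definition act_minus th u1 u2 : 'cV[C]_16 :=
  km th *: (cb *m u1) - spin gamma (kr th) *m u1 + sq2^-1 *:
   \sum_i ((kb th i * lam i ^+ 2) *: (gamma i *m u2) - ka th i *: (sc i *m u2)).

(** Conjugating by the exponentials turns the translation part of the action of
    a Killing field into a field along the x^- axis with zero derivative. *)
Lemma translation_constant th i u p : Q *m u = u ->
  E cb p *m ((kb th i * lam i ^+ 2) *: (gamma i *m u) - ka th i *: (sc i *m u)) =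
  kf th i (tm p) *: (sc i *m (E dm p *m u)) + kg th i (tm p) *: (gamma i *m (E dm p *m u)).
Proof.
move=> Qu.
have Qv q := Q_E q Qu.
have H1 q := curvature_act i (Qv q).
have H2 q := scd_mul ap am ap' am' gamma i (E dm q *m u).
move: (cbar_diag ap am hgamma) (dd_diag ap' am' hgamma) H1 H2.
move: cb dm (sc i) => c d s hc hd H1 H2.
(* both sides are compared after undoing the exponential: w is constant *)
pose w q := Ei c q *m (kf th i (tm q) *: (s *m (E d q *m u)) +
                       kg th i (tm q) *: (gamma i *m (E d q *m u))).
have w0 mu q : is_pdM mu w q 0.
  apply: is_pdM_eq.
    apply: is_pdM_mul; first exact: is_pdM_expM_opp.
    apply: is_pdM_add.
      apply: is_pdM_scale; first exact: is_pdC_kf.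
      by apply: is_pdM_mull; exact: is_pdM_E.
    apply: is_pdM_scale; first exact: is_pdC_kg.
    by apply: is_pdM_mull; exact: is_pdM_E.
  have := H1 q; have := H2 q; rewrite (esym (Ei_comm q hc (erefl (c *m c)))).
  move: (E d q *m u) (Ei c q) => v e h2 h1.
  case: (ix_m == mu); last first.
    by rewrite !mul0r oppr0 !scale0r mul0mx !mulmx0 !scaler0 !addr0 mulmx0 addr0.
  rewrite !mul1r scale1r -mulmxA -mulmxDr -[RHS](mulmx0 _ e); congr (_ *m _).
  rewrite !scaleN1r !mulmxN mulmxDr -!scalemxAr.
  have {}h1 : c *m (s *m v) = s *m (d *m v) - lam i ^+ 2 *: (gamma i *m v).
    by rewrite -h1 addrC subrK.
  rewrite h1 h2; move: (s *m (d *m v)) (gamma i *m v) (c *m (gamma i *m v)).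
  move: (gamma i *m (d *m v)) (kf _ _ _) (kg _ _ _) => x1 f g x2 x3 x4.
  by apply/matrixP => k l; rewrite !mxE; ring.
have := is_pdM0_constant w0 p.
rewrite /w (Ei_0 hc) (E_0 hd) !mul1mx.
move=> h; apply: etrans (_ : _ = E c p *m _) _; last first.
  apply: etrans (congr1 (mulmx (E c p)) (esym h)) _.
  by apply: etrans (mulmxA _ _ _) _; apply: etrans (congr1 (mulmx^~ _) (E_Ei p hc)) (mul1mx _).
congr (_ *m _); rewrite /xcoord mxE kfE kgE chl0 shl0 !mulr0 !mulr1 subr0 addr0 scaleNr addrC.
by [].
Qed.

(** The field K_- contributes cbar and d, a rotation contributes its spin lift,
    and the translations are handled by [translation_constant]. *)
Lemma lieD_xi th u1 u2 : rotation (kr th) -> Q *m u2 = u2 ->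
  lieD ap am ap' gamma (KV th) (xi u1 u2) = xi (act_minus th u1 u2) (act_plus th u2).
Proof.
move=> hr Qu; apply/funext => p; rewrite lieD_KV // xi_field_gxi.
have hc := cbar_diag ap am hgamma; have hd := dd_diag ap' am' hgamma.
rewrite sum_index pd_gxi_p // pd_gxi_m //.
rewrite (eq_bigr _ (fun i _ => congr1 (fun z => KV th p (ix i) 0 *: z)
  (pd_gxi_i sc hc hd i u1 u2 p))).
rewrite KV_m (eq_bigr _ (fun i _ => congr1 (fun z => z *: _) (KV_i ap am ap' th p i))).
rewrite sum_col_mx0 /gxi col_mxKu col_mxKd /act_minus /act_plus.
have tr i := translation_constant th i p Qu.
have hS k := spin_scd ap am ap' am' hgamma k hr.
have ec : E cb p *m cb = cb *m E cb p by exact: E_comm.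
have fd : E dm p *m dm = dm *m E dm p by exact: E_comm.
have eS : E cb p *m spin gamma (kr th) = spin gamma (kr th) *m E cb p.
  by apply: E_comm => //; have := spin_cbar ap am hgamma hr; rewrite -!mulmxE.
have fS : E dm p *m spin gamma (kr th) = spin gamma (kr th) *m E dm p.
  by apply: E_comm => //; have := spin_dd ap' am' hgamma hr; rewrite -!mulmxE.
move: ec fd eS fS tr hS hc hd; move: cb dm sc => c d s ec fd eS fS tr hS0 _ _.
move: ec fd eS fS tr hS0; move: (E c p) (E d p) => e f.
move: (spin gamma (kr th)) => S ec fd eS fS tr hS0.
have hS k (v : 'cV[C]_16) : \sum_j kr th k j *: (s j *m v) =
    S *m (s k *m v) - s k *m (S *m v).
  rewrite !mulmxA -mulmxBl !mulmxE hS0 mulmx_suml.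
  by apply: eq_bigr => j _; rewrite scalemxAl.
have fv : f *m (km th *: (d *m u2) - S *m u2) = km th *: (d *m (f *m u2)) - S *m (f *m u2).
  by rewrite mulmxBr -scalemxAr !mulmxA fd fS.
rewrite fv; rewrite scaler0 add0r scale_col_mx !add_col_mx.
congr col_mx; last by rewrite addr0 scaleNr scalerN opprK.
set v := f *m u2.
have rot : \sum_i (\sum_j xc j p * kr th j i) *: (s i *m v) =
    \sum_i xc i p *: (S *m (s i *m v)) - \sum_i xc i p *: (s i *m (S *m v)).
  rewrite -sumrB (eq_bigr (fun i => \sum_j (xc j p * kr th j i) *: (s i *m v))); last first.
    by move=> i _; rewrite scaler_suml.
  rewrite exchange_big /=; apply: eq_bigr => j _; rewrite -scalerBr -hS scaler_sumr.
  by apply: eq_bigr => i _; rewrite scalerA.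
rewrite (mulmxDr e) (mulmxBr e) -!(scalemxAr _ e) !(mulmxA e) ec eS -!mulmxA mulmx_sumr.
rewrite (eq_bigr _ (fun i _ => tr i)) big_split /= -/v.
have -> : \sum_i (kf th i (tm p) + \sum_j xc j p * kr th j i) *: (sq2^-1 *: (s i *m v)) =
    sq2^-1 *: (\sum_i kf th i (tm p) *: (s i *m v) +
               \sum_i (\sum_j xc j p * kr th j i) *: (s i *m v)).
  rewrite -big_split scaler_sumr; apply: eq_bigr => i _ /=.
  by rewrite -scalerDl !scalerA mulrC.
rewrite rot.
have -> : \sum_i xc i p *: (s i *m (km th *: (d *m v) - S *m v)) =
    km th *: (\sum_i xc i p *: (s i *m (d *m v))) - \sum_i xc i p *: (s i *m (S *m v)).
  rewrite scaler_sumr -sumrB; apply: eq_bigr => i _.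
  by rewrite mulmxBr -scalemxAr scalerBr !scalerA mulrC.
have -> : S *m (e *m u1 + sq2^-1 *: (\sum_i xc i p *: (s i *m v))) =
    S *m (e *m u1) + sq2^-1 *: \sum_i xc i p *: (S *m (s i *m v)).
  rewrite mulmxDr -scalemxAr mulmx_sumr; congr (_ + _ *: _).
  by apply: eq_bigr => i _; rewrite -scalemxAr.
move: (\sum_i xc i p *: (s i *m (d *m v))) (\sum_i xc i p *: (S *m (s i *m v))) => y1 y2.
move: (\sum_i xc i p *: (s i *m (S *m v))) (\sum_i kf th i (tm p) *: (s i *m v)) => y3 y4.
move: (\sum_i kg th i (tm p) *: (gamma i *m v)) (c *m (e *m u1)) (S *m (e *m u1)) => y5 y6 y7.
by apply/matrixP => k l; rewrite !mxE; ring.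
Qed.

End OddPart.

(** * Parallel sections *)

Section Parallel.
Variable R : realType.
Local Notation C := R[i].
Variables ap am ap' am' : R.
Variable gamma : gammas R.
Hypothesis hgamma : clifford_rep gamma.
Local Notation lam := (lambda ap am ap').
Local Notation cb := (cbar ap am gamma).
Local Notation dm := (dd ap' am' gamma).
Local Notation sc := (scd ap am ap' am' gamma).
Local Notation Q := (Q1234 gamma).
Local Notation xi := (xi_field ap am ap' am' gamma).
Local Notation D := (Dconn ap am ap' am' gamma).
Local Notation tm p := (xcoord ix_m p).
Local Notation xc i p := (xcoord (ix i) p)%:C.
Local Notation sq2 := (Num.sqrt 2 : R)%:C.
Local Notation E A p := (expM (- (tm p)%:C *: A)).
Local Notation Ei A p := (expM (- (- tm p)%:C *: A)).
Implicit Types (p : pt R) (u v : 'cV[C]_16) (i j : 'I_9) (f : sfield R).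

Lemma Dconn_p f p : D ix_p f p = pdV ix_p f p.
Proof. by rewrite /Dconn nabla_p by_indexE addr0. Qed.

Lemma Dconn_i f p i : D (ix i) f p =
  pdV (ix i) f p - sq2^-1 *: col_mx (sc i *m dsubmx (f p)) 0.
Proof. by rewrite /Dconn nabla_i by_indexE. Qed.

Lemma Dconn_m f p : D ix_m f p = pdV ix_m f p +
  col_mx (sq2^-1 *: (\sum_i (lam i ^+ 2 * xc i p) *: (gamma i *m dsubmx (f p))) +
          cb *m usubmx (f p)) (dm *m dsubmx (f p)).
Proof.
rewrite /Dconn nabla_m by_indexE -addrA; congr (_ + _).
by rewrite scale_col_mx add_col_mx scaler0 add0r.
Qed.

(** Along x^- the terms linear in x^i cancel by [curvature_act]. *)
Lemma xi_parallel u1 u2 : Q *m u2 = u2 -> parallel D (xi u1 u2).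
Proof.
move=> Qu; rewrite xi_field_gxi.
have hc := cbar_diag ap am hgamma; have hd := dd_diag ap' am' hgamma.
split; first by apply: elemM_smooth; exact: elemM_gxi.
move=> mu p; case: (indexP mu) => [||i].
- by rewrite Dconn_p pd_gxi_p.
- rewrite Dconn_m pd_gxi_m // /gxi col_mxKu col_mxKd.
  have H i := curvature_act ap am ap' am' hgamma i (Q_E ap' am' hgamma p Qu).
  move: cb dm sc hc hd H => c d s _ _ H.
  move: H; move: (E c p) (E d p) => e0 f0; move: (e0 *m u1) (f0 *m u2) => e v H.
  rewrite add_col_mx addNr -[RHS]col_mx0; congr col_mx.
  rewrite mulmxDr -scalemxAr mulmx_sumr.
  have -> : \sum_i c *m (xc i p *: (s i *m v)) =
      \sum_i xc i p *: (s i *m (d *m v)) - \sum_i (lam i ^+ 2 * xc i p) *: (gamma i *m v).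
    rewrite -sumrB; apply: eq_bigr => i _; rewrite -scalemxAr.
    have -> : c *m (s i *m v) = s i *m (d *m v) - lam i ^+ 2 *: (gamma i *m v).
      by rewrite -(H i) addrC subrK.
    by rewrite scalerBr scalerA mulrC.
  move: (\sum_i xc i p *: (s i *m (d *m v))) (c *m e) => x z.
  move: (\sum_i (lam i ^+ 2 * xc i p) *: (gamma i *m v)) => y.
  by apply/matrixP => k l; rewrite !mxE; ring.
- by rewrite Dconn_i pd_gxi_i // /gxi col_mxKd scale_col_mx scaler0 subrr.
Qed.

Section ParallelField.
Variable f : sfield R.
Hypothesis hf : parallel D f.
Local Notation f1 p := (usubmx (f p)).
Local Notation f2 p := (dsubmx (f p)).

Lemma par_p p : is_pdM ix_p f p 0.
Proof.
have [sf h] := hf; have := smooth_is_pdM ix_p p sf.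
by have := h ix_p p; rewrite Dconn_p => ->.
Qed.

Lemma par_i i p : is_pdM (ix i) f p (col_mx (sq2^-1 *: (sc i *m f2 p)) 0).
Proof.
have [sf h] := hf; have := smooth_is_pdM (ix i) p sf.
have /eqP := h (ix i) p; rewrite Dconn_i subr_eq0 => /eqP ->.
by rewrite scale_col_mx scaler0.
Qed.

Lemma par_m p : is_pdM ix_m f p (- col_mx
   (sq2^-1 *: (\sum_i (lam i ^+ 2 * xc i p) *: (gamma i *m f2 p)) + cb *m f1 p)
   (dm *m f2 p)).
Proof.
have [sf h] := hf; have := smooth_is_pdM ix_m p sf.
by have /eqP := h ix_m p; rewrite Dconn_m addr_eq0 => /eqP ->.
Qed.

(** Symmetry of the mixed second derivative of the first component along x^i
    and x^-. *)
Lemma par_obstruction i p :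
  cb *m (sc i *m f2 p) - sc i *m (dm *m f2 p) + lam i ^+ 2 *: (gamma i *m f2 p) = 0.
Proof.
have [sf _] := hf.
have e1 : pdV (ix i) f = fun q => col_mx (sq2^-1 *: (sc i *m f2 q)) 0.
  by apply/funext => q; exact: is_pdVE (par_i i q).
have e2 : pdV ix_m f = fun q => - col_mx
   (sq2^-1 *: (\sum_k (lam k ^+ 2 * xc k q) *: (gamma k *m f2 q)) + cb *m f1 q) (dm *m f2 q).
  by apply/funext => q; exact: is_pdVE (par_m q).
have := pdV_comm (ix i) ix_m p sf; rewrite e1 e2.
have := par_i i; have := par_m.
move: cb dm sc => c d s pm pi.
have d1 : is_pdM ix_m (fun q => col_mx (sq2^-1 *: (s i *m f2 q)) (0 : 'cV[C]_16)) p
    (col_mx (sq2^-1 *: (s i *m - (d *m f2 p))) 0).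
  apply: is_pdM_col_mx; last exact: is_pdM_cst.
  apply: is_pdM_scalec; apply: is_pdM_mull.
  by apply: is_pdM_eq (is_pdM_dsubmx (pm p)) _; rewrite opp_col_mx col_mxKd.
have d2 : is_pdM (ix i) (fun q => - col_mx
   (sq2^-1 *: (\sum_k (lam k ^+ 2 * xc k q) *: (gamma k *m f2 q)) + c *m f1 q) (d *m f2 q)) p
   (- col_mx (sq2^-1 *: (lam i ^+ 2 *: (gamma i *m f2 p)) + c *m (sq2^-1 *: (s i *m f2 p)))
             0).
  have f20 : is_pdM (ix i) (fun q => f2 q) p 0.
    by apply: is_pdM_eq (is_pdM_dsubmx (pi p)) _; rewrite col_mxKd.
  have f10 : is_pdM (ix i) (fun q => f1 q) p (sq2^-1 *: (s i *m f2 p)).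
    by apply: is_pdM_eq (is_pdM_usubmx (pi p)) _; rewrite col_mxKu.
  apply: is_pdM_opp; apply: is_pdM_col_mx; last first.
    by apply: is_pdM_eq (is_pdM_mull d f20) _; rewrite mulmx0.
  apply: is_pdM_add; last exact: is_pdM_mull.
  apply: is_pdM_scalec; apply: is_pdM_eq.
    apply: is_pdM_sum => k _; apply: is_pdM_scale.
      apply: is_pdC_mul; [exact: is_pdC_cst|exact: is_pdC_xcoord].
    by apply: is_pdM_mull; exact: f20.
  rewrite (bigD1 i) //= big1 => [|k ki].
    by rewrite eqxx mul0r add0r mulr1 mulmx0 scaler0 !addr0.
  by rewrite ix_ij (negPf ki) mul0r add0r mulr0 scale0r add0r mulmx0 scaler0.
rewrite (is_pdVE d1) (is_pdVE d2) opp_col_mx => /eq_col_mx [+ _].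
rewrite -scalemxAr -scalerDr -scalerN => /(scalerI (invr_neq0 (sq2_neq0 R))).
rewrite mulmxN => /eqP; rewrite eqr_opp => /eqP h.
by rewrite -h [_ + c *m _]addrC opprD addrA subrr add0r addNr.
Qed.

(** Undoing the exponentials, first in the second component and then in the
    first one corrected by its x^i part, leaves constants. *)
Lemma par_xi : Q *m f2 0 = f2 0 -> f = xi (f1 0) (f2 0).
Proof.
move=> Q0; rewrite xi_field_gxi.
have hc := cbar_diag ap am hgamma; have hd := dd_diag ap' am' hgamma.
have ob := par_obstruction.
have pp := par_p; have pi := par_i; have pm := par_m.
move: cb dm sc hc hd ob pi pm => c d s hc hd ob pi pm {Q0}.
have f2m q : is_pdM ix_m (fun q => f2 q) q (- (d *m f2 q)).
  by apply: is_pdM_eq (is_pdM_dsubmx (pm q)) _; rewrite opp_col_mx col_mxKd.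
have f2i i q : is_pdM (ix i) (fun q => f2 q) q 0.
  by apply: is_pdM_eq (is_pdM_dsubmx (pi i q)) _; rewrite col_mxKd.
have f2p q : is_pdM ix_p (fun q => f2 q) q 0.
  by apply: is_pdM_eq (is_pdM_dsubmx (pp q)) _; rewrite linear0.
have E2 q : f2 q = E d q *m f2 0.
  have h mu r : is_pdM mu (fun q => Ei d q *m f2 q) r 0.
    case: (indexP mu) => [||i].
    - apply: is_pdM_eq (is_pdM_mul (is_pdM_expM_opp ix_p r hd) (f2p r)) _.
      by rewrite ix_mp scale0r mul0mx mulmx0 addr0.
    - apply: is_pdM_eq (is_pdM_mul (is_pdM_expM_opp ix_m r hd) (f2m r)) _.
      by rewrite eqxx scale1r mulmxN mulmxA (Ei_comm r hd (erefl (d *m d))) subrr.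
    - apply: is_pdM_eq (is_pdM_mul (is_pdM_expM_opp (ix i) r hd) (f2i i r)) _.
      by rewrite ix_mi scale0r mul0mx mulmx0 addr0.
  have := is_pdM0_constant h q; rewrite (Ei_0 hd) mul1mx => <-.
  by rewrite mulmxA (E_Ei q hd) mul1mx.
pose g q := f1 q - sq2^-1 *: \sum_i xc i q *: (s i *m f2 q).
have dg mu r l l1 : is_pdM mu (fun q => f1 q) r l1 -> is_pdM mu (fun q => f2 q) r l ->
    is_pdM mu g r (l1 - sq2^-1 *: \sum_i ((ix i == mu)%:R *: (s i *m f2 r) +
                                          xc i r *: (s i *m l))).
  move=> h1 h2; apply: is_pdM_add => //; apply: is_pdM_opp; apply: is_pdM_scalec.
  apply: is_pdM_sum => i _; apply: is_pdM_scale; first exact: is_pdC_xcoord.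
  exact: is_pdM_mull.
have f1m q : is_pdM ix_m (fun q => f1 q) q
    (- (sq2^-1 *: (\sum_i (lam i ^+ 2 * xc i q) *: (gamma i *m f2 q)) + c *m f1 q)).
  by apply: is_pdM_eq (is_pdM_usubmx (pm q)) _; rewrite opp_col_mx col_mxKu.
have f1i i q : is_pdM (ix i) (fun q => f1 q) q (sq2^-1 *: (s i *m f2 q)).
  by apply: is_pdM_eq (is_pdM_usubmx (pi i q)) _; rewrite col_mxKu.
have f1p q : is_pdM ix_p (fun q => f1 q) q 0.
  by apply: is_pdM_eq (is_pdM_usubmx (pp q)) _; rewrite linear0.
have gp r : is_pdM ix_p g r 0.
  apply: is_pdM_eq (dg _ _ _ _ (f1p r) (f2p r)) _.
  by rewrite big1 ?scaler0 ?subr0 // => i _; rewrite ix_ip scale0r add0r mulmx0 scaler0.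
have gi i r : is_pdM (ix i) g r 0.
  apply: is_pdM_eq (dg _ _ _ _ (f1i i r) (f2i i r)) _.
  rewrite (bigD1 i) //= big1 => [|k ki].
    by rewrite eqxx scale1r mulmx0 scaler0 !addr0 subrr.
  by rewrite ix_ij (negPf ki) scale0r add0r mulmx0 scaler0.
have gm r : is_pdM ix_m g r (- (c *m g r)).
  apply: is_pdM_eq (dg _ _ _ _ (f1m r) (f2m r)) _.
  have -> : c *m g r = c *m f1 r - sq2^-1 *: \sum_i (xc i r *: (s i *m (d *m f2 r)) -
      (lam i ^+ 2 * xc i r) *: (gamma i *m f2 r)).
    rewrite /g mulmxBr -scalemxAr mulmx_sumr; congr (_ - _ *: _); apply: eq_bigr => i _.
    rewrite -scalemxAr (_ : c *m (s i *m f2 r) =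
      s i *m (d *m f2 r) - lam i ^+ 2 *: (gamma i *m f2 r)).
      by rewrite scalerBr scalerA mulrC.
    have := ob i r; move: (c *m _) (s i *m (d *m _)) (_ *: _) => x y z /eqP.
    by rewrite addr_eq0 subr_eq => /eqP ->; rewrite addrC.
  have -> : \sum_i ((ix i == ix_m)%:R *: (s i *m f2 r) + xc i r *: (s i *m - (d *m f2 r))) =
      - \sum_i xc i r *: (s i *m (d *m f2 r)).
    by rewrite -sumrN; apply: eq_bigr => i _; rewrite ix_im scale0r add0r mulmxN scalerN.
  rewrite sumrB; move: (\sum_i (lam i ^+ 2 * xc i r) *: (gamma i *m f2 r)) => y1.
  move: (\sum_i xc i r *: (s i *m (d *m f2 r))) (c *m f1 r) => y2 y3.
  by apply/matrixP => k l; rewrite !mxE; ring.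
have E1 q : g q = E c q *m f1 0.
  have h mu r : is_pdM mu (fun q => Ei c q *m g q) r 0.
    case: (indexP mu) => [||i].
    - apply: is_pdM_eq (is_pdM_mul (is_pdM_expM_opp ix_p r hc) (gp r)) _.
      by rewrite ix_mp scale0r mul0mx mulmx0 addr0.
    - apply: is_pdM_eq (is_pdM_mul (is_pdM_expM_opp ix_m r hc) (gm r)) _.
      by rewrite eqxx scale1r mulmxN mulmxA (Ei_comm r hc (erefl (c *m c))) subrr.
    - apply: is_pdM_eq (is_pdM_mul (is_pdM_expM_opp (ix i) r hc) (gi i r)) _.
      by rewrite ix_mi scale0r mul0mx mulmx0 addr0.
  have g0 : g 0 = f1 0.
    by rewrite /g big1 ?scaler0 ?subr0 // => i _; rewrite /xcoord mxE scale0r.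
  have := is_pdM0_constant h q; rewrite (Ei_0 hc) mul1mx g0 => <-.
  by rewrite mulmxA (E_Ei q hc) mul1mx.
apply/funext => q; rewrite -[LHS]vsubmxK; apply: etrans (_ : _ = col_mx (g q + sq2^-1 *:
  \sum_i xc i q *: (s i *m f2 q)) (f2 q)) _; first by rewrite /g subrK.
by rewrite E1 {1 2}E2.
Qed.

End ParallelField.

End Parallel.

(** * Flatness *)

Section Flatness.
Variable R : realType.
Local Notation C := R[i].
Variables ap am ap' am' : R.
Variable gamma : gammas R.
Hypothesis hgamma : clifford_rep gamma.
Local Notation lam := (lambda ap am ap').
Local Notation cb := (cbar ap am gamma).
Local Notation dm := (dd ap' am' gamma).
Local Notation sc := (scd ap am ap' am' gamma).
Local Notation D := (Dconn ap am ap' am' gamma).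
Local Notation xc i p := (xcoord (ix i) p)%:C.
Local Notation sq2 := (Num.sqrt 2 : R)%:C.
Local Notation M32 := 'M[C]_(16 + 16).
Implicit Types (p : pt R) (u v : 'cV[C]_16) (i j : 'I_9) (mu nu rho : 'I_11).
Implicit Types (f : sfield R) (X Y : vfield R).

(** Such matrices multiply to zero, so in the curvature they only meet the
    diagonal part of the connection form. *)
Definition upper (A : 'M[C]_16) : M32 := block_mx 0 A 0 0.

Lemma upper_add A B : upper A + upper B = upper (A + B).
Proof. by rewrite /upper add_block_mx !addr0. Qed.

Lemma upper_scale a A : a *: upper A = upper (a *: A).
Proof. by rewrite /upper scale_block_mx !scaler0. Qed.

Lemma upper_mul A B : upper A *m upper B = 0.
Proof. by rewrite /upper mulmx_block !(mul0mx, mulmx0, addr0, add0r) block_mx0. Qed.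

Lemma diag_upper (c d A : 'M[C]_16) : block_mx c 0 0 d *m upper A = upper (c *m A).
Proof. by rewrite /upper mulmx_block !(mul0mx, mulmx0, addr0, add0r). Qed.

Lemma upper_diag (c d A : 'M[C]_16) : upper A *m block_mx c 0 0 d = upper (A *m d).
Proof. by rewrite /upper mulmx_block !(mul0mx, mulmx0, addr0, add0r). Qed.

Lemma upper_act A (w : spinor R) : upper A *m w = col_mx (A *m dsubmx w) 0.
Proof. by rewrite -{1}[w]vsubmxK /upper mul_block_col !(mul0mx, addr0, add0r). Qed.

Definition form mu p : M32 :=
  by_index 0
   (block_mx cb 0 0 dm + sq2^-1 *: \sum_i (lam i ^+ 2 * xc i p) *: upper (gamma i))
   (fun i => - (sq2^-1 *: upper (sc i))) mu.

Definition dform nu mu : M32 :=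
  by_index 0 (by_index 0 0 (fun j => sq2^-1 *: (lam j ^+ 2 *: upper (gamma j))) nu)
    (fun=> 0) mu.

Lemma Dconn_form mu f p : D mu f p = pdV mu f p + form mu p *m f p.
Proof.
rewrite /form; case: (indexP mu) => [||i]; rewrite by_indexE.
- by rewrite Dconn_p mul0mx addr0.
- rewrite Dconn_m; congr (_ + _).
  move: cb dm => c d; rewrite mulmxDl.
  have -> : (sq2^-1 *: \sum_i (lam i ^+ 2 * xc i p) *: upper (gamma i)) *m f p =
      sq2^-1 *: col_mx (\sum_i (lam i ^+ 2 * xc i p) *: (gamma i *m dsubmx (f p))) 0.
    rewrite -scalemxAl mulmx_suml -sum_col_mx0; congr (_ *: _); apply: eq_bigr => i _.
    by rewrite -scalemxAl upper_act.
  have -> : block_mx c 0 0 d *m f p = col_mx (c *m usubmx (f p)) (d *m dsubmx (f p)).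
    by rewrite -{1}[f p]vsubmxK mul_block_col !(mul0mx, addr0, add0r).
  by rewrite scale_col_mx scaler0 add_col_mx addr0 addrC.
- by rewrite Dconn_i mulNmx -scalemxAl upper_act.
Qed.

Lemma is_pdM_form nu mu p : is_pdM nu (form mu) p (dform nu mu).
Proof.
rewrite /form /dform; case: (indexP mu) => [||i].
- by rewrite by_indexE; apply: is_pdM_ext (is_pdM_cst _ 0 _) _ => q; rewrite by_indexE.
- rewrite by_indexE; apply: is_pdM_ext; last by move=> q; rewrite by_indexE.
  apply: is_pdM_eq.
    apply: is_pdM_add; first exact: is_pdM_cst.
    apply: is_pdM_scalec; apply: is_pdM_sum => i _; apply: is_pdM_scaler.
    apply: is_pdC_mul; [exact: is_pdC_cst|exact: is_pdC_xcoord].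
  rewrite add0r; case: (indexP nu) => [||j]; rewrite by_indexE.
  + by rewrite big1 ?scaler0 // => i _; rewrite ix_ip mul0r mulr0 addr0 scale0r.
  + by rewrite big1 ?scaler0 // => i _; rewrite ix_im mul0r mulr0 addr0 scale0r.
  + rewrite (bigD1 j) //= big1 ?addr0 => [|k kj].
      by rewrite eqxx mul0r add0r mulr1.
    by rewrite ix_ij (negPf kj) mul0r mulr0 addr0 scale0r.
- by rewrite by_indexE; apply: is_pdM_ext (is_pdM_cst _ _ _) _ => q; rewrite by_indexE.
Qed.

Lemma is_pdM_D nu mu f p : smooth f -> is_pdM nu (D mu f) p
  (pdV nu (pdV mu f) p + (dform nu mu *m f p + form mu p *m pdV nu f p)).
Proof.
move=> sf; apply: is_pdM_ext; last by move=> q; exact: Dconn_form.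
apply: is_pdM_add; first by apply: smooth_is_pdM; exact: smooth_pdV.
by apply: is_pdM_mul; [exact: is_pdM_form|exact: smooth_is_pdM].
Qed.

Hypothesis obstruction0 : forall i,
  cb *m sc i - sc i *m dm + lam i ^+ 2 *: gamma i = 0.

(** The Maurer-Cartan equation. Only its components along x^i and x^- involve
    the obstruction. *)
Lemma form_flat nu mu p :
  dform nu mu + form nu p *m form mu p = dform mu nu + form mu p *m form nu p.
Proof.
have key i : dform (ix i) ix_m + form (ix i) p *m form ix_m p =
    dform ix_m (ix i) + form ix_m p *m form (ix i) p.
  rewrite /dform /form !by_indexE add0r; have := obstruction0 i.
  move: cb dm (sc i) => c d s h.
  have up0 : upper s *m (sq2^-1 *: \sum_i0 (lam i0 ^+ 2 * xc i0 p) *: upper (gamma i0)) = 0.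
    rewrite -scalemxAr mulmx_sumr big1 ?scaler0 // => k _.
    by rewrite -scalemxAr upper_mul scaler0.
  have up1 : (sq2^-1 *: \sum_i0 (lam i0 ^+ 2 * xc i0 p) *: upper (gamma i0)) *m upper s = 0.
    rewrite -scalemxAl mulmx_suml big1 ?scaler0 // => k _.
    by rewrite -scalemxAl upper_mul scaler0.
  rewrite mulNmx mulmxN -scalemxAl -scalemxAr mulmxDr mulmxDl up0 up1 !addr0.
  rewrite upper_diag diag_upper -scalerBr upper_scale -scalerN; congr (_ *: _).
  apply/eqP; rewrite -subr_eq0 opprK; apply/eqP.
  have -> : upper (lam i ^+ 2 *: gamma i) - upper (s *m d) + upper (c *m s) =
    upper (c *m s - s *m d + lam i ^+ 2 *: gamma i).
    have uN A : upper (- A) = - upper A by rewrite -[- A]scaleN1r -upper_scale scaleN1r.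
    rewrite -(upper_add (c *m s - s *m d)) -(upper_add (c *m s)) (uN (s *m d)).
    by rewrite addrC addrA addrAC.
  by rewrite h /upper block_mx0.
have fp : form ix_p p = 0 by rewrite /form by_indexE.
have dp1 rho : dform ix_p rho = 0.
  by rewrite /dform; case: (indexP rho) => [||i]; rewrite !by_indexE.
have dp2 rho : dform rho ix_p = 0 by rewrite /dform by_indexE.
have dii i j : dform (ix i) (ix j) = 0 by rewrite /dform by_indexE.
have fii i j : form (ix i) p *m form (ix j) p = 0.
  rewrite /form !by_indexE; move: (sc i) (sc j) => s s'.
  by rewrite mulNmx mulmxN -scalemxAl -scalemxAr upper_mul !scaler0 !oppr0.
case: (indexP nu) => [||i]; case: (indexP mu) => [||j].
- by [].
- by rewrite dp1 dp2 fp mul0mx mulmx0.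
- by rewrite dp1 dp2 fp mul0mx mulmx0.
- by rewrite dp1 dp2 fp mul0mx mulmx0.
- by [].
- exact: esym (key j).
- by rewrite dp1 dp2 fp mul0mx mulmx0.
- exact: key.
- by rewrite !dii !fii.
Qed.

Lemma D_comm nu mu f p : smooth f -> D nu (D mu f) p = D mu (D nu f) p.
Proof.
move=> sf; rewrite (Dconn_form nu) (Dconn_form mu) !Dconn_form.
rewrite (is_pdVE (is_pdM_D nu mu p sf)) (is_pdVE (is_pdM_D mu nu p sf)).
rewrite (pdV_comm nu mu p sf).
have := congr1 (mulmx^~ (f p)) (form_flat nu mu p); rewrite /= !mulmxDl !mulmxDr !mulmxA.
move: (dform nu mu *m f p) (dform mu nu *m f p) (form nu p *m form mu p *m f p)
  (form mu p *m form nu p *m f p) (form mu p *m pdV nu f p) (form nu p *m pdV mu f p)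
  (pdV mu (pdV nu f) p) => a b e g k l x h.
have -> : x + (a + k) + (l + e) = x + ((a + e) + (k + l)).
  by apply/matrixP => y z; rewrite !mxE; ring.
by rewrite h; apply/matrixP => y z; rewrite !mxE; ring.
Qed.

Lemma D_along mu Y f p : smooth Y -> smooth f -> D mu (along D Y f) p =
  \sum_nu (pdV mu Y p nu 0 *: D nu f p + Y p nu 0 *: D mu (D nu f) p).
Proof.
move=> sY sf; rewrite Dconn_form.
have h : is_pdM mu (along D Y f) p (\sum_nu (pdV mu Y p nu 0 *: D nu f p +
    Y p nu 0 *: pdV mu (D nu f) p)).
  apply: is_pdM_sum => nu _; apply: is_pdM_scale; first exact: smooth_is_pdM.
  by rewrite (is_pdVE (is_pdM_D mu nu p sf)); exact: is_pdM_D.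
rewrite (is_pdVE h) /along mulmx_sumr -big_split; apply: eq_bigr => nu _ /=.
by rewrite (Dconn_form mu (D nu f) p) -scalemxAr -addrA -scalerDr.
Qed.

(** The operators D_mu commute, so the second order terms of the curvature cancel
    and the first order terms are D along the commutator of the fields. *)
Lemma D_flat : flat D.
Proof.
move=> X Y f sX sY sf p; rewrite /curvature.
have dbl (V W : vfield R) : smooth W -> along D V (along D W f) p =
    \sum_nu (\sum_mu V p mu 0 * pdV mu W p nu 0) *: D nu f p +
    \sum_mu \sum_nu (V p mu 0 * W p nu 0) *: D mu (D nu f) p.
  move=> sW; transitivity (\sum_mu (\sum_nu (V p mu 0 * pdV mu W p nu 0) *: D nu f p +
     \sum_nu (V p mu 0 * W p nu 0) *: D mu (D nu f) p)).
    apply: eq_bigr => mu _; rewrite D_along // scaler_sumr -big_split; apply: eq_bigr => nu _ /=.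
    by move: (D mu (D nu f) p) (D nu f p) => z w; rewrite scalerDr !scalerA.
  rewrite big_split; congr (_ + _); rewrite [LHS]exchange_big; apply: eq_bigr => nu _ /=.
  by rewrite scaler_suml.
rewrite (dbl X Y) // (dbl Y X) //.
have -> : \sum_mu \sum_nu (Y p mu 0 * X p nu 0) *: D mu (D nu f) p =
    \sum_mu \sum_nu (X p mu 0 * Y p nu 0) *: D mu (D nu f) p.
  rewrite [LHS]exchange_big; apply: eq_bigr => nu _; apply: eq_bigr => mu _.
  by rewrite D_comm // mulrC.
have -> : along D (lie_bracket X Y) f p =
    \sum_nu (\sum_mu X p mu 0 * pdV mu Y p nu 0) *: D nu f p -
    \sum_nu (\sum_mu Y p mu 0 * pdV mu X p nu 0) *: D nu f p.
  rewrite -sumrB /along; apply: eq_bigr => nu _; rewrite -scalerBl lie_bracketE sumrB.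
  by [].
move: (\sum_nu _) (\sum_nu _) (\sum_mu _) => a b e.
by apply/matrixP => y z; rewrite !mxE; ring.
Qed.

End Flatness.

Section NonFlat.
Variable R : realType.
Local Notation C := R[i].
Variables ap am ap' am' : R.
Variable gamma : gammas R.
Hypothesis hgamma : clifford_rep gamma.
Local Notation lam := (lambda ap am ap').
Local Notation cb := (cbar ap am gamma).
Local Notation dm := (dd ap' am' gamma).
Local Notation sc := (scd ap am ap' am' gamma).
Local Notation D := (Dconn ap am ap' am' gamma).
Local Notation nu := (nu ap am ap' am').

(** On the X^+ part of v the obstruction vanishes, as nu(false,i) = i lambda_i. *)
Lemma obstruction_split i (v : 'cV[C]_16) :
  cb *m (sc i *m v) - sc i *m (dm *m v) + lam i ^+ 2 *: (gamma i *m v) =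
  (nu true i ^+ 2 - nu false i ^+ 2)%:C *: (gamma i *m (Xm gamma *m v)).
Proof.
have v01 : v = Xp gamma *m v + Xm gamma *m v.
  by rewrite -mulmxDl Xp_proj Xm_proj [_ + _](proj_sum (Q1234 gamma)) mul1mx.
have h0 := obstruction_act ap am ap' am' hgamma i (_ : _ = (-1) ^+ false *: (Xp gamma *m v)).
have h1 := obstruction_act ap am ap' am' hgamma i (Q_Xm hgamma v).
have Q0 : Q1234 gamma *m (Xp gamma *m v) = (-1) ^+ false *: (Xp gamma *m v).
  by rewrite Xp_proj; apply: proj_eigen; exact: Q1234_sq.
have {}h0 := h0 Q0.
rewrite [in LHS]v01 (lambda_sq ap am ap' am') rmorphB /=.
move: (Xp gamma *m v) (Xm gamma *m v) h0 h1 => v0 v1.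
move: cb dm (sc i) => c d s h0 h1.
rewrite !mulmxDr [X in _ + X = _]scalerDr opprD [X in X + _ = _]addrACA h0 h1.
move: (gamma i *m v0) (gamma i *m v1) => x y.
by apply/matrixP => k l; rewrite !mxE; ring.
Qed.

Lemma nonflat_nu : ~ flat D -> exists i, nu true i ^+ 2 != nu false i ^+ 2.
Proof.
move=> nf; case: (boolP [exists i, nu true i ^+ 2 != nu false i ^+ 2]) => [/existsP //|/existsPn h].
case: nf; apply: D_flat => i.
have e : nu true i ^+ 2 - nu false i ^+ 2 = 0 by have /negPn/eqP -> := h i; rewrite subrr.
apply/matrixP => k l.
have := obstruction_split i (delta_mx l 0); rewrite e scale0r.
move: cb dm (sc i) => c d s.
rewrite !mulmxA scalemxAl -mulmxBl -mulmxDl => /matrixP /(_ k 0).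
by rewrite -colE !mxE.
Qed.

(** A single index with a nonzero factor suffices, because gamma_i is invertible. *)
Lemma nonflat_Xm f : ~ flat D -> parallel D f -> Xm gamma *m dsubmx (f 0) = 0.
Proof.
move=> /nonflat_nu[i nz] hf; have := par_obstruction hf i 0.
rewrite obstruction_split => /eqP; rewrite scaler_eq0 => /orP[|/eqP h].
  by rewrite (fmorph_eq0 (real_complex R)) subr_eq0 (negPf nz).
have := congr1 (mulmx (gamma i)) h; rewrite mulmxA mulmx0 mulmxE (gamma_sq hgamma i).
by rewrite mulNmx mul1mx => /eqP; rewrite oppr_eq0 => /eqP.
Qed.

End NonFlat.

(** * The charge conjugation form *)

Section ChargeConjugation.
Variable R : realType.
Local Notation C := R[i].
Variables ap am ap' am' : R.
Variable gamma : gammas R.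
Variable CV : 'cV[C]_16 -> 'cV[C]_16 -> C.
Hypothesis hgamma : clifford_rep gamma.
Hypothesis hCV : charge_conjugation gamma CV.
Local Notation lam := (lambda ap am ap').
Local Notation cb := (cbar ap am gamma).
Local Notation dm := (dd ap' am' gamma).
Local Notation sc := (scd ap am ap' am' gamma).
Local Notation Q := (Q1234 gamma).
Local Notation T := (T125 gamma).
Local Notation sq2 := (Num.sqrt 2 : R)%:C.
Local Notation act1 := (act_minus ap am ap' am' gamma).
Local Notation act2 := (act_plus ap' am' gamma).
Implicit Types (u v w x y : 'cV[C]_16) (i j k : 'I_9) (th : kdata R) (A : 'M[C]_16).

Lemma CVDl u w v : CV (u + w) v = CV u v + CV w v.
Proof. by have := cc_linear_l hCV v 1 u w; rewrite scale1r mul1r. Qed.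
Lemma CVDr u v w : CV u (v + w) = CV u v + CV u w.
Proof. by have := cc_linear_r hCV u 1 v w; rewrite scale1r mul1r. Qed.
Lemma CV0r u : CV u 0 = 0.
Proof.
by have /eqP := CVDr u 0 0; rewrite addr0 -subr_eq0 opprD addNKr oppr_eq0 => /eqP.
Qed.
Lemma CVZr a u v : CV u (a *: v) = a * CV u v.
Proof. by rewrite -[a *: v]addr0 (cc_linear_r hCV) CV0r addr0. Qed.
Lemma CV_sym u v : CV u v = CV v u. Proof. exact: (cc_sym hCV). Qed.
Lemma CVZl a u v : CV (a *: u) v = a * CV u v.
Proof. by rewrite CV_sym CVZr CV_sym. Qed.
Lemma CVNr u v : CV u (- v) = - CV u v.
Proof. by rewrite -scaleN1r CVZr mulN1r. Qed.
Lemma CVNl u v : CV (- u) v = - CV u v.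
Proof. by rewrite -scaleN1r CVZl mulN1r. Qed.
Lemma CVBr u v w : CV u (v - w) = CV u v - CV u w.
Proof. by rewrite CVDr CVNr. Qed.
Lemma CV_sumr (I : Type) (r : seq I) (F : I -> 'cV[C]_16) u :
  CV u (\sum_(i <- r) F i) = \sum_(i <- r) CV u (F i).
Proof.
elim: r => [|i r IH]; first by rewrite !big_nil CV0r.
by rewrite !big_cons CVDr IH.
Qed.
Lemma CV_suml (I : Type) (r : seq I) (F : I -> 'cV[C]_16) u :
  CV (\sum_(i <- r) F i) u = \sum_(i <- r) CV (F i) u.
Proof. by rewrite CV_sym CV_sumr; apply: eq_bigr => i _; exact: CV_sym. Qed.

Lemma CV_gamma i u v : CV (gamma i *m u) v = CV u (gamma i *m v).
Proof. exact: (cc_gamma hCV). Qed.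

(** The generators are symmetric, so transposition reverses a product. *)
Lemma CV_blade s u v : CV (blade gamma s *m u) v = CV u (blade gamma (rev s) *m v).
Proof.
elim: s u v => [|k s IH] u v.
  by rewrite /blade !big_nil !mul1mx.
have e1 : blade gamma (k :: s) *m u = gamma k *m (blade gamma s *m u).
  by rewrite blade_cons -mulmxE mulmxA.
have e2 : blade gamma (rev (k :: s)) *m v = blade gamma (rev s) *m (gamma k *m v).
  by rewrite rev_cons /blade -cats1 big_cat big_seq1 /= -mulmxE mulmxA.
by rewrite e1 e2 CV_gamma IH.
Qed.

(** Reversing three anticommuting factors costs the sign -1. *)
Lemma CV_T u v : CV (T *m u) v = - CV u (T *m v).
Proof.
rewrite T125E CV_blade (blade_rev hgamma) ?uniq_labs //=.
by rewrite -signr_odd /= expr1 scaleN1r mulNmx CVNr.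
Qed.

Lemma CV_Q u v : CV (Q *m u) v = CV u (Q *m v).
Proof.
rewrite Q1234E CV_blade (blade_rev hgamma) ?uniq_labs //=.
by rewrite -signr_odd /= expr0 scale1r.
Qed.

Lemma CV_proj b u v : CV (proj Q b *m u) v = CV u (proj Q b *m v).
Proof.
have e w : proj Q b *m w = 2^-1 *: (w + (-1) ^+ b *: (Q *m w)).
  by rewrite /proj -scalemxAl mulmxDl mul1mx -scalemxAl.
by rewrite !e CVZl CVZr CVDl CVDr CVZl CVZr CV_Q.
Qed.

Lemma CV_twoparam (r0 r1 : R) u v :
  CV (twoparam gamma r0 r1 *m u) v = - CV u (twoparam gamma r0 r1 *m v).
Proof.
have PT b : T *m proj Q b = proj Q b *m T.
  by have := proj_comm b (TQ_comm hgamma); rewrite -!mulmxE.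
rewrite /twoparam /split_mul -mulmxE.
move: (CV_proj false) (CV_proj true) CV_T (PT false) (PT true).
move: (proj Q false) (proj Q true) T => P0 P1 t h0 h1 ht c0 c1.
have e w : (r0%:C *: P0 + r1%:C *: P1) *m t *m w = r0%:C *: (P0 *m (t *m w)) + r1%:C *: (P1 *m (t *m w)).
  by rewrite -mulmxA mulmxDl -!scalemxAl.
rewrite !e CVDl !CVZl h0 h1 !ht CVDr !CVZr [t *m (P0 *m _)]mulmxA c0 [t *m (P1 *m _)]mulmxA c1.
by rewrite -!mulmxA; ring.
Qed.

Lemma CV_cbar u v : CV (cb *m u) v = - CV u (cb *m v).
Proof. by rewrite cbarE CV_twoparam. Qed.

Lemma CV_dd u v : CV (dm *m u) v = - CV u (dm *m v).
Proof. by rewrite ddE CV_twoparam. Qed.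

Lemma CV_spin S u v : rotation S -> CV (spin gamma S *m u) v = - CV u (spin gamma S *m v).
Proof.
move=> [anti _].
have e w : spin gamma S *m w = 4^-1 *: \sum_i \sum_j S i j *: (gamma i *m (gamma j *m w)).
  rewrite /spin -scalemxAl mulmx_suml; congr (_ *: _); apply: eq_bigr => i _.
  rewrite mulmx_suml; apply: eq_bigr => j _.
  by rewrite -scalemxAl -mulmxE mulmxA.
rewrite !e CVZl CVZr -mulrN CV_suml CV_sumr; congr (_ * _).
under eq_bigr => i _ do rewrite CV_suml.
under [in RHS]eq_bigr => i _ do rewrite CV_sumr.
rewrite exchange_big -sumrN; apply: eq_bigr => i _; rewrite -sumrN; apply: eq_bigr => j _.
by rewrite CVZl CVZr !CV_gamma (anti i j) mulNr.
Qed.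

Lemma CV_act2 th u v : rotation (kr th) -> CV (act2 th u) v = - CV u (act2 th v).
Proof.
move=> hr; rewrite /act_plus CVDl CVNl CVZl CV_dd CV_spin // CVBr CVZr; ring.
Qed.

(** Q is symmetric, so its two eigenspaces are orthogonal. *)
Lemma Q_orthogonal u v : Q *m u = u -> Q *m v = - v -> CV u v = 0.
Proof.
move=> Qu Qv; have : CV u v = - CV u v by rewrite -{1}Qu CV_Q Qv CVNr.
by move=> /eqP; rewrite -addr_eq0 -mulr2n mulrn_eq0 => /eqP.
Qed.

Lemma scd_T i u : Q *m u = u -> sc i *m u = ('i * lam i) *: (T *m (gamma i *m u)).
Proof.
move=> Qu; rewrite (i_lambda ap am ap' am').
by apply: scd_act => //; rewrite expr0 scale1r.
Qed.

Definition pair_g i u v : C := CV u (gamma i *m v).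
Definition pair_Tg i u v : C := CV u (T *m (gamma i *m v)).
Definition pair_gTg i j u v : C := CV u (gamma i *m (T *m (gamma j *m v))).

Lemma CV_act1 th x1 x2 v : rotation (kr th) -> Q *m x2 = x2 ->
  CV (act1 th x1 x2) v = - (km th * CV x1 (cb *m v)) + CV x1 (spin gamma (kr th) *m v)
   + sq2^-1 * \sum_k (kb th k * lam k ^+ 2 * CV x2 (gamma k *m v)
                      + ka th k * ('i * lam k) * CV x2 (gamma k *m (T *m v))).
Proof.
move=> hr Qx; rewrite /act_minus !CVDl CVNl !CVZl CV_cbar CV_spin // CV_suml opprK.
rewrite mulrN; congr (_ + _ * _); apply: eq_bigr => k _.
rewrite CVDl CVNl !CVZl CV_gamma scd_T // CVZl CV_T CV_gamma; ring.
Qed.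

(** Since s(e_i) = cbar gamma_i - gamma_i d acts as a multiple of T gamma_i
    on Q = 1, the field K_- exchanges the pairings [pair_g] and [pair_Tg]; a translation leads to
    pairings of the two second components. *)
Lemma equivariant_cp th i x1 x2 y2 : rotation (kr th) -> Q *m x2 = x2 -> Q *m y2 = y2 ->
  pair_g i (act1 th x1 x2) y2 + pair_g i x1 (act2 th y2) =
  - (km th * ('i * lam i) * pair_Tg i x1 y2) + \sum_j kr th i j * pair_g j x1 y2 +
  sq2^-1 * \sum_k (kb th k * lam k ^+ 2 * CV x2 (gamma k *m (gamma i *m y2))
                   + ka th k * ('i * lam k) * pair_gTg k i x2 y2).
Proof.
move=> hr Qx Qy; rewrite /pair_g CV_act1 //.
have e1 : gamma i *m act2 th y2 = km th *: (gamma i *m (dm *m y2))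
    - gamma i *m (spin gamma (kr th) *m y2).
  by rewrite /act_plus mulmxBr -scalemxAr.
have e2 : cb *m (gamma i *m y2) = ('i * lam i) *: (T *m (gamma i *m y2)) + gamma i *m (dm *m y2).
  by rewrite -scd_T // scd_mul subrK.
have e3 : spin gamma (kr th) *m (gamma i *m y2) =
    \sum_j kr th i j *: (gamma j *m y2) + gamma i *m (spin gamma (kr th) *m y2).
  have h := spin_gamma hgamma i hr.
  apply/eqP; rewrite -subr_eq !mulmxA -mulmxBl !mulmxE h mulmx_suml; apply/eqP.
  by apply: eq_bigr => j _; rewrite scalemxAl.
have f1 := etrans (congr1 (CV x1) e1) (etrans (CVBr _ _ _) (congr1 (+%R^~ _) (CVZr _ _ _))).
have f2 := etrans (congr1 (CV x1) e2) (etrans (CVDr _ _ _) (congr1 (+%R^~ _) (CVZr _ _ _))).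
have sj : CV x1 (\sum_j kr th i j *: (gamma j *m y2)) = \sum_j kr th i j * pair_g j x1 y2.
  by rewrite CV_sumr; apply: eq_bigr => j _; exact: CVZr.
have f3 := etrans (congr1 (CV x1) e3) (etrans (CVDr _ _ _) (congr1 (+%R^~ _) sj)).
have re (m l n g h q z S A B F : C) : F = m * g - h -> A = l * n + g -> B = z + h ->
    - (m * A) + B + q * S + F = - (m * l * n) + z + q * S.
  by move=> -> -> ->; ring.
exact: re f1 f2 f3.
Qed.

Lemma equivariant_cn th i x1 x2 y2 : rotation (kr th) -> Q *m x2 = x2 -> Q *m y2 = y2 ->
  pair_Tg i (act1 th x1 x2) y2 + pair_Tg i x1 (act2 th y2) =
  - (km th * ('i * lam i) * pair_g i x1 y2) + \sum_j kr th i j * pair_Tg j x1 y2 +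
  sq2^-1 * \sum_k (kb th k * lam k ^+ 2 * pair_gTg k i x2 y2
      + ka th k * ('i * lam k) * CV x2 (gamma k *m (gamma i *m y2))).
Proof.
move=> hr Qx Qy; rewrite /pair_Tg CV_act1 //.
have -> : \sum_k (kb th k * lam k ^+ 2 * CV x2 (gamma k *m (T *m (gamma i *m y2)))
      + ka th k * ('i * lam k) * CV x2 (gamma k *m (T *m (T *m (gamma i *m y2))))) =
    \sum_k (kb th k * lam k ^+ 2 * pair_gTg k i x2 y2
      + ka th k * ('i * lam k) * CV x2 (gamma k *m (gamma i *m y2))).
  by apply: eq_bigr => k _; rewrite (TT_act hgamma).
have e1 : T *m (gamma i *m act2 th y2) = km th *: (T *m (gamma i *m (dm *m y2)))
    - T *m (gamma i *m (spin gamma (kr th) *m y2)).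
  by rewrite /act_plus mulmxBr -scalemxAr mulmxBr -scalemxAr.
have cT w : cb *m (T *m w) = T *m (cb *m w).
  have := @twoparam_comm _ gamma ap am T (TQ_comm hgamma) (erefl (T * T)).
  by rewrite -cbarE -!mulmxE !mulmxA => ->.
have ST w : spin gamma (kr th) *m (T *m w) = T *m (spin gamma (kr th) *m w).
  by rewrite !mulmxA !mulmxE (spin_T hgamma hr).
have e2 : cb *m (T *m (gamma i *m y2)) = ('i * lam i) *: (gamma i *m y2)
    + T *m (gamma i *m (dm *m y2)).
  have e : cb *m (gamma i *m y2) = ('i * lam i) *: (T *m (gamma i *m y2)) + gamma i *m (dm *m y2).
    by rewrite -scd_T // scd_mul subrK.
  by rewrite cT e mulmxDr -scalemxAr (TT_act hgamma).
have e3 : spin gamma (kr th) *m (T *m (gamma i *m y2)) =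
    \sum_j kr th i j *: (T *m (gamma j *m y2)) + T *m (gamma i *m (spin gamma (kr th) *m y2)).
  have h := spin_gamma hgamma i hr.
  rewrite ST; have -> : \sum_j kr th i j *: (T *m (gamma j *m y2)) =
    T *m (\sum_j kr th i j *: (gamma j *m y2)).
    by rewrite mulmx_sumr; apply: eq_bigr => j _; rewrite -scalemxAr.
  rewrite -mulmxDr; congr (_ *m _).
  apply/eqP; rewrite -subr_eq !mulmxA -mulmxBl !mulmxE h mulmx_suml; apply/eqP.
  by apply: eq_bigr => j _; rewrite scalemxAl.
have f1 := etrans (congr1 (CV x1) e1) (etrans (CVBr _ _ _) (congr1 (+%R^~ _) (CVZr _ _ _))).
have f2 := etrans (congr1 (CV x1) e2) (etrans (CVDr _ _ _) (congr1 (+%R^~ _) (CVZr _ _ _))).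
have sj : CV x1 (\sum_j kr th i j *: (T *m (gamma j *m y2))) =
    \sum_j kr th i j * pair_Tg j x1 y2.
  by rewrite CV_sumr; apply: eq_bigr => j _; exact: CVZr.
have f3 := etrans (congr1 (CV x1) e3) (etrans (CVDr _ _ _) (congr1 (+%R^~ _) sj)).
have re (m l n g h q z S A B F : C) : F = m * g - h -> A = l * n + g -> B = z + h ->
    - (m * A) + B + q * S + F = - (m * l * n) + z + q * S.
  by move=> -> -> ->; ring.
exact: re f1 f2 f3.
Qed.

End ChargeConjugation.

(** * Coefficients of the odd-odd bracket *)

Section OddBracketData.
Variable R : realType.
Local Notation C := R[i].
Variables ap am ap' am' : R.
Variable gamma : gammas R.
Variable CV : 'cV[C]_16 -> 'cV[C]_16 -> C.
Hypothesis hgamma : clifford_rep gamma.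
Hypothesis hCV : charge_conjugation gamma CV.
Local Notation lam := (lambda ap am ap').
Local Notation cb := (cbar ap am gamma).
Local Notation dm := (dd ap' am' gamma).
Local Notation Q := (Q1234 gamma).
Local Notation T := (T125 gamma).
Local Notation sq2 := (Num.sqrt 2 : R)%:C.
Local Notation act1 := (act_minus ap am ap' am' gamma).
Local Notation act2 := (act_plus ap' am' gamma).
Local Notation cp := (pair_g gamma CV).
Local Notation cn := (pair_Tg gamma CV).
Local Notation cw := (pair_gTg gamma CV).
Implicit Types (u v w x y : 'cV[C]_16) (i j k : 'I_9) (th : kdata R).
Hypothesis lam_neq0 : forall i, lam i != 0.

(** The rotation part of the bracket: skew in the indices and symmetric in the
    spinors ([wedge_anti], [wedgeC]). *)
Definition wedge i j u v : C := cw i j u v - cw j i u v.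

(** The coordinates of the odd-odd bracket, see [odd_bracketE]. *)
Definition bracket_data x1 x2 y1 y2 : kdata R := KData
  ('i * sq2 * CV x2 y2) ('i * sq2 * CV x1 y1)
  (fun i => - 'i * (cp i x1 y2 + cp i y1 x2))
  (fun i => (lam i)^-1 * (cn i x1 y2 + cn i y1 x2))
  (\matrix_(i, j) (lam i / sq2 * wedge i j x2 y2)).

Lemma cwC i j u v : cw i j v u = - cw j i u v.
Proof.
apply: etrans (CV_sym hCV v _) _; apply: etrans (CV_gamma hCV _ _ _) _.
by apply: etrans (CV_T hgamma hCV _ _) _; congr (- _); exact: (CV_gamma hCV).
Qed.

Lemma wedgeC i j u v : wedge i j v u = wedge i j u v.
Proof. by rewrite /wedge (cwC i j u v) (cwC j i u v) opprK addrC. Qed.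

Lemma wedge_anti i j u v : wedge j i u v = - wedge i j u v.
Proof. by rewrite /wedge opprB. Qed.

Lemma gamma_T_act i v : gamma i *m (T *m v) = (-1) ^+ (~~ comm125 i) *: (T *m (gamma i *m v)).
Proof.
have := gamma_T hgamma i; rewrite -!mulmxE; move: T => t e.
by rewrite !mulmxA e -scalemxAl.
Qed.

Lemma gamma_anti_act i j v : gamma i *m (gamma j *m v) =
  - (2 * (i == j)%:R) *: v - gamma j *m (gamma i *m v).
Proof.
have := gamma_comm hgamma i j; rewrite -!mulmxE => e.
by rewrite !mulmxA e mulmxBl scaleNr mulNmx -scalemxAl mul1mx.
Qed.

(** For indices in different blocks, either Q separates the two spinors or T has
    opposite signs past gamma_i and gamma_j and the two terms cancel. *)
Lemma wedge0 i j u v : Q *m u = u -> Q *m v = v -> ~~ rot_pair i j -> wedge i j u v = 0.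
Proof.
move=> Qu Qv nr; have [->|ij] := eqVneq i j; first by rewrite /wedge subrr.
have Qv' : Q *m v = (-1) ^+ false *: v by rewrite expr0 scale1r.
have [ca|ca] := eqVneq (anti1234 i) (anti1234 j); last first.
  have z k l : anti1234 k != anti1234 l -> cw k l u v = 0.
    move=> kl; apply: (Q_orthogonal hgamma hCV) => //.
    rewrite (Q_gamma_act hgamma k (Q_T_act hgamma (Q_gamma_act hgamma l Qv'))).
    by case: (anti1234 k) kl; case: (anti1234 l); rewrite //= expr1 scaleN1r.
  by rewrite /wedge !z ?subrr // eq_sym.
have [cc|cc] := eqVneq (comm125 i) (comm125 j).
  by rewrite (same_rot_pair ij cc ca) in nr.
rewrite /wedge /pair_gTg !gamma_T_act (gamma_anti_act j i) eq_sym (negPf ij) mulr0 oppr0 scale0r sub0r.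
rewrite mulmxN scalerN (CVNr hCV) opprK -(CVDr hCV) -scalerDl.
by case: (comm125 i) cc; case: (comm125 j) => //= _; rewrite expr0 expr1 ?subrr ?addNr scale0r (CV0r hCV).
Qed.

Lemma rot_pair_lam i j : rot_pair i j -> lam i = lam j.
Proof.
move=> /rot_pair_same[h1 h2]; rewrite !(lambda_nu ap am ap' 0).
by rewrite (nu_same ap am ap' h1 h2).
Qed.

Lemma lam_wedge i j u v : Q *m u = u -> Q *m v = v ->
  lam i * wedge i j u v = lam j * wedge i j u v.
Proof.
move=> Qu Qv; case: (boolP (rot_pair i j)) => [/rot_pair_lam -> //|nr].
by rewrite wedge0 // !mulr0.
Qed.

Lemma rotation_bracket_data x1 x2 y1 y2 : Q *m x2 = x2 -> Q *m y2 = y2 ->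
  rotation (kr (bracket_data x1 x2 y1 y2)).
Proof.
move=> Qx Qy; split=> [i j|i j nr]; rewrite !mxE.
  rewrite wedge_anti mulrN; congr (- _).
  by rewrite mulrAC [RHS]mulrAC lam_wedge.
by rewrite wedge0 // mulr0.
Qed.

Lemma Q_act2 th v : rotation (kr th) -> Q *m v = v -> Q *m act2 th v = act2 th v.
Proof.
move=> hr Qv; rewrite /act_plus mulmxBr -scalemxAr.
have e1 : Q *m (dm *m v) = dm *m v.
  by have := Q_dd ap' am' hgamma; rewrite -!mulmxE !mulmxA => ->; rewrite -mulmxA Qv.
have e2 : Q *m (spin gamma (kr th) *m v) = spin gamma (kr th) *m v.
  by have := spin_Q hgamma hr; rewrite -!mulmxE !mulmxA => <-; rewrite -mulmxA Qv.
by rewrite e1 e2.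
Qed.

(** On Q = 1 the map d is a multiple of T, which commutes with
    gamma_i T gamma_j for i and j in one block; so only the rotation contributes. *)
Lemma equivariant_cw th i j x2 y2 : Q *m x2 = x2 -> Q *m y2 = y2 -> rotation (kr th) ->
  rot_pair i j -> cw i j (act2 th x2) y2 + cw i j x2 (act2 th y2) =
  \sum_k kr th i k * cw k j x2 y2 + \sum_k kr th j k * cw i k x2 y2.
Proof.
move=> Qx Qy hr /rot_pair_same[hc ha].
have dT v : Q *m v = v -> dm *m v = ap'%:C *: (T *m v).
  by move=> Qv; apply: (dd_act ap' am' hgamma (b := false)); rewrite expr0 scale1r.
have Sg k w : spin gamma (kr th) *m (gamma k *m w) =
    \sum_j kr th k j *: (gamma j *m w) + gamma k *m (spin gamma (kr th) *m w).
  have h := spin_gamma hgamma k hr.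
  apply/eqP; rewrite -subr_eq !mulmxA -mulmxBl !mulmxE h mulmx_suml; apply/eqP.
  by apply: eq_bigr => l _; rewrite scalemxAl.
have ST w : spin gamma (kr th) *m (T *m w) = T *m (spin gamma (kr th) *m w).
  by rewrite !mulmxA !mulmxE (spin_T hgamma hr).
have nT w : T *m (gamma i *m (T *m (gamma j *m w))) = gamma i *m (T *m (gamma j *m (T *m w))).
  rewrite (T_gamma_T hgamma) (gamma_T_act j) -!scalemxAr (TT_act hgamma) hc.
  by [].
rewrite /pair_gTg; apply: etrans (congr1 (fun z => z + _) (CV_act2 ap' am' hgamma hCV x2 _ hr)) _.
rewrite /act_plus (dT _ Qy).
have Qn : Q *m (gamma i *m (T *m (gamma j *m y2))) = gamma i *m (T *m (gamma j *m y2)).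
  have Qy' : Q *m y2 = (-1) ^+ false *: y2 by rewrite expr0 scale1r.
  have := Q_gamma_act hgamma i (Q_T_act hgamma (Q_gamma_act hgamma j Qy')).
  by rewrite addFb ha addbb expr0 scale1r.
rewrite (dT _ Qn) nT {dT Qn nT}.
rewrite [spin gamma (kr th) *m (gamma i *m _)]Sg ST Sg.
have E1 : CV x2 (\sum_k kr th i k *: (gamma k *m (T *m (gamma j *m y2)))) =
    \sum_k kr th i k * cw k j x2 y2.
  by apply: etrans (CV_sumr hCV _ _ _) _; apply: eq_bigr => k _; exact: (CVZr hCV).
have E2 : CV x2 (gamma i *m (T *m \sum_k kr th j k *: (gamma k *m y2))) =
    \sum_k kr th j k * cw i k x2 y2.
  have -> : gamma i *m (T *m \sum_k kr th j k *: (gamma k *m y2)) =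
      \sum_k kr th j k *: (gamma i *m (T *m (gamma k *m y2))).
    by rewrite !mulmx_sumr; apply: eq_bigr => k _; rewrite -!scalemxAr.
  by apply: etrans (CV_sumr hCV _ _ _) _; apply: eq_bigr => k _; exact: (CVZr hCV).
rewrite -E1 -E2; move: (spin gamma (kr th) *m y2) => w.
move: (\sum_k kr th i k *: _) (\sum_k kr th j k *: _) => z1 z2.
rewrite !(mulmxBr, mulmxDr) -!scalemxAr.
by rewrite !(CVBr hCV, CVDr hCV, CVZr hCV); ring.
Qed.

Section Equivariance.
Variables (th : kdata R) (x1 x2 y1 y2 : 'cV[C]_16).
Hypotheses (hr : rotation (kr th)) (Qx : Q *m x2 = x2) (Qy : Q *m y2 = y2).
Local Notation B := (bracket_data x1 x2 y1 y2).
Local Notation Bx := (bracket_data (act1 th x1 x2) (act2 th x2) y1 y2).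
Local Notation By := (bracket_data x1 x2 (act1 th y1 y2) (act2 th y2)).

Lemma equivariant_m : km Bx + km By = 0.
Proof. by rewrite /= (CV_act2 ap' am' hgamma hCV _ _ hr) mulrN addNr. Qed.

(** Transposing the operators in C_V moves the translation part onto the second
    components, where it meets the coefficients of K_i and K_i^*. *)
Lemma equivariant_c : kc Bx + kc By =
  \sum_i lam i ^+ 2 * (ka th i * kb B i - ka B i * kb th i).
Proof.
have a1 := CV_act1 ap am ap' am' hgamma hCV x1 y1 hr Qx.
have a2 := etrans (CV_sym hCV x1 _) (CV_act1 ap am ap' am' hgamma hCV y1 x1 hr Qy).
transitivity ('i * sq2 * (CV (act1 th x1 x2) y1 + CV x1 (act1 th y1 y2))).
  by rewrite /= mulrDr.
rewrite a1 a2 {a1 a2}.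
have e1 : CV y1 (cb *m x1) = - CV x1 (cb *m y1).
  by apply: etrans (CV_sym hCV _ _) (CV_cbar ap am hgamma hCV x1 y1).
have e2 : CV y1 (spin gamma (kr th) *m x1) = - CV x1 (spin gamma (kr th) *m y1).
  by apply: etrans (CV_sym hCV _ _) (CV_spin hCV x1 y1 hr).
rewrite e1 e2.
have f1 k u v : CV u (gamma k *m v) = cp k v u.
  by apply: etrans (esym (CV_gamma hCV k u v)) (CV_sym hCV _ _).
have f2 k u v : CV u (gamma k *m (T *m v)) = - cn k v u.
  apply: etrans (esym (CV_gamma hCV k u _)) _; apply: etrans (CV_sym hCV _ _) _.
  exact: (CV_T hgamma hCV).
under eq_bigr => k _ do rewrite f1 f2.
under [X in _ * (_ + (_ + _ * X)) = _]eq_bigr => k _ do rewrite f1 f2.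
move: (CV x1 _) (CV x1 _) => z1 z2.
transitivity ('i * \sum_i (kb th i * lam i ^+ 2 * (cp i x1 y2 + cp i y1 x2)
     - ka th i * ('i * lam i) * (cn i x1 y2 + cn i y1 x2))).
  rewrite -[in RHS](eq_bigr _ (fun k _ => erefl)).
  have -> : \sum_i (kb th i * lam i ^+ 2 * (cp i x1 y2 + cp i y1 x2)
     - ka th i * ('i * lam i) * (cn i x1 y2 + cn i y1 x2)) =
    \sum_k (kb th k * lam k ^+ 2 * cp k y1 x2 + ka th k * ('i * lam k) * - cn k y1 x2) +
    \sum_k (kb th k * lam k ^+ 2 * cp k x1 y2 + ka th k * ('i * lam k) * - cn k x1 y2).
    by rewrite -big_split; apply: eq_bigr => k _ /=; ring.
  have s0 := sq2_neq0 R; move: (\sum_k _) (\sum_k _) => a b; by field.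
rewrite mulr_sumr; apply: eq_bigr => i _.
have i2 : 'i * 'i = -1 :> C by rewrite -expr2 sqrCi.
transitivity ('i * (kb th i * lam i ^+ 2 * (cp i x1 y2 + cp i y1 x2)) -
  ('i * 'i) * (ka th i * lam i * (cn i x1 y2 + cn i y1 x2))); first by ring.
by rewrite i2 /=; have l0 := lam_neq0 i; field.
Qed.

(** The translation part is symmetrized in the two spinors: there the Clifford
    relation leaves only the pairing C_V(x2, y2), and the rest is [wedge]. *)
Lemma equivariant_a i : ka Bx i + ka By i =
  - (lam i ^+ 2 * (km th * kb B i - km B * kb th i))
  + \sum_k (ka th k * kr B k i - ka B k * kr th k i).
Proof.
have [anti _] := hr.
have h1 := equivariant_cp ap am ap' am' hgamma hCV i x1 hr Qx Qy.
have h2 := equivariant_cp ap am ap' am' hgamma hCV i y1 hr Qy Qx.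
have i2 : 'i * 'i = -1 :> C by rewrite -expr2 sqrCi.
transitivity (- 'i * ((cp i (act1 th x1 x2) y2 + cp i x1 (act2 th y2)) +
   (cp i (act1 th y1 y2) x2 + cp i y1 (act2 th x2)))); first by rewrite /=; ring.
rewrite h1 h2 {h1 h2} /=.
have g1 k : CV x2 (gamma k *m (gamma i *m y2)) + CV y2 (gamma k *m (gamma i *m x2)) =
    - (2 * (k == i)%:R) * CV x2 y2.
  rewrite (CV_sym hCV y2) !(CV_gamma hCV) -(CVDr hCV) (gamma_anti_act k i) subrK.
  by rewrite (CVZr hCV).
have g2 k : cw k i x2 y2 + cw k i y2 x2 = wedge k i x2 y2 by rewrite (cwC k i x2 y2).
transitivity (- 'i * (- (km th * ('i * lam i) * (cn i x1 y2 + cn i y1 x2)) +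
   \sum_j kr th i j * (cp j x1 y2 + cp j y1 x2) + sq2^-1 *
   \sum_k (kb th k * lam k ^+ 2 * (- (2 * (k == i)%:R) * CV x2 y2) +
           ka th k * ('i * lam k) * wedge k i x2 y2))).
  have -> : \sum_j kr th i j * (cp j x1 y2 + cp j y1 x2) =
    \sum_j kr th i j * cp j x1 y2 + \sum_j kr th i j * cp j y1 x2.
    by rewrite -big_split; apply: eq_bigr => j _; rewrite mulrDr.
  have -> : \sum_k (kb th k * lam k ^+ 2 * (- (2 * (k == i)%:R) * CV x2 y2) +
           ka th k * ('i * lam k) * wedge k i x2 y2) =
     \sum_k (kb th k * lam k ^+ 2 * CV x2 (gamma k *m (gamma i *m y2)) +
           ka th k * ('i * lam k) * cw k i x2 y2) +
     \sum_k (kb th k * lam k ^+ 2 * CV y2 (gamma k *m (gamma i *m x2)) +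
           ka th k * ('i * lam k) * cw k i y2 x2).
    by rewrite -big_split; apply: eq_bigr => k _ /=; rewrite -g1 -g2; ring.
  by ring.
have -> : \sum_k (kb th k * lam k ^+ 2 * (- (2 * (k == i)%:R) * CV x2 y2) +
           ka th k * ('i * lam k) * wedge k i x2 y2) =
    - 2 * kb th i * lam i ^+ 2 * CV x2 y2 + 'i * \sum_k ka th k * lam k * wedge k i x2 y2.
  rewrite big_split /=; congr (_ + _); last by rewrite mulr_sumr; apply: eq_bigr => k _; ring.
  rewrite (bigD1 i) //= big1 ?addr0 => [|k ki]; first by rewrite eqxx mulr1; ring.
  by rewrite (negPf ki) mulr0 oppr0 mul0r mulr0.
have -> : \sum_k (ka th k * (\matrix_(i0, j) (lam i0 / sq2 * wedge i0 j x2 y2)) k i -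
     - 'i * (cp k x1 y2 + cp k y1 x2) * kr th k i) =
   sq2^-1 * (\sum_k ka th k * lam k * wedge k i x2 y2) -
   'i * (\sum_j kr th i j * (cp j x1 y2 + cp j y1 x2)).
  rewrite !mulr_sumr -sumrB; apply: eq_bigr => k _; rewrite mxE (anti k i); ring.
move: (\sum_k _) (\sum_j _) => a b.
have s2' : sq2 * sq2 = 2 :> C := sq2_sq R.
have := sq2_neq0 R; move: (sq2) s2' => s s2' s0.
have l0 := lam_neq0 i.
transitivity (('i * 'i) * (km th * lam i * (cn i x1 y2 + cn i y1 x2)) - 'i * b
   - s^-1 * (('i * 'i) * a) + 'i * s^-1 * 2 * kb th i * lam i ^+ 2 * CV x2 y2); first by ring.
by rewrite i2 -s2'; field; rewrite s0 l0.
Qed.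

Lemma equivariant_b i : kb Bx i + kb By i =
  km th * ka B i - km B * ka th i + \sum_k (kb th k * kr B k i - kb B k * kr th k i).
Proof.
have [anti _] := hr; have l0 := lam_neq0 i.
have h1 := equivariant_cn ap am ap' am' hgamma hCV i x1 hr Qx Qy.
have h2 := equivariant_cn ap am ap' am' hgamma hCV i y1 hr Qy Qx.
have i2 : 'i * 'i = -1 :> C by rewrite -expr2 sqrCi.
transitivity ((lam i)^-1 * ((cn i (act1 th x1 x2) y2 + cn i x1 (act2 th y2)) +
   (cn i (act1 th y1 y2) x2 + cn i y1 (act2 th x2)))); first by rewrite /=; ring.
rewrite h1 h2 {h1 h2} /=.
have g1 k : CV x2 (gamma k *m (gamma i *m y2)) + CV y2 (gamma k *m (gamma i *m x2)) =
    - (2 * (k == i)%:R) * CV x2 y2.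
  rewrite (CV_sym hCV y2) !(CV_gamma hCV) -(CVDr hCV) (gamma_anti_act k i) subrK.
  by rewrite (CVZr hCV).
have g2 k : cw k i x2 y2 + cw k i y2 x2 = wedge k i x2 y2 by rewrite (cwC k i x2 y2).
transitivity ((lam i)^-1 * (- (km th * ('i * lam i) * (cp i x1 y2 + cp i y1 x2)) +
   \sum_j kr th i j * (cn j x1 y2 + cn j y1 x2) + sq2^-1 *
   \sum_k (kb th k * lam k ^+ 2 * wedge k i x2 y2 +
           ka th k * ('i * lam k) * (- (2 * (k == i)%:R) * CV x2 y2)))).
  have -> : \sum_j kr th i j * (cn j x1 y2 + cn j y1 x2) =
    \sum_j kr th i j * cn j x1 y2 + \sum_j kr th i j * cn j y1 x2.
    by rewrite -big_split; apply: eq_bigr => j _; rewrite mulrDr.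
  have -> : \sum_k (kb th k * lam k ^+ 2 * wedge k i x2 y2 +
           ka th k * ('i * lam k) * (- (2 * (k == i)%:R) * CV x2 y2)) =
     \sum_k (kb th k * lam k ^+ 2 * cw k i x2 y2 +
           ka th k * ('i * lam k) * CV x2 (gamma k *m (gamma i *m y2))) +
     \sum_k (kb th k * lam k ^+ 2 * cw k i y2 x2 +
           ka th k * ('i * lam k) * CV y2 (gamma k *m (gamma i *m x2))).
    by rewrite -big_split; apply: eq_bigr => k _ /=; rewrite -g1 -g2; ring.
  by ring.
have -> : \sum_k (kb th k * lam k ^+ 2 * wedge k i x2 y2 +
           ka th k * ('i * lam k) * (- (2 * (k == i)%:R) * CV x2 y2)) =
    lam i * (\sum_k kb th k * lam k * wedge k i x2 y2) - 2 * ka th i * ('i * lam i) * CV x2 y2.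
  rewrite big_split /=; congr (_ + _).
    rewrite mulr_sumr; apply: eq_bigr => k _.
    have lw := lam_wedge k i Qx Qy.
    transitivity (kb th k * lam k * (lam k * wedge k i x2 y2)); first by ring.
    by rewrite lw; ring.
  rewrite (bigD1 i) //= big1 ?addr0 => [|k ki]; first by rewrite eqxx mulr1; ring.
  by rewrite (negPf ki) mulr0 oppr0 mul0r mulr0.
have -> : \sum_j kr th i j * (cn j x1 y2 + cn j y1 x2) =
    lam i * \sum_k (lam k)^-1 * (cn k x1 y2 + cn k y1 x2) * kr th i k.
  rewrite mulr_sumr; apply: eq_bigr => k _.
  have rl := rotation_lambda ap am ap' am' i k hr; have lk := lam_neq0 k.
  transitivity ((kr th i k * lam i) * ((lam k)^-1 * (cn k x1 y2 + cn k y1 x2))); last by ring.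
  by rewrite rl; field.
have -> : \sum_k (kb th k * (\matrix_(i0, j) (lam i0 / sq2 * wedge i0 j x2 y2)) k i -
     (lam k)^-1 * (cn k x1 y2 + cn k y1 x2) * kr th k i) =
   sq2^-1 * (\sum_k kb th k * lam k * wedge k i x2 y2) +
   \sum_k (lam k)^-1 * (cn k x1 y2 + cn k y1 x2) * kr th i k.
  rewrite !mulr_sumr -big_split; apply: eq_bigr => k _; rewrite mxE (anti i k) /=; ring.
move: (\sum_k _) (\sum_k _) => a b.
have s2' : sq2 * sq2 = 2 :> C := sq2_sq R.
have := sq2_neq0 R; move: (sq2) s2' => s s2' s0.
by rewrite -s2'; field; rewrite s0 l0.
Qed.

(** Off the blocks both sides vanish; on a block lambda is constant and
    [equivariant_cw] applies to both terms of [wedge]. *)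
Lemma equivariant_r : kr Bx + kr By = kr th *m kr B - kr B *m kr th.
Proof.
have rB := rotation_bracket_data x1 y1 Qx Qy.
have rBx := rotation_bracket_data (act1 th x1 x2) y1 (Q_act2 hr Qx) Qy.
have rBy := rotation_bracket_data x1 (act1 th y1 y2) Qx (Q_act2 hr Qy).
have [anti _] := hr.
have rS := rotation_comm hr rB.
apply/matrixP => i j; case: (boolP (rot_pair i j)) => [hij|nij]; last first.
  have [_ zx] := rBx; have [_ zy] := rBy; have [_ zS] := rS.
  transitivity (kr Bx i j + kr By i j); first exact: mxE.
  apply: etrans _ (esym (zS _ _ nij)).
  exact: etrans (congr2 +%R (zx _ _ nij) (zy _ _ nij)) (addr0 0).
transitivity (lam i / sq2 * (wedge i j (act2 th x2) y2 + wedge i j x2 (act2 th y2))).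
  transitivity (kr Bx i j + kr By i j); first exact: mxE.
  by rewrite mulrDr; congr (_ + _); exact: mxE.
have e1 := equivariant_cw Qx Qy hr hij.
have e2 := equivariant_cw Qx Qy hr (etrans (rot_pair_sym j i) hij).
transitivity (lam i / sq2 * (\sum_k kr th i k * wedge k j x2 y2 + \sum_k kr th j k * wedge i k x2 y2)).
  congr (_ * _).
  transitivity ((cw i j (act2 th x2) y2 + cw i j x2 (act2 th y2)) -
     (cw j i (act2 th x2) y2 + cw j i x2 (act2 th y2))).
    by rewrite /wedge [LHS]addrACA -opprD.
  have w1 : \sum_k kr th i k * wedge k j x2 y2 =
      \sum_k kr th i k * cw k j x2 y2 - \sum_k kr th i k * cw j k x2 y2.
    by rewrite -sumrB; apply: eq_bigr => k _; rewrite -mulrBr.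
  have w2 : \sum_k kr th j k * wedge i k x2 y2 =
      \sum_k kr th j k * cw i k x2 y2 - \sum_k kr th j k * cw k i x2 y2.
    by rewrite -sumrB; apply: eq_bigr => k _; rewrite -mulrBr.
  apply: etrans (congr2 (fun a b => a - b) e1 e2) _.
  apply: etrans _ (esym (congr2 +%R w1 w2)).
  have re (a b c d : C) : a + b - (c + d) = a - d + (b - c) by ring.
  exact: re.
have BE k l : kr B k l = lam k / sq2 * wedge k l x2 y2 by exact: mxE.
transitivity (\sum_k kr th i k * kr B k j - \sum_k kr B i k * kr th k j); last first.
  apply/esym; apply: etrans (mxE _ _ _ _) _; congr (_ + _); first exact: mxE.
  by apply: etrans (mxE _ _ _ _) _; congr (- _); exact: mxE.
apply: etrans (mulrDr _ _ _) _; congr (_ + _); apply: etrans (mulr_sumr _ _ _ _) _.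
  apply: eq_bigr => k _; have rl := rotation_lambda ap am ap' am' i k hr.
  apply: etrans _ (esym (congr1 (fun z => kr th i k * z) (BE k j))).
  by transitivity (kr th i k * lam i / sq2 * wedge k j x2 y2); [ring|rewrite rl; ring].
apply: etrans _ (sumrN _ _ _); apply: eq_bigr => k _.
apply: etrans _ (esym (congr1 (fun z => - (z * kr th k j)) (BE i k))).
by rewrite (anti k j); ring.
Qed.

End Equivariance.

End OddBracketData.

(** * The spinor representation of K_0 *)

Section TranslationCommutator.
Variable R : realType.
Local Notation C := R[i].
Variables (c d S : 'M[C]_16) (g s : 'I_9 -> 'M[C]_16) (Rm : 'M[C]_9).
Variables (l2 a b : 'I_9 -> C) (m : C) (u : 'cV[C]_16).
Local Notation tr v := (\sum_i ((b i * l2 i) *: (g i *m v) - a i *: (s i *m v))).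
Hypothesis cg : forall i, c *m (g i *m u) - g i *m (d *m u) = s i *m u.
Hypothesis cs : forall i, c *m (s i *m u) - s i *m (d *m u) = - (l2 i *: (g i *m u)).
Hypothesis Sg : forall i, S *m (g i *m u) - g i *m (S *m u) = \sum_j Rm i j *: (g j *m u).
Hypothesis Ss : forall i, S *m (s i *m u) - s i *m (S *m u) = \sum_j Rm i j *: (s j *m u).
Hypothesis Rl : forall i j, Rm i j * l2 i = Rm i j * l2 j.

(** The commutator of the translation part with the rest of the action follows
    from the brackets of cbar, d and the rotation with gamma_i and s(e_i) alone. *)
Lemma translation_commutator :
  m *: (c *m tr u) - S *m tr u - tr (m *: (d *m u) - S *m u) =
  \sum_i ((l2 i * (m * a i - \sum_k b k * Rm k i)) *: (g i *m u) +
          (m * l2 i * b i + \sum_k a k * Rm k i) *: (s i *m u)).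
Proof.
have swap (f : 'I_9 -> C) (X : 'I_9 -> 'M[C]_16) : \sum_i f i *: \sum_j Rm i j *: (X j *m u) =
    \sum_i (\sum_k f k * Rm k i) *: (X i *m u).
  under eq_bigr => i _ do rewrite scaler_sumr.
  rewrite exchange_big /=; apply: eq_bigr => i _; rewrite scaler_suml.
  by apply: eq_bigr => k _; rewrite scalerA.
transitivity (\sum_i ((b i * l2 i) *: (m *: (s i *m u) - \sum_j Rm i j *: (g j *m u)) -
    a i *: (- (m * l2 i) *: (g i *m u) - \sum_j Rm i j *: (s j *m u)))).
  rewrite !mulmx_sumr scaler_sumr -!sumrB; apply: eq_bigr => i _.
  rewrite -Sg -Ss; have := cs i; have := cg i.
  rewrite !(mulmxBr, mulmxDr) -!scalemxAr.
  move: (c *m (g i *m u)) (c *m (s i *m u)) (S *m (g i *m u)) (S *m (s i *m u)) => x1 x2 x3 x4.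
  move: (g i *m (d *m u)) (s i *m (d *m u)) (g i *m (S *m u)) (s i *m (S *m u)) => x5 x6 x7 x8.
  move: (g i *m u) (s i *m u) => v w <- /eqP; rewrite subr_eq => /eqP ->.
  by apply/matrixP => k l; rewrite !mxE; ring.
have -> : \sum_i ((l2 i * (m * a i - \sum_k b k * Rm k i)) *: (g i *m u) +
          (m * l2 i * b i + \sum_k a k * Rm k i) *: (s i *m u)) =
   \sum_i ((m * l2 i * a i) *: (g i *m u) + (m * l2 i * b i) *: (s i *m u)) -
   \sum_i (\sum_k (b k * l2 k) * Rm k i) *: (g i *m u) +
   \sum_i (\sum_k a k * Rm k i) *: (s i *m u).
  rewrite -sumrB -big_split; apply: eq_bigr => i _ /=.
  have -> : \sum_k b k * l2 k * Rm k i = l2 i * \sum_k b k * Rm k i.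
    rewrite mulr_sumr; apply: eq_bigr => k _.
    by transitivity (b k * (Rm k i * l2 k)); [ring|rewrite Rl; ring].
  move: (\sum_k b k * _) (\sum_k a k * _) => y z; move: (g i *m u) (s i *m u) => v w.
  by apply/matrixP => k l; rewrite !mxE; ring.
rewrite -!swap -sumrB -big_split; apply: eq_bigr => i _ /=.
move: (\sum_j _ *: (g j *m u)) (\sum_j _ *: (s j *m u)) => y z; move: (g i *m u) (s i *m u) => v w.
by apply/matrixP => k l; rewrite !mxE; ring.
Qed.

End TranslationCommutator.

Section SpinorAction.
Variable R : realType.
Local Notation C := R[i].
Variables ap am ap' am' : R.
Variable gamma : gammas R.
Hypothesis hgamma : clifford_rep gamma.
Local Notation lam := (lambda ap am ap').
Local Notation cb := (cbar ap am gamma).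
Local Notation dm := (dd ap' am' gamma).
Local Notation sc := (scd ap am ap' am' gamma).
Local Notation Q := (Q1234 gamma).
Local Notation act1 := (act_minus ap am ap' am' gamma).
Local Notation act2 := (act_plus ap' am' gamma).
Local Notation commutator_data := (commutator_data ap am ap').
Local Notation tr th v :=
  (\sum_i ((kb th i * lam i ^+ 2) *: (gamma i *m v) - ka th i *: (sc i *m v))).
Implicit Types (u v : 'cV[C]_16) (i j : 'I_9) (th : kdata R).

Lemma act_plus_linear th a u v : act2 th (a *: u + v) = a *: act2 th u + act2 th v.
Proof.
rewrite /act_plus; move: dm (spin gamma (kr th)) => d S.
rewrite !mulmxDr -!scalemxAr; move: (d *m u) (d *m v) (S *m u) (S *m v) => x1 x2 x3 x4.
by apply/matrixP => k l; rewrite !mxE; ring.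
Qed.

Lemma act_minus_linear th a u1 u2 v1 v2 :
  act1 th (a *: u1 + v1) (a *: u2 + v2) = a *: act1 th u1 u2 + act1 th v1 v2.
Proof.
rewrite /act_minus; move: cb (spin gamma (kr th)) => c S; move: sc => s.
have -> : \sum_i ((kb th i * lam i ^+ 2) *: (gamma i *m (a *: u2 + v2)) -
             ka th i *: (s i *m (a *: u2 + v2))) =
    a *: (\sum_i ((kb th i * lam i ^+ 2) *: (gamma i *m u2) - ka th i *: (s i *m u2))) +
    \sum_i ((kb th i * lam i ^+ 2) *: (gamma i *m v2) - ka th i *: (s i *m v2)).
  rewrite scaler_sumr -big_split; apply: eq_bigr => i _ /=.
  rewrite !mulmxDr -!scalemxAr; move: (gamma i *m u2) (gamma i *m v2) (s i *m u2) (s i *m v2).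
  by move=> x1 x2 x3 x4; apply/matrixP => k l; rewrite !mxE; ring.
move: (\sum_i _) (\sum_i _) => y z.
rewrite !mulmxDr -!scalemxAr; move: (c *m u1) (c *m v1) (S *m u1) (S *m v1) => x1 x2 x3 x4.
by apply/matrixP => k l; rewrite !mxE; ring.
Qed.

Lemma act_plus_kadd a th th' u : act2 (kadd a th th') u = a *: act2 th u + act2 th' u.
Proof.
have er : kr (kadd a th th') = a *: kr th + kr th' by [].
have em : km (kadd a th th') = a * km th + km th' by [].
rewrite /act_plus er em spin_linear.
move: dm (spin gamma (kr th)) (spin gamma (kr th')) => d S S'.
rewrite mulmxDl -scalemxAl; move: (d *m u) (S *m u) (S' *m u) => x1 x2 x3.
by apply/matrixP => k l; rewrite !mxE; ring.
Qed.

Lemma act_minus_kadd a th th' u1 u2 :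
  act1 (kadd a th th') u1 u2 = a *: act1 th u1 u2 + act1 th' u1 u2.
Proof.
have er : kr (kadd a th th') = a *: kr th + kr th' by [].
have em : km (kadd a th th') = a * km th + km th' by [].
rewrite /act_minus er em spin_linear.
move: cb (spin gamma (kr th)) (spin gamma (kr th')) => c S S'; move: sc => s.
rewrite [X in _ + _ *: X = _](_ : _ =
    a *: (\sum_i ((kb th i * lam i ^+ 2) *: (gamma i *m u2) - ka th i *: (s i *m u2))) +
    \sum_i ((kb th' i * lam i ^+ 2) *: (gamma i *m u2) - ka th' i *: (s i *m u2))); last first.
  rewrite scaler_sumr -big_split; apply: eq_bigr => i _ /=.
  move: (gamma i *m u2) (s i *m u2) => x1 x2.
  by apply/matrixP => k l; rewrite !mxE; ring.
move: (\sum_i _) (\sum_i _) => y z.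
rewrite mulmxDl -scalemxAl; move: (c *m u1) (S *m u1) (S' *m u1) => x1 x2 x3.
by apply/matrixP => k l; rewrite !mxE; ring.
Qed.

Lemma act_plus_kbr th th' u : rotation (kr th) -> rotation (kr th') ->
  act2 (commutator_data th th') u = act2 th (act2 th' u) - act2 th' (act2 th u).
Proof.
move=> hr hr'; have er : kr (commutator_data th th') = kr th *m kr th' - kr th' *m kr th by [].
have em : km (commutator_data th th') = 0 by [].
rewrite /act_plus er em.
have e := spin_spin hgamma hr' hr.
have e1 := spin_dd ap' am' hgamma hr; have e2 := spin_dd ap' am' hgamma hr'.
rewrite -{}e; move: dm (spin gamma (kr th)) (spin gamma (kr th')) e1 e2 => d S S'.
rewrite -!mulmxE => e1 e2.
have f1 w : S *m (d *m w) = d *m (S *m w) by rewrite !mulmxA e1.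
have f2 w : S' *m (d *m w) = d *m (S' *m w) by rewrite !mulmxA e2.
rewrite !mulmxBr mulmxBl -!scalemxAr f1 f2 -!mulmxA.
move: (d *m (d *m u)) (d *m (S *m u)) (d *m (S' *m u)) (S *m (S' *m u)) => x1 x2 x3 x4.
by move: (S' *m (S *m u)) => x5; apply/matrixP => k l; rewrite !mxE; ring.
Qed.

Lemma translation_act th th' u : rotation (kr th) -> Q *m u = u ->
  km th *: (cb *m tr th' u) - spin gamma (kr th) *m tr th' u - tr th' (act2 th u) =
  \sum_i ((lam i ^+ 2 * (km th * ka th' i - \sum_k kb th' k * kr th k i)) *: (gamma i *m u) +
     (km th * lam i ^+ 2 * kb th' i + \sum_k ka th' k * kr th k i) *: (sc i *m u)).
Proof.
move=> hr Qu; rewrite /act_plus.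
have cs i := curvature_act ap am ap' am' hgamma i Qu.
have cg i := esym (scd_mul ap am ap' am' gamma i u).
have h1 i := spin_gamma hgamma i hr.
have h2 i := spin_scd ap am ap' am' hgamma i hr.
have Sg i : spin gamma (kr th) *m (gamma i *m u) - gamma i *m (spin gamma (kr th) *m u) =
    \sum_j kr th i j *: (gamma j *m u).
  have := h1 i; move: (spin gamma (kr th)) => S; rewrite -!mulmxE => h.
  rewrite !mulmxA -mulmxBl h mulmx_suml; apply: eq_bigr => j _; by rewrite scalemxAl.
have Ss i : spin gamma (kr th) *m (sc i *m u) - sc i *m (spin gamma (kr th) *m u) =
    \sum_j kr th i j *: (sc j *m u).
  have := h2 i; move: (spin gamma (kr th)) => S; move: sc => s; rewrite -!mulmxE => h.
  rewrite !mulmxA -mulmxBl h mulmx_suml; apply: eq_bigr => j _; by rewrite scalemxAl.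
exact: translation_commutator cg cs Sg Ss (fun i j => rotation_lam2 ap am ap' i j hr).
Qed.

Lemma affine_commutator (c S S' : 'M[C]_16) (m m' q : C) (u w1 w2 w3 w4 : 'cV[C]_16) :
  S * c = c * S -> S' * c = c * S' ->
  0 *: (c *m u) - (S' * S - S * S') *m u +
    q *: ((m *: (c *m w1) - S *m w1 - w3) - (m' *: (c *m w2) - S' *m w2 - w4)) =
  (m *: (c *m (m' *: (c *m u) - S' *m u + q *: w1)) -
     S *m (m' *: (c *m u) - S' *m u + q *: w1) + q *: w4) -
  (m' *: (c *m (m *: (c *m u) - S *m u + q *: w2)) -
     S' *m (m *: (c *m u) - S *m u + q *: w2) + q *: w3).
Proof.
rewrite -!mulmxE => e1 e2.
have f1 w : S *m (c *m w) = c *m (S *m w) by rewrite !mulmxA e1.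
have f2 w : S' *m (c *m w) = c *m (S' *m w) by rewrite !mulmxA e2.
rewrite !(mulmxBr, mulmxDr) mulmxBl -!scalemxAr f1 f2 -!mulmxA.
move: (c *m (c *m u)) (c *m (S *m u)) (c *m (S' *m u)) (S *m (S' *m u)) => x1 x2 x3 x4.
move: (S' *m (S *m u)) (c *m w1) (S *m w1) (c *m w2) (S' *m w2) (c *m u) => x5 x6 x7 x8 x9 x10.
by apply/matrixP => k l; rewrite !mxE; ring.
Qed.

Lemma act_minus_kbr th th' u1 u2 : rotation (kr th) -> rotation (kr th') -> Q *m u2 = u2 ->
  act1 (commutator_data th th') u1 u2 =
  act1 th (act1 th' u1 u2) (act2 th' u2) - act1 th' (act1 th u1 u2) (act2 th u2).
Proof.
move=> hr hr' Qu.
have t1 := translation_act th' hr Qu; have t2 := translation_act th hr' Qu.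
have e := spin_spin hgamma hr' hr.
have e1 := spin_cbar ap am hgamma hr; have e2 := spin_cbar ap am hgamma hr'.
have er : kr (commutator_data th th') = kr th *m kr th' - kr th' *m kr th by [].
have em : km (commutator_data th th') = 0 by [].
rewrite /act_minus er em -{}e.
have -> : tr (commutator_data th th') u2 =
    (km th *: (cb *m tr th' u2) - spin gamma (kr th) *m tr th' u2 - tr th' (act2 th u2)) -
    (km th' *: (cb *m tr th u2) - spin gamma (kr th') *m tr th u2 - tr th (act2 th' u2)).
  apply: etrans _ (esym (congr2 (fun a b => a - b) t1 t2)); apply: etrans _ (sumrB _ _ _ _).
  apply: eq_bigr => i _.
  rewrite /= !sumrB; move: (\sum_k _) (\sum_k _) (\sum_k _) (\sum_k _) => y1 y2 y3 y4.
  move: (gamma i *m u2) (sc i *m u2) => x1 x2.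
  by apply/matrixP => k l; rewrite !mxE; ring.
exact: (affine_commutator _ _ _ _ _ _ _ _ e1 e2).
Qed.

End SpinorAction.

(** * The odd-odd bracket as a Killing field *)

Section OddBracketField.
Variable R : realType.
Local Notation C := R[i].
Variables ap am ap' am' : R.
Variable gamma : gammas R.
Variable CV : 'cV[C]_16 -> 'cV[C]_16 -> C.
Hypothesis hgamma : clifford_rep gamma.
Hypothesis hCV : charge_conjugation gamma CV.
Hypothesis lam_neq0 : forall i, lambda ap am ap' i != 0.
Local Notation lam := (lambda ap am ap').
Local Notation Q := (Q1234 gamma).
Local Notation T := (T125 gamma).
Local Notation sq2 := (Num.sqrt 2 : R)%:C.
Local Notation act1 := (act_minus ap am ap' am' gamma).
Local Notation act2 := (act_plus ap' am' gamma).
Local Notation KV := (KV ap am ap').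
Local Notation commutator_data := (commutator_data ap am ap').
Local Notation bracket_data := (bracket_data ap am ap' gamma CV).
Local Notation cp := (pair_g gamma CV).
Local Notation cn := (pair_Tg gamma CV).
Local Notation wedge := (wedge gamma CV).
Implicit Types (u v w x y : 'cV[C]_16) (i j k : 'I_9) (th : kdata R).

Lemma bracket_data_equivariant th x1 x2 y1 y2 : rotation (kr th) -> Q *m x2 = x2 -> Q *m y2 = y2 ->
  commutator_data th (bracket_data x1 x2 y1 y2) =
  kadd 1 (bracket_data (act1 th x1 x2) (act2 th x2) y1 y2) (bracket_data x1 x2 (act1 th y1 y2) (act2 th y2)).
Proof.
move=> hr Qx Qy; apply: kdata_ext.
- apply: etrans (esym (equivariant_m ap am ap' am' hgamma hCV x1 x2 y1 y2 hr)) _.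
  by congr (_ + _); exact: esym (mul1r _).
- apply: etrans (esym (equivariant_c am' hgamma hCV lam_neq0 x1 y1 hr Qx Qy)) _.
  by congr (_ + _); exact: esym (mul1r _).
- move=> i; apply: etrans (esym (equivariant_a am' hgamma hCV lam_neq0 x1 y1 hr Qx Qy i)) _.
  by congr (_ + _); exact: esym (mul1r _).
- move=> i; apply: etrans (esym (equivariant_b am' hgamma hCV lam_neq0 x1 y1 hr Qx Qy i)) _.
  by congr (_ + _); exact: esym (mul1r _).
- apply: etrans (esym (equivariant_r ap am ap' am' hgamma hCV x1 y1 hr Qx Qy)) _.
  by congr (_ + _); exact: esym (scale1r _).
Qed.

Lemma kr_bracket_data x1 x2 y1 y2 i j :
  kr (bracket_data x1 x2 y1 y2) i j = lam i / sq2 * wedge i j x2 y2.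
Proof. exact: mxE. Qed.

Lemma bracket_data_sym x1 x2 y1 y2 : bracket_data x1 x2 y1 y2 = bracket_data y1 y2 x1 x2.
Proof.
have hkr : kr (bracket_data x1 x2 y1 y2) = kr (bracket_data y1 y2 x1 x2).
  apply/matrixP => i j; apply: etrans (kr_bracket_data _ _ _ _ _ _) _.
  apply: etrans _ (esym (kr_bracket_data _ _ _ _ _ _)); congr (_ * _).
  exact: (wedgeC hgamma hCV).
apply: kdata_ext; last exact: hkr.
- by rewrite /=; congr (_ * _); exact: (CV_sym hCV).
- by rewrite /=; congr (_ * _); exact: (CV_sym hCV).
- by move=> i; rewrite /=; congr (_ * _); exact: addrC.
- by move=> i; rewrite /=; congr (_ * _); exact: addrC.
Qed.

Lemma bracket_data_linear a x1 x2 z1 z2 y1 y2 :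
  bracket_data (a *: x1 + z1) (a *: x2 + z2) y1 y2 = kadd a (bracket_data x1 x2 y1 y2) (bracket_data z1 z2 y1 y2).
Proof.
have ll u w v : CV (a *: u + w) v = a * CV u v + CV w v := cc_linear_l hCV v a u w.
have lr i u w v : CV v (gamma i *m (a *: u + w)) =
    a * CV v (gamma i *m u) + CV v (gamma i *m w).
  by rewrite mulmxDr -scalemxAr (cc_linear_r hCV).
have lt i u w v : CV v (T *m (gamma i *m (a *: u + w))) =
    a * CV v (T *m (gamma i *m u)) + CV v (T *m (gamma i *m w)).
  by rewrite !mulmxDr -!scalemxAr (cc_linear_r hCV).
have hkr : kr (bracket_data (a *: x1 + z1) (a *: x2 + z2) y1 y2) =
    a *: kr (bracket_data x1 x2 y1 y2) + kr (bracket_data z1 z2 y1 y2).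
  have e (M N : 'M[C]_9) i j : (a *: M + N) i j = a * M i j + N i j by rewrite !mxE.
  apply/matrixP => i j; apply: etrans (kr_bracket_data _ _ _ _ _ _) _.
  apply: etrans _ (esym (e _ _ i j)).
  apply: etrans _ (esym (congr2 (fun b c => a * b + c) (kr_bracket_data _ _ _ _ i j) (kr_bracket_data _ _ _ _ i j))).
  rewrite /wedge /pair_gTg (ll x2 z2) (ll x2 z2).
  have re (l b1 b2 b3 b4 : C) : l * (a * b1 + b3 - (a * b2 + b4)) =
    a * (l * (b1 - b2)) + l * (b3 - b4) by ring.
  exact: re.
apply: kdata_ext; last exact: hkr.
- by rewrite /= ll; ring.
- by rewrite /= ll; ring.
- by move=> i; rewrite /= /pair_g lr ll; ring.
- by move=> i; rewrite /= /pair_Tg lt ll; ring.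
Qed.

Lemma GammaI_block (s : seq 'I_9) : uniq s ->
  GammaI gamma s = block_mx ((-1) ^+ size s *: blade gamma s) 0 0 (blade gamma s).
Proof.
move=> us; rewrite /GammaI us {us}; elim: s => [|k s IH].
  by rewrite big_nil /blade big_nil expr0 scale1r -scalar_mx_block.
rewrite big_cons IH /Gamma blade_cons mulmx_block !mul0mx !mulmx0 !addr0 !add0r.
congr (block_mx _ _ _ _).
by rewrite mulNmx -scalemxAr exprS mulN1r scaleNr.
Qed.

Lemma Cform_col (a b c d : 'cV[C]_16) :
  Cform CV (col_mx a b) (col_mx c d) = - ('i * CV a d) + 'i * CV b c.
Proof. by rewrite /Cform !col_mxKu !col_mxKd. Qed.

Lemma CV0l v : CV 0 v = 0.
Proof. by rewrite (CV_sym hCV) (CV0r hCV). Qed.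

Lemma Cform_Gm x y : Cform CV (in_Sm x) (Gamma_m R *m in_Sm y) = 'i * sq2 * CV x y.
Proof.
rewrite /Gamma_m /in_Sm -scalemxAl mul_block_col ?mul0mx ?mulmx0 ?addr0 mulNmx mul1mx.
rewrite scale_col_mx scaler0 Cform_col (CV0r hCV) scalerN (CVNr hCV) (CVZr hCV); ring.
Qed.

Lemma Cform_Gp (M : 'M[C]_(16 + 16)) (A B : 'M[C]_16) x y : M = block_mx A 0 0 B ->
  Cform CV (in_Sp x) (Gamma_p R *m M *m in_Sp y) = 'i * sq2 * CV x (B *m y).
Proof.
move=> ->; rewrite /Gamma_p /in_Sp -!scalemxAl mulmx_block mul_block_col.
rewrite ?mul0mx ?mulmx0 ?addr0 ?add0r mul1mx mul0mx.
by rewrite scale_col_mx scaler0 Cform_col (CV0r hCV) (CVZr hCV); ring.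
Qed.

Lemma Cform_block (A B : 'M[C]_16) x y :
  Cform CV (in_Sm x) (block_mx A 0 0 B *m in_Sp y) = - 'i * CV x (B *m y).
Proof.
by rewrite /in_Sm /in_Sp mul_block_col ?mul0mx ?mulmx0 ?addr0 ?add0r Cform_col CV0l; ring.
Qed.

Lemma Cform_Gi i x y : Cform CV (in_Sm x) (Gamma gamma i *m in_Sp y) = - 'i * cp i x y.
Proof. exact: Cform_block. Qed.

Lemma Cform_G125i i x y :
  Cform CV (in_Sm x) (GammaI gamma (labs [:: 1; 2; 5]%N) *m Gamma gamma i *m in_Sp y) =
  - 'i * cn i x y.
Proof.
rewrite GammaI_block ?uniq_labs // -T125E /Gamma mulmx_block ?mul0mx ?mulmx0 ?addr0 ?add0r.
by rewrite Cform_block /pair_Tg mulmxA.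
Qed.

(** The blocks {1,2} and {3,4} have one generator each; the double sum over
    {6,..,9} counts each generator twice, hence the factor 1/2. *)
Lemma rotation_expand (S : 'M[C]_9) : rotation S ->
  S = S (lab 1) (lab 2) *: (delta_mx (lab 1) (lab 2) - delta_mx (lab 2) (lab 1)) +
   (S (lab 3) (lab 4) *: (delta_mx (lab 3) (lab 4) - delta_mx (lab 4) (lab 3)) +
    \sum_(j <- labs [:: 6; 7; 8; 9]%N) \sum_(k <- labs [:: 6; 7; 8; 9]%N)
      (2^-1 * S j k) *: (delta_mx j k - delta_mx k j)).
Proof.
move=> [anti van]; set s := labs [:: 6; 7; 8; 9]%N.
have us : uniq s by rewrite uniq_labs.
have pick (F : 'I_9 -> C) a : \sum_(k <- s) F k * (a == k)%:R = (a \in s)%:R * F a.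
  case: (boolP (a \in s)) => [ain|anin].
    rewrite (bigD1_seq a) //= eqxx mulr1 mul1r big1 ?addr0 // => k ka.
    by rewrite eq_sym (negPf ka) mulr0.
  rewrite mul0r big1_seq // => k /= ks; case: eqP => [e|_]; last by rewrite mulr0.
  by rewrite e ks in anin.
have E a b : (\sum_(j <- s) \sum_(k <- s)
      (2^-1 * S j k) *: (delta_mx j k - delta_mx k j : 'M[C]_9)) a b =
    (a \in s)%:R * ((b \in s)%:R * S a b).
  rewrite summxE.
  transitivity (\sum_(j <- s) ((a == j)%:R * \sum_(k <- s) (2^-1 * S j k) * (b == k)%:R
     - (b == j)%:R * \sum_(k <- s) (2^-1 * S j k) * (a == k)%:R)).
    apply: eq_bigr => j _; rewrite summxE !mulr_sumr -sumrB; apply: eq_bigr => k _.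
    by rewrite !mxE -!mulnb !natrM; ring.
  under eq_bigr => j _ do rewrite !pick.
  rewrite sumrB.
  rewrite (eq_bigr (fun j => (b \in s)%:R * (2^-1 * S j b) * (a == j)%:R)); last by move=> j _; rewrite mulrC.
  rewrite [X in _ - X](eq_bigr (fun j => (a \in s)%:R * (2^-1 * S j a) * (b == j)%:R)); last by move=> j _; rewrite mulrC.
  by rewrite !pick (anti a b); field.
apply/matrixP => a b; rewrite [RHS]mxE [X in _ = _ + X]mxE E !mxE.
have h0 : ~~ rot_pair a b -> S a b = 0 := van a b.
have hd : a == b -> S a b = 0.
  move=> /eqP ->; have /eqP := anti b b.
  by rewrite -addr_eq0 -mulr2n mulrn_eq0 => /eqP.
have hp (k l : nat) : (a == lab k) && (b == lab l) -> S a b = S (lab k) (lab l).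
  by move=> /andP[/eqP -> /eqP ->].
have hm (k l : nat) : (a == lab k) && (b == lab l) -> S a b = - S (lab l) (lab k).
  by move=> /andP[/eqP -> /eqP ->].
have h1 := hp 1%N 2%N; have h2 := hm 2%N 1%N; have h3 := hp 3%N 4%N; have h4 := hm 4%N 3%N.
move: {hp hm} (S (lab 1) (lab 2)) (S (lab 3) (lab 4)) (S a b) h4 h3 h2 h1 h0 hd => c1 c3 w.
rewrite /s rot_pairE !eq_lab // !mem_labs // -(val_eqE a b) /=.
move: (nat_of_ord a) (nat_of_ord b) (ltn_ord a) (ltn_ord b) => {E pick us anti van} {}a {}b ha hb.
(* h0 settles the pairs in different blocks, hd the diagonal ones *)
case: a ha => [|[|[|[|[|[|[|[|[|a]]]]]]]]] //= _;
case: b hb => [|[|[|[|[|[|[|[|[|b]]]]]]]]] //= _ h4 h3 h2 h1 h0 hd;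
first [rewrite (h0 isT)|rewrite (hd isT)|rewrite (h1 isT)|rewrite (h2 isT)|
       rewrite (h3 isT)|rewrite (h4 isT)|idtac]; rewrite ?mulr0n ?mulr1n; ring.
Qed.


Lemma blade_act k s v : blade gamma (k :: s) *m v = gamma k *m (blade gamma s *m v).
Proof. by rewrite blade_cons -mulmxE mulmxA. Qed.

Lemma blade_nil v : blade gamma [::] *m v = v.
Proof. by rewrite /blade big_nil mul1mx. Qed.

Lemma gamma_sq_act i v : gamma i *m (gamma i *m v) = - v.
Proof.
have := gamma_sq hgamma i; rewrite -!mulmxE => e.
by rewrite mulmxA e mulNmx mul1mx.
Qed.

Lemma gamma_swap i j v : i != j -> gamma i *m (gamma j *m v) = - (gamma j *m (gamma i *m v)).
Proof. by move=> ij; rewrite (gamma_anti_act hgamma) (negPf ij) mulr0 oppr0 scale0r sub0r. Qed.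

Lemma lab_neq (k l : nat) : (0 < k <= 9)%N -> (0 < l <= 9)%N -> k != l -> lab k != lab l.
Proof.
move=> hk hl; apply: contraNneq => /eqP; rewrite eq_lab //.
by have /eqP : lab k == lab k by []; move=> _; rewrite /lab inordK -1?ltnS ?prednK //;
   case/andP: hk.
Qed.

(** Moving T to the left past generators of one block produces equal signs. *)
Lemma wedge_same i j x y : i != j -> comm125 i = comm125 j ->
  wedge i j x y = 2 * (-1) ^+ (~~ comm125 i) * CV x (T *m (gamma i *m (gamma j *m y))).
Proof.
move=> ij h; rewrite /wedge /pair_gTg !(gamma_T_act hgamma) -h (gamma_swap y (i := j)) 1?eq_sym //.
by rewrite mulmxN scalerN (CVNr hCV) opprK (CVZr hCV); ring.
Qed.

Lemma wedge12 x y : wedge (lab 1) (lab 2) x y = - 2 * CV x (blade gamma (labs [:: 5]%N) *m y).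
Proof.
have n12 : lab 1 != lab 2 by exact: lab_neq.
have n52 : lab 5 != lab 2 by exact: lab_neq.
have n51 : lab 5 != lab 1 by exact: lab_neq.
have n21 : lab 2 != lab 1 by exact: lab_neq.
have [c1 c2] : comm125 (lab 1) /\ comm125 (lab 2) by rewrite /comm125 /lab !inordK.
rewrite wedge_same ?c1 ?c2 // expr0.
rewrite T125E /= !blade_act !blade_nil (gamma_swap _ n51) (gamma_swap _ n52) !mulmxN.
rewrite opprK (gamma_swap _ n21) !mulmxN !gamma_sq_act.
by rewrite opprK (CVNr hCV) mulr1 mulrN mulNr.
Qed.

Lemma wedge34 x y : wedge (lab 3) (lab 4) x y =
  - 2 * CV x (blade gamma (labs [:: 1; 2; 3; 4; 5]%N) *m y).
Proof.
have n34 : lab 3 != lab 4 by exact: lab_neq.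
have n53 : lab 5 != lab 3 by exact: lab_neq.
have n54 : lab 5 != lab 4 by exact: lab_neq.
have [c3 c4] : comm125 (lab 3) = false /\ comm125 (lab 4) = false.
  by rewrite /comm125 /lab !inordK.
rewrite wedge_same ?c3 ?c4 // expr1.
rewrite T125E /= !blade_act !blade_nil (gamma_swap _ n53) (gamma_swap _ n54) !mulmxN opprK.
by rewrite mulrN mulr1.
Qed.

Lemma wedge_block j k x y : j \in labs [:: 6; 7; 8; 9]%N -> k \in labs [:: 6; 7; 8; 9]%N ->
  wedge j k x y = if uniq (labs [:: 1; 2; 5]%N ++ [:: j; k]) then
    - 2 * CV x (blade gamma (labs [:: 1; 2; 5]%N ++ [:: j; k]) *m y) else 0.
Proof.
move=> hj hk; have cj i : i \in labs [:: 6; 7; 8; 9]%N -> comm125 i = false.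
  by rewrite mem_labs // /comm125; case: i => [[|[|[|[|[|[|[|[|[|i]]]]]]]]] hi].
have nj i : i \in labs [:: 6; 7; 8; 9]%N -> i \notin labs [:: 1; 2; 5]%N.
  by rewrite !mem_labs //; case: i => [[|[|[|[|[|[|[|[|[|i]]]]]]]]] hi].
have [<-|jk] := eqVneq j k.
  rewrite /wedge subrr; case: ifP => //.
  by rewrite cat_uniq => /and3P[_ _]; rewrite cons_uniq inE eqxx.
have -> : uniq (labs [:: 1; 2; 5]%N ++ [:: j; k]).
  rewrite cat_uniq; apply/and3P; split; [by rewrite uniq_labs| |by rewrite /= inE jk].
  apply/hasPn => i.
  by move=> ik; apply: nj; move: ik; rewrite in_cons mem_seq1 => /orP[]/eqP ->.
rewrite wedge_same ?cj // expr1 T125E /= !blade_act !blade_nil.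
by rewrite mulrN mulr1.
Qed.

(** The imaginary units from C and from the prefactors cancel up to sign. The entries
    of the rotation are evaluated by [wedge12], [wedge34] and [wedge_block], and its
    generators are collected by [rotation_expand]. *)
Lemma odd_bracketE x1 x2 y1 y2 : Q *m x2 = x2 -> Q *m y2 = y2 ->
  odd_bracket ap am ap' gamma CV x1 x2 y1 y2 = KV (bracket_data x1 x2 y1 y2).
Proof.
move=> Qx Qy; have rB := rotation_bracket_data ap am ap' hgamma hCV x1 y1 Qx Qy.
have i2 : 'i * 'i = -1 :> C by rewrite -expr2 sqrCi.
have s2 : sq2 * sq2 = 2 :> C := sq2_sq R.
have s0 := sq2_neq0 R.
have hGp s : uniq s -> Cform CV (in_Sp x2) (Gamma_p R *m GammaI gamma s *m in_Sp y2) =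
    'i * sq2 * CV x2 (blade gamma s *m y2).
  by move=> us; apply: Cform_Gp; exact: GammaI_block.
have c12 : 'i * lam (lab 1) * Cform CV (in_Sp x2)
     (Gamma_p R *m GammaI gamma (labs [:: 5]%N) *m in_Sp y2) =
    kr (bracket_data x1 x2 y1 y2) (lab 1) (lab 2).
  rewrite kr_bracket_data wedge12 hGp ?uniq_labs //; move: (CV x2 _) => z.
  transitivity ('i * 'i * sq2 * lam (lab 1) * z); first by ring.
  by rewrite i2 -s2; field.
have c34 : 'i * lam (lab 3) * Cform CV (in_Sp x2)
     (Gamma_p R *m GammaI gamma (labs [:: 1; 2; 3; 4; 5]%N) *m in_Sp y2) =
    kr (bracket_data x1 x2 y1 y2) (lab 3) (lab 4).
  rewrite kr_bracket_data wedge34 hGp ?uniq_labs //; move: (CV x2 _) => z.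
  transitivity ('i * 'i * sq2 * lam (lab 3) * z); first by ring.
  by rewrite i2 -s2; field.
have c6 j k : j \in labs [:: 6; 7; 8; 9]%N -> k \in labs [:: 6; 7; 8; 9]%N ->
    'i * lam (lab 6) / 2 * Cform CV (in_Sp x2)
     (Gamma_p R *m GammaI gamma (labs [:: 1; 2; 5]%N ++ [:: j; k]) *m in_Sp y2) =
    2^-1 * kr (bracket_data x1 x2 y1 y2) j k.
  move=> hj hk; rewrite kr_bracket_data wedge_block //; have -> : lam (lab 6) = lam j.
    have [->|n6j] := eqVneq j (lab 6); first by [].
    apply: (rot_pair_lam ap am ap'); rewrite /rot_pair /has.
    by rewrite (_ : lab 6 \in labs [:: 6; 7; 8; 9]%N) ?hj ?orbT // mem_labs // /lab inordK.
  case: ifP => us; last first.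
    by rewrite /GammaI us mulmx0 mul0mx /in_Sp /Cform linear0 (CV0r hCV) linear0 (CV0r hCV); ring.
  rewrite hGp //; move: (CV x2 _) => z.
  transitivity ('i * 'i * sq2 * lam j / 2 * z); first by field.
  by rewrite i2 -s2; field.
have rot2 (r r' : seq 'I_9) (f : 'I_9 -> 'I_9 -> C) : KV_rot ap am ap'
    (\sum_(j <- r) \sum_(k <- r') f j k *: (delta_mx j k - delta_mx k j)) =
    \sum_(j <- r) \sum_(k <- r') f j k *: @K_ij R j k.
  elim: r => [|j r IH]; first by rewrite !big_nil KV_rot0.
  rewrite !big_cons -[\sum_(k <- r') _ in LHS]scale1r KV_rot_linear scale1r IH.
  by congr (_ + _); exact: (KV_rot_sum ap am ap' r' (f j) (fun=> j) id).
set th := bracket_data x1 x2 y1 y2.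
transitivity (kc th *: @K_p R + km th *: @K_m R
  + \sum_i ka th i *: K_i ap am ap' i + \sum_i kb th i *: K_is ap am ap' i +
  (kr th (lab 1) (lab 2) *: @K_ij R (lab 1) (lab 2) +
  (kr th (lab 3) (lab 4) *: @K_ij R (lab 3) (lab 4) +
   \sum_(j <- labs [:: 6; 7; 8; 9]%N) \sum_(k <- labs [:: 6; 7; 8; 9]%N)
     (2^-1 * kr th j k) *: @K_ij R j k))); last first.
  rewrite -rot2 -(KV_kij ap am ap' (lab 3)) -(KV_kij ap am ap' (lab 1)) -!KV_rot_linear.
  by rewrite -rotation_expand // -KV_split.
apply/funext => p; rewrite /odd_bracket c12 c34 {c12 c34}.
rewrite -[RHS]/(kc th *: K_p p + km th *: K_m p + (\sum_i ka th i *: K_i ap am ap' i) p +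
  (\sum_i kb th i *: K_is ap am ap' i) p +
  (kr th (lab 1) (lab 2) *: K_ij (lab 1) (lab 2) p +
   (kr th (lab 3) (lab 4) *: K_ij (lab 3) (lab 4) p +
    (\sum_(j <- labs [:: 6; 7; 8; 9]%N) \sum_(k <- labs [:: 6; 7; 8; 9]%N)
     (2^-1 * kr th j k) *: @K_ij R j k) p))).
have re (v1 v2 v3 v4 w1 w2 w3 w4 z5 z6 z7 t7 : 'cV[C]_11) : v1 = w1 -> v2 = w2 ->
    v3 = w3 -> v4 = w4 -> z7 = t7 ->
    v1 + v2 + v3 + v4 + z5 + z6 + z7 = w1 + w2 + w3 + w4 + (z5 + (z6 + t7)).
  by move=> -> -> -> -> ->; rewrite !addrA.
apply: re.
- by rewrite Cform_Gm.
- congr (_ *: _); have := Cform_Gp x2 y2 (scalar_mx_block 16 16 (1 : C)).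
  by rewrite mulmx1 mul1mx.
- rewrite fct_sumE; apply: eq_bigr => i _; congr (_ *: _).
  by rewrite !Cform_Gi -mulrDr.
- rewrite fct_sumE; apply: eq_bigr => i _; congr (_ *: _).
  rewrite !Cform_G125i -mulrDr /=; move: (cn i x1 y2 + cn i y1 x2) => z.
  transitivity (- ('i * 'i) * ((lam i)^-1 * z)); first by ring.
  by rewrite i2 opprK mul1r.
- rewrite fct_sumE scaler_sumr; apply: eq_big_seq => j hj.
  rewrite fct_sumE scaler_sumr; apply: eq_big_seq => k hk.
  by rewrite scalerA c6.
Qed.



End OddBracketField.

(** * The superalgebra *)

Section Superalgebra.
Variable R : realType.
Local Notation C := R[i].
Variables ap am ap' am' : R.
Variable gamma : gammas R.
Variable CV : 'cV[C]_16 -> 'cV[C]_16 -> C.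
Hypothesis hgamma : clifford_rep gamma.
Hypothesis hCV : charge_conjugation gamma CV.
Hypothesis lam_neq0 : forall i, lambda ap am ap' i != 0.
Local Notation Q := (Q1234 gamma).
Local Notation act1 := (act_minus ap am ap' am' gamma).
Local Notation act2 := (act_plus ap' am' gamma).
Local Notation KV := (KV ap am ap').
Local Notation commutator_data := (commutator_data ap am ap').
Local Notation bracket_data := (bracket_data ap am ap' gamma CV).
Local Notation xi := (xi_field ap am ap' am' gamma).
Local Notation lieD := (lieD ap am ap' gamma).
Implicit Types (u v : 'cV[C]_16) (th : kdata R) (f g : sfield R).

Lemma xi_linear a u1 u2 v1 v2 : xi (a *: u1 + v1) (a *: u2 + v2) = a *: xi u1 u2 + xi v1 v2.
Proof. exact: gxi_linear. Qed.

Lemma xi_sub u1 u2 v1 v2 : xi u1 u2 - xi v1 v2 = xi (u1 - v1) (u2 - v2).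
Proof.
apply: etrans (addrC _ _) _; rewrite -scaleN1r; apply: etrans (esym (xi_linear _ _ _ _ _)) _.
by rewrite !scaleN1r; congr xi; exact: addrC.
Qed.

(** The condition X^- u2 = 0 says that Q fixes u2. *)
Lemma K1E : K1 ap am ap' am' gamma =
  [set f | exists u1 u2, Q *m u2 = u2 /\ f = xi u1 u2]%classic.
Proof.
apply/seteqP; split => f [u1 [u2 [h ->]]]; exists u1, u2; split=> //; first exact: Xm0_Q.
exact: Q_Xm0.
Qed.

Lemma Q_linear a u v : Q *m u = u -> Q *m v = v -> Q *m (a *: u + v) = a *: u + v.
Proof. by move=> hu hv; rewrite mulmxDr -scalemxAr hu hv. Qed.

Definition xi_bracket f g : vfield R :=
  KV (bracket_data (usubmx (f 0)) (dsubmx (f 0)) (usubmx (g 0)) (dsubmx (g 0))).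

Lemma xi_bracketE x1 x2 y1 y2 : xi_bracket (xi x1 x2) (xi y1 y2) = KV (bracket_data x1 x2 y1 y2).
Proof.
have hc := cbar_diag ap am hgamma; have hd := dd_diag ap' am' hgamma.
have eu u1 u2 : usubmx (xi u1 u2 0) = u1 := gxi_u _ _ hc u1 u2.
have ed u1 u2 : dsubmx (xi u1 u2 0) = u2 := gxi_d _ _ hd u1 u2.
by rewrite /xi_bracket !eu !ed.
Qed.

Lemma superalgebra : geometric_superalgebra (gB ap am ap') (Dconn ap am ap' am' gamma)
  (K0 ap am ap') (K1 ap am ap' am' gamma) lieD xi_bracket.
Proof.
have hL th u1 u2 : rotation (kr th) -> Q *m u2 = u2 ->
    lieD (KV th) (xi u1 u2) = xi (act1 th u1 u2) (act2 th u2) by exact: lieD_xi.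
have hQ th u : rotation (kr th) -> Q *m u = u -> Q *m act2 th u = act2 th u.
  exact: Q_act2.
have hK th th' : rotation (kr th) -> rotation (kr th') -> rotation (kr (commutator_data th th')).
  exact: rotation_comm.
have hA a th th' : rotation (kr th) -> rotation (kr th') -> rotation (kr (kadd a th th')).
  exact: rotation_linear.
rewrite K1E; split.
- exact: lspan_subspace.
- rewrite K0E => X Y [th [hr ->]] [th' [hr' ->]]; exists (commutator_data th th'); split; first exact: hK.
  exact: lie_bracket_KV.
- rewrite K0E => X [th [hr ->]]; exact: killing_KV.
- split.
    exists 0, 0; split; first by rewrite mulmx0.
    have := xi_linear (-1) 0 0 0 0; by rewrite !scaleN1r !addNr => ->.
  move=> a f g [u1 [u2 [hu ->]]] [v1 [v2 [hv ->]]].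
  exists (a *: u1 + v1), (a *: u2 + v2); split; first exact: Q_linear.
  by rewrite xi_linear.
- by move=> f [u1 [u2 [hu ->]]]; exact: xi_parallel.
- rewrite K0E => X f [th [hr ->]] [u1 [u2 [hu ->]]].
  exists (act1 th u1 u2), (act2 th u2); split; first exact: hQ.
  exact: hL.
- rewrite K0E => X a f g [th [hr ->]] [u1 [u2 [hu ->]]] [v1 [v2 [hv ->]]].
  rewrite -xi_linear !hL //; last exact: Q_linear.
  by rewrite act_minus_linear act_plus_linear xi_linear.
- rewrite K0E => a X Y f [th [hr ->]] [th' [hr' ->]] [u1 [u2 [hu ->]]].
  rewrite -KV_linear !hL //; last exact: hA.
  by rewrite act_minus_kadd act_plus_kadd xi_linear.
- rewrite K0E => X Y f [th [hr ->]] [th' [hr' ->]] [u1 [u2 [hu ->]]].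
  rewrite lie_bracket_KV // (hL th' u1 u2 hr' hu) (hL th u1 u2 hr hu).
  rewrite (hL th _ _ hr (hQ _ _ hr' hu)) (hL th' _ _ hr' (hQ _ _ hr hu)).
  rewrite (hL (commutator_data th th') _ _ (hK _ _ hr hr') hu).
  by rewrite xi_sub act_minus_kbr // act_plus_kbr.
- move=> f g [x1 [x2 [Qx ->]]] [y1 [y2 [Qy ->]]]; rewrite xi_bracketE.
  by apply: KV_in_K0; exact: rotation_bracket_data.
- move=> f g [x1 [x2 [Qx ->]]] [y1 [y2 [Qy ->]]]; rewrite !xi_bracketE.
  by congr KV; exact: bracket_data_sym.
- move=> a f g h [x1 [x2 [Qx ->]]] [y1 [y2 [Qy ->]]] [z1 [z2 [Qz ->]]].
  by rewrite -xi_linear !xi_bracketE -KV_linear; congr KV; exact: bracket_data_linear.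
- rewrite K0E => X f g [th [hr ->]] [x1 [x2 [Qx ->]]] [y1 [y2 [Qy ->]]].
  rewrite !hL // !xi_bracketE lie_bracket_KV //; last exact: rotation_bracket_data.
  rewrite (bracket_data_equivariant am' hgamma hCV lam_neq0 x1 y1 hr Qx Qy) KV_linear.
  by rewrite scale1r.
Qed.

End Superalgebra.

Theorem theorem5p6 (R : realType) (ap am ap' am' : R)
    (gamma : gammas R) (CV : 'cV[R[i]]_16 -> 'cV[R[i]]_16 -> R[i])
    (hgamma : clifford_rep gamma)
    (hCV : charge_conjugation gamma CV)
    (hB : indecomposable ap am ap')
    (hD : ~ flat (Dconn ap am ap' am' gamma)) :
  exists br : sfield R -> sfield R -> vfield R,
    (forall xi1 xi2 eta1 eta2 : 'cV[R[i]]_16,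
       Xm gamma *m xi2 = 0 -> Xm gamma *m eta2 = 0 ->
       br (xi_field ap am ap' am' gamma xi1 xi2)
          (xi_field ap am ap' am' gamma eta1 eta2)
       = odd_bracket ap am ap' gamma CV xi1 xi2 eta1 eta2)
    /\ nonrestricted_geometric_superalgebra
         (gB ap am ap') (Dconn ap am ap' am' gamma)
         (K0 ap am ap') (K1 ap am ap' am' gamma)
         (lieD ap am ap' gamma) br.
Proof.
exists (xi_bracket ap am ap' gamma CV); split.
  move=> xi1 xi2 eta1 eta2 /(Xm0_Q) Qx /(Xm0_Q) Qy.
  by rewrite xi_bracketE // odd_bracketE.
split; first by apply: superalgebra => // i; exact: lambda_neq0.
rewrite (K1E ap am ap' am' gamma); apply/seteqP; split => f.
  by move=> [u1 [u2 [hu ->]]]; exact: xi_parallel.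
move=> hf; have Qf := Xm0_Q (nonflat_Xm hgamma hD hf).
by exists (usubmx (f 0)), (dsubmx (f 0)); split; last exact: par_xi.
Qed.
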